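(* Let $(Z_0,Z_1)$ be a coarse simplicial pair of uniformly acyclic complexes, each with bounded geometry. Let $X$ be a coarse $PD(n)$ space and let $f\colon Z_0\to X$ be a coarse embedding. Then there exists a commutative diagram \[ \begin{array}{ccccccccc} \cdots\to & \check H^D_{n-k}(fZ_1^c,fZ_0^c) & \xrightarrow{\partial} & \check{\widetilde H}{}^D_{n-k-1}(fZ_0^c) & \to & \check{\widetilde H}{}^D_{n-k-1}(fZ_1^c) & \to\cdots\\ & \downarrow{\scriptstyle A} & & \downarrow{\scriptstyle A} & & \downarrow{\scriptstyle A} & \\ \cdots\xrightarrow{\delta} & H_c^k(Z_0,Z_1) & \to & H_c^k(Z_0) & \to & H_c^k(Z_1) & \xrightarrow{\delta}\cdots \end{array} \] in which the vertical maps $A$ are the coarse Alexander duality maps and are isomorphisms, and the rows are the homology and cohomology long exact sequences (the top row being the exact sequence induced, by passing to the inverse limit, by the reduced homology long exact sequences of the complementary pairs, and the bottom row being the long exact sequence in compactly supported cohomology of the pair $(Z_0,Z_1)$).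
   Context: All homology and cohomology is simplicial with integer coefficients; $C_\circ(X)$ and $C_c^\circ(X)$ denote simplicial chains and compactly supported simplicial cochains, and $H_c^*$ is compactly supported cohomology. Reduced homology is the homology of the augmented chain complex (so $\widetilde H_{-1}(\varnothing)=\mathbb{Z}$). A metric simplicial complex is a connected, locally finite simplicial complex with the length metric in which each simplex is isometric to the standard Euclidean simplex with edges of length one. It has bounded geometry if vertex links have a uniformly bounded number of simplices. For a subcomplex $K$ and a positive integer $R$, $N_R(K)$ is the $R$-fold iterated closed star of $K$; for a general subset it denotes a metric $R$-tubular neighborhood. A map $f\colon Y\to X$ of metric spaces is a coarse embedding if there are unbounded increasing functions $\rho_\pm\colon\mathbb{R}_{\ge0}\to\mathbb{R}_{\ge0}$ with $\rho_-(d(y_1,y_2))\le d(f(y_1),f(y_2))\le\rho_+(d(y_1,y_2))$ for all $y_1,y_2\in Y$. (It need not be continuous.) A coarse simplicial pair $(Z_0,Z_1)$ is a simplicial pair, $Z_1\subseteq Z_0$, such that $Z_0$ and $Z_1$ are each endowed with a length metric in which each edge has length one, and the inclusion $Z_1\to Z_0$ is a coarse embedding. An $m$-dimensional metric simplicial complex $X$ is uniformly acyclic if for every $j\le m$ and every $R_1>0$ there is $R_2>0$ such that for each subcomplex $K\subset X$ of diameter at most $R_1$ the inclusion $K\to N_{R_2}(K)$ induces zero on $\widetilde H_j$. The support of a subset of $C_\circ(X)$ is the smallest subcomplex carrying it. A homomorphism $h\colon C_i(X)\to C_c^j(X)$ has displacement at most $D$ if for every simplex $\sigma$ the cochain $h(\sigma)$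 is supported in $N_D(\sigma)$. A homomorphism $C_c^j(X)\to C_i(X)$ has displacement at most $D$ if for each simplex $\sigma$ the image of the composition $C_c^j(\bar\sigma)\to C_c^j(X)\to C_i(X)$ has support in $N_D(\sigma)$, where the first map is extension by zero outside $\bar\sigma$. A chain map or chain homotopy $h$ is $D$-controlled if for each simplex $\sigma$ the support of $h(C_\circ(\sigma))$ has diameter at most $D$; similarly for cochain maps and cochain homotopies. A coarse $PD(n)$ space is a bounded geometry, uniformly acyclic, metric simplicial complex $X$ equipped with cochain maps $C_{n-\circ}(X)\xrightarrow{\bar P}C_c^\circ(X)\xrightarrow{P}C_{n-\circ}(X)$ such that for some integer constant $E_0$, both $P$ and $\bar P$ have displacement at most $E_0$, and $\bar P\circ P$ and $P\circ\bar P$ are cochain homotopic to the identity by $E_0$-controlled cochain homotopies. For a subset $K\subseteq X$, a neighborhood of $K$ is a subcomplex $L$ contained in $N_R(K)$ for some $R<\infty$. For subsets $K_1\subseteq K_0$, a neighborhood of $(K_0,K_1)$ is a pair of subcomplexes $L_1\subseteq L_0$ with $L_i\subseteq N_R(K_i)$ for some $R$. Define (inverse limits over neighborhoods directed by inclusion) \[\check{\widetilde H}{}^D_i(K^c)=\varprojlim_{L}\widetilde H_i(\overline{X-L}),\qquad \check H^D_i(K_1^c,K_0^c)=\varprojlim_{(L_0,L_1)}H_i(\overline{X-L_1},\overline{X-L_0}).\] Here $fZ_i^c$ is short for $(f(Z_i))^c$. Coarse Alexander duality maps. A chain map $f_\#\colon C_\circ(Z_0)\to C_\circ(X)$ approximates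 $f$ if it is augmentation preserving and for some $M$, for every simplex $\sigma$ of $Z_0$ the support of $f_\#(C_\circ(\sigma))$ is within Hausdorff distance $M$ of $f(\sigma)$. Such a chain map exists; fix one. Let $K_i$ be the support of $f_\#(C_\circ(Z_i))$, a subcomplex at finite Hausdorff distance from $f(Z_i)$, and set $Y_i^R=\overline{X-N_R(K_i)}$ and $E=E_0+1$. The limits above may be computed along the cofinal sequences $N_R(K_i)$, $R=1,2,\dots$. The map $\bar P$ sends $C_{n-\circ}(Y_i^{R+E})$ into $C_c^\circ(X,N_R(K_i))$, hence induces $C_{n-\circ}(X,Y_i^{R+E})\to C_c^\circ(N_R(K_i))$ and $C_{n-\circ}(Y_1^{R+E},Y_0^{R+E})\to C_c^\circ(N_R(K_0),N_R(K_1))$; the dual of $f_\#$ induces $f^\#\colon C_c^\circ(N_R(K_i))\to C_c^\circ(Z_i)$ and $C_c^\circ(N_R(K_0),N_R(K_1))\to C_c^\circ(Z_0,Z_1)$. The absolute duality map is induced by the composition \[\widetilde H_{n-k-1}(Y_i^{R+E})\xrightarrow{\partial^{-1}}H_{n-k}(X,Y_i^{R+E})\xrightarrow{\bar P}H_c^k(N_R(K_i))\xrightarrow{f^*}H_c^k(Z_i)\] ($\partial$ is an isomorphism since $X$ is acyclic), and the relative duality map is induced by the composition \[H_{n-k}(Y_1^{R+E},Y_0^{R+E})\xrightarrow{\bar P}H_c^k(N_R(K_0),N_R(K_1))\xrightarrow{f^*}H_c^k(Z_0,Z_1).\] These compositions are compatible with the bonding maps for varying $R$, and so each induces a homomorphism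 $A$ from the inverse limit. *)

(* Defs.v *)
From HB Require Import structures.
From mathcomp Require Import all_boot all_order all_algebra generic_quotient ring_quotient.
From mathcomp Require Import finmap.
From mathcomp Require Import boolp classical_sets functions cardinality fsbigop reals.

Set Implicit Arguments.
Unset Strict Implicit.
Unset Printing Implicit Defensive.

Import Order.TTheory GRing.Theory Num.Theory.
Local Open Scope ring_scope.
Local Open Scope classical_set_scope.
Local Open Scope quotient_scope.


(* [subquot Z B] is the abelian group Z / (Z :&: B). *)
Section Subquotient.
Variables (A : zmodType) (Z B : zmodClosed A).

Record cycle := Cycle { cycle_val :> A; _ : cycle_val \in Z }.
HB.instance Definition _ := [isSub for cycle_val].
HB.instance Definition _ := [Choice of cycle by <:].
HB.instance Definition _ := [SubChoice_isSubZmodule of cycle by <:].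

Definition null_cycle : {pred cycle} := fun x => val x \in B.

Fact null_cycle_closed : zmod_closed null_cycle.
Proof.
split=> [|x y]; rewrite -!topredE /= /null_cycle.
  by rewrite raddf0 rpred0.
by rewrite raddfB => ? ?; rewrite rpredB.
Qed.
HB.instance Definition _ :=
  GRing.isZmodClosed.Build cycle null_cycle null_cycle_closed.

Definition subquot := Quotient.quot (null_cycle : zmodClosed cycle).
HB.instance Definition _ := GRing.Zmodule.on subquot.

Definition cls (a : A) : subquot := \pi_(subquot) (insubd (0 : cycle) a).

Definition rep (h : subquot) : A := val (repr h).

Lemma rep_cycle h : rep h \in Z.
Proof. exact: valP. Qed.

Lemma eq_cls a b : a \in Z -> b \in Z -> a - b \in B -> cls a = cls b.
Proof.
move=> aZ bZ abB; apply/eqP; rewrite /cls -Quotient.idealrBE.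
by rewrite -!topredE /= /null_cycle raddfB /= !insubdK.
Qed.

Lemma cls_eq a b : a \in Z -> b \in Z -> cls a = cls b -> a - b \in B.
Proof.
move=> aZ bZ /eqP; rewrite /cls -Quotient.idealrBE.
by rewrite -!topredE /= /null_cycle raddfB /= !insubdK.
Qed.

Lemma repK : cancel rep cls.
Proof. by move=> h; rewrite /cls /rep valKd reprK. Qed.

Lemma clsB : {in Z &, {morph cls : a b / a - b}}.
Proof.
move=> a b aZ bZ; rewrite /cls -raddfB; congr (\pi _); apply: val_inj.
by rewrite raddfB /= !insubdK // rpredB.
Qed.

End Subquotient.

(* The map induced on subquotients by a map [phi]; it is only used for maps
   that are additive on [Z] and send [Z] to [Z'] and [Z :&: B] to [B']. *)
Definition hmap (A A' : zmodType) (Z B : zmodClosed A) (Z' B' : zmodClosed A')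
  (phi : A -> A') (h : subquot Z B) : subquot Z' B' := cls Z' B' (phi (rep h)).
Arguments hmap {A A' Z B Z' B'} phi h.

Lemma hmapB (A A' : zmodType) (Z B : zmodClosed A) (Z' B' : zmodClosed A')
    (phi : A -> A') :
  {in Z &, {morph phi : a b / a - b}} ->
  {homo phi : a / a \in Z >-> a \in Z'} ->
  (forall a, a \in Z -> a \in B -> phi a \in B') ->
  zmod_morphism (@hmap A A' Z B Z' B' phi).
Proof.
move=> phiB phiZ phiN x y; rewrite /hmap -clsB ?phiZ ?rep_cycle //.
rewrite -phiB ?rep_cycle //; apply: eq_cls.
- exact/phiZ/rep_cycle.
- by apply/phiZ; rewrite rpredB ?rep_cycle.
rewrite -phiB ?rpredB ?rep_cycle //; apply: phiN.
  by rewrite !rpredB ?rep_cycle.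
apply: (@cls_eq _ Z); rewrite ?rpredB ?rep_cycle //.
by rewrite repK clsB ?rep_cycle // !repK.
Qed.

Record inverse_system := InverseSystem {
  index :> Type;
  index_le : index -> index -> Prop;
  term : index -> zmodType;
  bond : forall i j, index_le i j -> {additive term j -> term i} }.

Section InverseLimit.
Variable S : inverse_system.

Definition thread := forall i : S, term i.
HB.instance Definition _ := gen_eqMixin thread.
HB.instance Definition _ := gen_choiceMixin thread.

Let thread0 : thread := fun=> 0.
Let threadN (x : thread) : thread := fun i => - x i.
Let threadD (x y : thread) : thread := fun i => x i + y i.

Fact thread_addA : associative threadD.
Proof. by move=> x y z; apply: functional_extensionality_dep => i; exact: addrA. Qed.
Fact thread_addC : commutative threadD.
Proof. by move=> x y; apply: functional_extensionality_dep => i; exact: addrC. Qed.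
Fact thread_add0 : left_id thread0 threadD.
Proof. by move=> x; apply: functional_extensionality_dep => i; exact: add0r. Qed.
Fact thread_addN : left_inverse thread0 threadN threadD.
Proof. by move=> x; apply: functional_extensionality_dep => i; exact: addNr. Qed.
HB.instance Definition _ :=
  GRing.isZmodule.Build thread thread_addA thread_addC thread_add0 thread_addN.

Definition compatible : {pred thread} :=
  fun x => `[< forall i j (le_ij : index_le i j), bond le_ij (x j) = x i >].

Fact compatible_closed : zmod_closed compatible.
Proof.
split=> [|x y]; rewrite -!topredE /= /compatible.
  by apply/asboolP => i j le_ij; rewrite raddf0.
move=> /asboolP xC /asboolP yC; apply/asboolP => i j le_ij.
by rewrite [LHS]raddfB xC yC.
Qed.
HB.instance Definition _ :=
  GRing.isZmodClosed.Build thread compatible compatible_closed.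

Record limit := Limit { limit_val : thread; _ : limit_val \in compatible }.
HB.instance Definition _ := [isSub for limit_val].
HB.instance Definition _ := [Choice of limit by <:].
HB.instance Definition _ := [SubChoice_isSubZmodule of limit by <:].

Definition component (x : limit) (i : S) : term i := val x i.

End InverseLimit.


Section Complexes.
Variables (d : Order.disp_t) (V : orderType d).
Implicit Types (S T K L X : set {fset V}) (s t : {fset V}) (v w : V) (i k : int).

(* A simplicial complex is the set of its (nonempty, finite) simplices. *)
Definition simplicial_complex S :=
  ~ S fset0 /\ forall s t, S s -> (t `<=` s)%fset -> t != fset0 -> S t.

Definition subcomplex K X := simplicial_complex K /\ K `<=` X.

Definition faces s : set {fset V} := [set t | t != fset0 /\ (t `<=` s)%fset].

(* [\overline{X - L}]: the smallest subcomplex of [X] containing the simplices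
   of [X] that are not in [L]. *)
Definition complement X L : set {fset V} :=
  [set t | t != fset0 /\ exists s, [/\ X s, ~ L s & (t `<=` s)%fset]].

(* The augmented chain complex has the empty simplex in degree -1. *)
Definition augmented S : set {fset V} := S `|` [set fset0].

Definition closed_star X K : set {fset V} :=
  [set t | X t /\ exists s v, [/\ X s, (t `<=` s)%fset, v \in s & K [fset v]%fset]].

Definition star_nbhd X (r : nat) K := iter r (closed_star X) K.

(* Chains and cochains are integer functions on simplices, every simplex being
   oriented by the order on [V].  [chains S i] is the group of finitely
   supported functions on the [i]-simplices of [S]: it is both the chain group
   C_i(S), and the cochain group C_c^i(S). *)
Definition cochain := {fset V} -> int.
HB.instance Definition _ := GRing.Zmodule.on cochain.

Definition chains S i : {pred cochain} := fun c =>
  `[< finite_set [set s | c s != 0] /\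
      forall s, c s != 0 -> S s /\ #|` s|%:Z = i + 1 >].

Fact chains_closed S i : zmod_closed (chains S i).
Proof.
split=> [|a b]; rewrite -!topredE /= /chains.
  apply/asboolP; split=> [|s /eqP]; last by [].
  by rewrite (_ : [set _ | _] = set0) // -subset0 => s /eqP [].
move=> /asboolP [finA supA] /asboolP [finB supB]; apply/asboolP.
have ab s : (a - b) s != 0 -> a s != 0 \/ b s != 0.
  have [a0|] := eqVneq (a s) 0; last by left.
  have [b0|] := eqVneq (b s) 0; last by right.
  by rewrite [(a - b) s](_ : _ = a s - b s) // a0 b0 subrr eqxx.
split=> [|s /ab[/supA|/supB] //].
apply: (@sub_finite_set _ _ ([set s | a s != 0] `|` [set s | b s != 0])).
  exact: ab.
by rewrite finite_setU.
Qed.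
HB.instance Definition _ S i :=
  GRing.isZmodClosed.Build cochain (chains S i) (chains_closed S i).

Definition simplex_chain s : cochain := fun t => (t == s)%:R.

Definition incidence s v : int := (-1) ^+ #|` [fset w in s | (w < v)%O]%fset|.

(* The boundary of the simplex [s] is
   \sum_(v in s) incidence s v * (s minus v).  In both operators the simplices
   outside [S] are discarded: the boundary of a vertex is the empty simplex
   when [S] contains it (augmented complexes), and zero otherwise. *)
Definition boundary S (c : cochain) : cochain := fun t =>
  if `[< S t >]
  then \sum_(v \in [set v | v \notin t]) incidence (v |` t)%fset v * c (v |` t)%fset
  else 0.

Definition coboundary S (c : cochain) : cochain := fun s =>
  if `[< S s >] then \sum_(v <- s) incidence s v * c (s `\ v)%fset else 0.

Definition restriction S (c : cochain) : cochain :=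
  fun s => if `[< S s >] then c s else 0.

Definition evaluation (phi c : cochain) : int := \sum_(s \in setT) phi s * c s.

Lemma boundaryB S i : {in chains S i &, {morph boundary S : a b / a - b}}.
Proof.
move=> a b /asboolP [finA supA] /asboolP [finB supB].
apply: functional_extensionality_dep => t; rewrite [RHS](_ : _ = boundary S a t - boundary S b t) //.
rewrite /boundary; case: asboolP => // St.
pose supp := [set s | a s != 0] `|` [set s | b s != 0].
pose D := [set v | v \notin t] `&` \bigcup_(s in supp) [set` s].
have finD : finite_set D.
  apply: (@sub_finite_set _ _ (\bigcup_(s in supp) [set` s])); first by move=> v [].
  by apply: bigcup_finite; rewrite ?finite_setU // => s _; exact: finite_fset.
have sumD (c : cochain) : (forall s, c s != 0 -> supp s) ->
    \sum_(v \in [set v | v \notin t]) incidence (v |` t)%fset v * c (v |` t)%fset =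
    \sum_(v \in D) incidence (v |` t)%fset v * c (v |` t)%fset.
  move=> supc; apply/esym/fsbig_widen => [v [] //|v /= [vt nD]].
  have [->|c0] := eqVneq (c (v |` t)%fset) 0; first by rewrite mulr0.
  by case: nD; split=> //; exists (v |` t)%fset; [exact: supc | exact: fset1U1].
have supab s : (a - b) s != 0 -> supp s.
  have [a0|] := eqVneq (a s) 0; last by left.
  have [b0|] := eqVneq (b s) 0; last by right.
  by rewrite [(a - b) s](_ : _ = a s - b s) // a0 b0 subrr eqxx.
rewrite (sumD _ supab) (sumD a) ?(sumD b); try by [left|right].
by rewrite !fsbig_finite // -sumrB; apply: eq_bigr => v _; rewrite -mulrBr.
Qed.

Lemma coboundaryB S : {morph coboundary S : a b / a - b}.
Proof.
move=> a b; apply: functional_extensionality_dep => s.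
rewrite [RHS](_ : _ = coboundary S a s - coboundary S b s) // /coboundary.
by case: asboolP => // Ss; rewrite -sumrB; apply: eq_bigr => v _; rewrite -mulrBr.
Qed.

(* Relative homology H_i(S, T); absolute homology is the case [T = set0]. *)
Definition relative_cycles S T i : {pred cochain} :=
  fun c => (c \in chains S i) && (boundary S c \in chains T (i - 1)).

Definition relative_boundaries S T i : {pred cochain} := fun c =>
  `[< exists b a,
      [/\ b \in chains S (i + 1), a \in chains T i & c = boundary S b + a] >].

Fact relative_cycles_closed S T i : zmod_closed (relative_cycles S T i).
Proof.
split=> [|a b]; rewrite -!topredE /= /relative_cycles.
  by rewrite -[X in boundary S X](subrr 0) (@boundaryB S i) ?subrr ?rpred0.
by move=> /andP[aS aT] /andP[bS bT]; rewrite (@boundaryB S i) ?rpredB.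
Qed.
HB.instance Definition _ S T i := GRing.isZmodClosed.Build cochain
  (relative_cycles S T i) (relative_cycles_closed S T i).

Fact relative_boundaries_closed S T i : zmod_closed (relative_boundaries S T i).
Proof.
split=> [|x y]; rewrite -!topredE /= /relative_boundaries.
  apply/asboolP; exists 0, 0; rewrite !rpred0; split=> //.
  by rewrite addr0 -[X in boundary S X](subrr 0) (@boundaryB S i) ?subrr ?rpred0.
move=> /asboolP[b [a [bS aT ->]]] /asboolP[b' [a' [bS' aT' ->]]] {x y}; apply/asboolP.
exists (b - b'), (a - a'); rewrite !rpredB //; split=> //.
by rewrite (@boundaryB S (i + 1)) // opprD addrACA.
Qed.
HB.instance Definition _ S T i := GRing.isZmodClosed.Build cochain
  (relative_boundaries S T i) (relative_boundaries_closed S T i).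

Definition homology S T i :=
  subquot (relative_cycles S T i) (relative_boundaries S T i).
HB.instance Definition _ S T i := GRing.Zmodule.on (homology S T i).

Definition reduced_homology S i := homology (augmented S) set0 i.
HB.instance Definition _ S i := GRing.Zmodule.on (reduced_homology S i).

(* Compactly supported cohomology H_c^k(S, T), for [T `<=` S]: the relative
   cochains are the cochains of [S] that vanish on [T]. *)
Definition relative_cocycles S T k : {pred cochain} :=
  fun c => (c \in chains (S `\` T) k) && (coboundary S c == 0).

Definition relative_coboundaries S T k : {pred cochain} :=
  fun c => `[< exists2 b, b \in chains (S `\` T) (k - 1) & c = coboundary S b >].

Fact relative_cocycles_closed S T k : zmod_closed (relative_cocycles S T k).
Proof.
split=> [|a b]; rewrite -!topredE /= /relative_cocycles.
  by rewrite -[X in coboundary S X](subrr 0) coboundaryB subrr eqxx rpred0.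
by move=> /andP[aS /eqP a0] /andP[bS /eqP b0]; rewrite coboundaryB a0 b0 subrr eqxx rpredB.
Qed.
HB.instance Definition _ S T k := GRing.isZmodClosed.Build cochain
  (relative_cocycles S T k) (relative_cocycles_closed S T k).

Fact relative_coboundaries_closed S T k : zmod_closed (relative_coboundaries S T k).
Proof.
split=> [|x y]; rewrite -!topredE /= /relative_coboundaries.
  apply/asboolP; exists 0; rewrite ?rpred0 //.
  by rewrite -[X in coboundary S X](subrr 0) coboundaryB subrr.
move=> /asboolP[b bS ->] /asboolP[b' bS' ->] {x y}; apply/asboolP.
by exists (b - b'); rewrite ?rpredB ?coboundaryB.
Qed.
HB.instance Definition _ S T k := GRing.isZmodClosed.Build cochain
  (relative_coboundaries S T k) (relative_coboundaries_closed S T k).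

Definition compact_cohomology S T k :=
  subquot (relative_cocycles S T k) (relative_coboundaries S T k).
HB.instance Definition _ S T k := GRing.Zmodule.on (compact_cohomology S T k).

Definition homology_inclusion S T S' T' i : homology S T i -> homology S' T' i :=
  hmap id.

Definition reduced_inclusion T S i : reduced_homology T i -> reduced_homology S i :=
  hmap id.

(* Restricting to [S] drops the empty simplex. *)
Definition to_relative S T i : reduced_homology S i -> homology S T i :=
  hmap (restriction S).

(* The augmented boundary of [S] is used so that the sequence is also exact at
   the reduced homology of an empty [T] in degree -1. *)
Definition connecting S T i : homology S T i -> reduced_homology T (i - 1) :=
  hmap (boundary (augmented S)).

Definition from_relative S T k :
  compact_cohomology S T k -> compact_cohomology S set0 k := hmap id.

Definition cohomology_restriction S T k :
  compact_cohomology S set0 k -> compact_cohomology T set0 k :=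
  hmap (restriction T).

Definition coconnecting S T k :
  compact_cohomology T set0 k -> compact_cohomology S T (k + 1) :=
  hmap (coboundary S).

Definition face_closed S S' := forall s t, S s -> S' t -> (t `<=` s)%fset -> S t.

Lemma boundary_sub S S' i c : S `<=` S' -> face_closed S S' ->
  c \in chains S i -> boundary S' c = boundary S c.
Proof.
move=> SS' SF /asboolP[_ cS]; apply: functional_extensionality_dep => t.
rewrite /boundary; case: (asboolP (S t)) => [St|nSt]; first by rewrite asboolT //; exact: SS'.
case: asboolP => // S't; apply: fsbig1 => v _.
have [->|/cS[Sv _]] := eqVneq (c (v |` t)%fset) 0; first by rewrite mulr0.
by case: nSt; apply: (SF (v |` t)%fset t) => //; exact: fsubsetU1.
Qed.

Lemma chains_sub S S' i : S `<=` S' -> {subset chains S i <= chains S' i}.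
Proof.
move=> SS' c /asboolP[fc cS]; apply/asboolP; split=> // s /cS[Ss ->].
by split=> //; exact: SS'.
Qed.

Lemma homology_inclusionB S T S' T' i :
  S `<=` S' -> face_closed S S' -> T `<=` T' ->
  zmod_morphism (@homology_inclusion S T S' T' i).
Proof.
move=> SS' SF TT'; apply: hmapB => // c.
  move=> /andP[cS cT]; apply/andP; split; first exact: chains_sub cS.
  by rewrite (boundary_sub SS' SF cS); exact: chains_sub cT.
move=> _ /asboolP[b [a [bS aT ->]]]; apply/asboolP; exists b, a; split.
- exact: chains_sub bS.
- exact: chains_sub aT.
- by rewrite (boundary_sub SS' SF bS).
Qed.

Lemma complement_sub X L L' : L `<=` L' -> complement X L' `<=` complement X L.
Proof. by move=> LL' t [t0 [s [Xs nL ts]]]; split=> //; exists s; split=> // /LL'. Qed.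

Lemma complement_face_closed X L L' :
  face_closed (complement X L') (complement X L).
Proof.
move=> s t [s0 [r [Xr nL sr]]] [t0 _] ts; split=> //; exists r; split=> //.
exact: fsubset_trans ts sr.
Qed.

Lemma augmented_sub S S' : S `<=` S' -> augmented S `<=` augmented S'.
Proof. by move=> SS' s [/SS'|->]; [left|right]. Qed.

Lemma augmented_face_closed S S' :
  ~ S' fset0 -> face_closed S S' -> face_closed (augmented S) (augmented S').
Proof.
move=> S'0 SF s t [Ss|->] [S't|->] ts; try by right.
  by left; apply: SF S't ts.
by move: ts S't; rewrite fsubset0 => /eqP ->.
Qed.

End Complexes.


Section Metric.
Variables (R : realType) (d : Order.disp_t) (V : orderType d).
Implicit Types (S K X : set {fset V}) (s t : {fset V}) (v w : V) (x y : V -> R).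

(* Points of the geometric realization, in barycentric coordinates. *)
Definition in_simplex s x :=
  [/\ forall v, 0 <= x v, forall v, v \notin s -> x v = 0 & \sum_(v <- s) x v = 1].

Definition realization S : set (V -> R) := [set x | exists2 s, S s & in_simplex s x].

(* The factor 2 is the squared length of the edges in barycentric coordinates. *)
Definition simplex_dist s x y : R := Num.sqrt ((\sum_(v <- s) (x v - y v) ^+ 2) / 2).

(* Lengths of the polygonal paths from [x] to [y] with consecutive vertices in
   a common closed simplex; their infimum is the length metric. *)
Inductive broken_line S : (V -> R) -> (V -> R) -> R -> Prop :=
| broken_line0 x : realization S x -> broken_line S x x 0
| broken_lineS s x y z l : S s -> in_simplex s x -> in_simplex s y ->
    broken_line S y z l -> broken_line S x z (simplex_dist s x y + l).

Definition dist S x y : R := inf [set l | broken_line S x y l].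

Definition connected_complex S :=
  (exists v, S [fset v]%fset) /\
  forall v w, S [fset v]%fset -> S [fset w]%fset ->
    exists2 p : seq V, path (fun a b => `[< S [fset a; b]%fset >]) v p & last v p = w.

Definition locally_finite S := forall v, finite_set [set s | S s /\ v \in s].

(* The length metric is implicit: it is [dist S]. *)
Definition metric_complex S :=
  [/\ simplicial_complex S, connected_complex S & locally_finite S].

Definition link S v : set {fset V} :=
  [set t | [/\ t != fset0, v \notin t & S (v |` t)%fset]].

Definition bounded_geometry S :=
  exists N : nat, forall v, S [fset v]%fset -> (link S v #<= `I_N)%card.

Definition diameter_le S K (r : R) :=
  forall x y, realization K x -> realization K y -> dist S x y <= r.

Definition has_dimension S (m : nat) :=
  (forall s, S s -> (#|` s| <= m.+1)%N) /\ (exists2 s, S s & #|` s| = m.+1).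

Definition uniformly_acyclic S :=
  exists2 m : nat, has_dimension S m &
  forall (j : int) (r1 : R), j <= m%:Z -> 0 < r1 ->
  exists2 r2 : nat, (0 < r2)%N &
  forall K, subcomplex K S -> K !=set0 -> diameter_le S K r1 ->
  forall h : reduced_homology K j, reduced_inclusion (star_nbhd S r2 K) h = 0.

End Metric.

Section CoarseMaps.
Variable R : realType.

Definition unbounded_increasing (rho : R -> R) :=
  (forall a b, 0 <= a -> a <= b -> rho a <= rho b) /\
  (forall c, exists2 a, 0 <= a & c <= rho a).

Definition coarse_embedding (A B : Type) (D : set A) (dA : A -> A -> R)
    (dB : B -> B -> R) (f : A -> B) :=
  exists rho1 rho2, [/\ unbounded_increasing rho1, unbounded_increasing rho2 &
  forall x y, D x -> D y ->
    rho1 (dA x y) <= dB (f x) (f y) /\ dB (f x) (f y) <= rho2 (dA x y)].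

Definition hausdorff_le (B : Type) (dB : B -> B -> R) (P Q : set B) (r : R) :=
  (forall p, P p -> exists2 q, Q q & dB p q <= r) /\
  (forall q, Q q -> exists2 p, P p & dB p q <= r).

Definition coarse_pair (d : Order.disp_t) (V : orderType d) (Z0 Z1 : set {fset V}) :=
  [/\ metric_complex Z0, metric_complex Z1, Z1 `<=` Z0 &
      coarse_embedding (@realization R d V Z1) (dist Z1) (dist Z0) id].

End CoarseMaps.


Section Maps.
Variables (R : realType) (d d' : Order.disp_t) (V : orderType d) (W : orderType d').
Implicit Types (h : cochain V -> cochain W).

(* A family of homomorphisms from the i-chains of [S] to the (e i)-chains of
   [T], given by a single function on cochains; its other values are
   irrelevant. *)
Definition graded_hom (S : set {fset V}) (T : set {fset W}) (e : int -> int) h :=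
  forall i, {homo h : c / c \in chains S i >-> c \in chains T (e i)} /\
            {in chains S i &, {morph h : a b / a - b}}.

(* The smallest subcomplex carrying the image of all the chains of [S]. *)
Definition support h (S : set {fset V}) : set {fset W} :=
  [set t | t != fset0 /\ exists i c s,
    [/\ c \in chains S i, h c s != 0 & (t `<=` s)%fset]].

Definition controlled (S : set {fset V}) (T : set {fset W}) h (r : R) :=
  forall s, S s -> diameter_le T (support h (faces s)) r.

Definition augmentation (c : cochain V) : int := \sum_(s \in setT) c s.

End Maps.

Section CoarsePD.
Variables (R : realType) (d : Order.disp_t) (W : orderType d).
Implicit Types (X : set {fset W}) (h p pbar : cochain W -> cochain W).

Definition chain_displacement X h (D : nat) :=
  forall s t, X s -> h (simplex_chain s) t != 0 -> star_nbhd X D (faces s) t.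

Definition cochain_displacement X h (D : nat) :=
  forall s, X s -> support h (faces s) `<=` star_nbhd X D (faces s).

Record coarse_PD X (n : nat) pbar p (E0 : nat) : Prop := CoarsePD {
  PD_metric : metric_complex X;
  PD_bounded : bounded_geometry X;
  PD_acyclic : uniformly_acyclic R X;
  PD_pbar : graded_hom X X (fun i => n%:Z - i) pbar;
  PD_p : graded_hom X X (fun k => n%:Z - k) p;
  PD_pbar_chain : forall i, {in chains X i, forall c,
    coboundary X (pbar c) = pbar (boundary X c)};
  PD_p_chain : forall k, {in chains X k, forall c,
    boundary X (p c) = p (coboundary X c)};
  PD_pbar_displacement : chain_displacement X pbar E0;
  PD_p_displacement : cochain_displacement X p E0;
  PD_cochain_homotopy : exists h,
    [/\ graded_hom X X (fun k => k - 1) h, controlled X X h (E0%:R : R) &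
        forall k, {in chains X k, forall c,
          pbar (p c) - c = coboundary X (h c) + h (coboundary X c)}];
  PD_chain_homotopy : exists h,
    [/\ graded_hom X X (fun i => i + 1) h, controlled X X h (E0%:R : R) &
        forall i, {in chains X i, forall c,
          p (pbar c) - c = boundary X (h c) + h (boundary X c)}] }.

End CoarsePD.


Section Deleted.
Variables (R : realType) (d : Order.disp_t) (W : orderType d) (X : set {fset W}).
Implicit Types (A : set (W -> R)) (i : int).

Definition is_nbhd A (L : set {fset W}) := subcomplex L X /\
  exists r : R, forall x, realization L x -> exists2 a, A a & dist X x a <= r.

Record nbhd A := Nbhd { nbhd_val :> set {fset W}; nbhdP : is_nbhd A nbhd_val }.

Record nbhd_pair A0 A1 := NbhdPair {
  outer : nbhd A0; inner : nbhd A1; inner_sub : inner `<=` outer }.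

Definition reduced_bond A i (L L' : nbhd A) (LL' : L `<=` L') :
    reduced_homology (complement X L') i -> reduced_homology (complement X L) i :=
  @reduced_inclusion _ _ _ _ i.

Fact reduced_bondB A i (L L' : nbhd A) (LL' : L `<=` L') :
  zmod_morphism (@reduced_bond A i L L' LL').
Proof.
apply: homology_inclusionB => //.
  exact/augmented_sub/complement_sub.
by apply: augmented_face_closed; [case; rewrite eqxx | exact: complement_face_closed].
Qed.
HB.instance Definition _ A i (L L' : nbhd A) (LL' : L `<=` L') :=
  GRing.isZmodMorphism.Build _ _ (@reduced_bond A i L L' LL') (@reduced_bondB A i L L' LL').

Definition reduced_system A i := @InverseSystem (nbhd A)
  (fun L L' => L `<=` L') (fun L => reduced_homology (complement X L) i)
  (fun L L' LL' => @reduced_bond A i L L' LL').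

Definition relative_bond A0 A1 i (L L' : nbhd_pair A0 A1)
    (LL' : outer L `<=` outer L' /\ inner L `<=` inner L') :
    homology (complement X (inner L')) (complement X (outer L')) i ->
    homology (complement X (inner L)) (complement X (outer L)) i :=
  @homology_inclusion _ _ _ _ _ _ i.

Fact relative_bondB A0 A1 i (L L' : nbhd_pair A0 A1)
    (LL' : outer L `<=` outer L' /\ inner L `<=` inner L') :
  zmod_morphism (@relative_bond A0 A1 i L L' LL').
Proof.
case: (LL') => LL0 LL1; apply: homology_inclusionB.
- exact: complement_sub.
- exact: complement_face_closed.
- exact: complement_sub.
Qed.
HB.instance Definition _ A0 A1 i (L L' : nbhd_pair A0 A1)
    (LL' : outer L `<=` outer L' /\ inner L `<=` inner L') :=
  GRing.isZmodMorphism.Build _ _ (@relative_bond A0 A1 i L L' LL') (@relative_bondB A0 A1 i L L' LL').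

Definition relative_system A0 A1 i := @InverseSystem (nbhd_pair A0 A1)
  (fun L L' => outer L `<=` outer L' /\ inner L `<=` inner L')
  (fun L => homology (complement X (inner L)) (complement X (outer L)) i)
  (fun L L' LL' => @relative_bond A0 A1 i L L' LL').

Definition deleted_homology A i := limit (reduced_system A i).
HB.instance Definition _ A i := GRing.Zmodule.on (deleted_homology A i).

(* The group H_i(A1^c, A0^c), for [A1 `<=` A0]. *)
Definition relative_deleted_homology A0 A1 i := limit (relative_system A0 A1 i).
HB.instance Definition _ A0 A1 i :=
  GRing.Zmodule.on (relative_deleted_homology A0 A1 i).

Definition reduced_component A i (x : deleted_homology A i) (L : nbhd A) :
  reduced_homology (complement X L) i := component x L.

Definition relative_component A0 A1 i (x : relative_deleted_homology A0 A1 i)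
    (L : nbhd_pair A0 A1) :
  homology (complement X (inner L)) (complement X (outer L)) i := component x L.

End Deleted.


Section Duality.
Variables (R : realType) (d d' : Order.disp_t) (V : orderType d) (W : orderType d').
Implicit Types (Z : set {fset V}) (X K : set {fset W}) (i k : int).

Definition approximates X Z (f : (V -> R) -> (W -> R)) (fs : cochain V -> cochain W) :=
  [/\ graded_hom Z X id fs,
      forall i, {in chains Z i, forall c, boundary X (fs c) = fs (boundary Z c)},
      {in chains Z 0, forall c, augmentation (fs c) = augmentation c} &
      exists M : R, forall s, Z s ->
        hausdorff_le (dist X) (realization (support fs (faces s)))
                     (f @` in_simplex s) M].

Definition dual_map Z (fs : cochain V -> cochain W) (phi : cochain W) : cochain V :=
  fun s => if `[< Z s >] then evaluation phi (fs (simplex_chain s)) else 0.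

Definition dual_induced fs (K0 K1 : set {fset W}) (Z0 Z1 : set {fset V}) k :
    compact_cohomology K0 K1 k -> compact_cohomology Z0 Z1 k :=
  hmap (dual_map Z0 fs).

Definition pbar_induced (pbar : cochain W -> cochain W) (Y1 Y0 K0 K1 : set {fset W})
    i k : homology Y1 Y0 i -> compact_cohomology K0 K1 k :=
  hmap (restriction K0 \o pbar).

(* [u] below is the inverse image of a component of [x] under the connecting
   isomorphism H_i(X, Y) -> H_(i-1)(Y), where i + k = n. *)
Definition is_duality_map X (E0 : nat) pbar (f : (V -> R) -> (W -> R)) fs Z i k
    (a : @deleted_homology R _ _ X (f @` realization Z) (i - 1) ->
         compact_cohomology Z set0 k) :=
  forall (x : deleted_homology X (f @` realization Z) (i - 1)) (r : nat), (0 < r)%N ->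
  exists (L : nbhd X (f @` realization Z)) (u : homology X (complement X L) i),
    [/\ L = star_nbhd X (r + E0.+1) (support fs Z) :> set _,
        connecting u = reduced_component x L &
        a x = dual_induced fs Z set0
                (pbar_induced pbar (star_nbhd X r (support fs Z)) set0 k u)].

Definition is_relative_duality_map X (E0 : nat) pbar (f : (V -> R) -> (W -> R)) fs Z0 Z1 i k
    (a : @relative_deleted_homology R _ _ X (f @` realization Z0) (f @` realization Z1) i ->
         compact_cohomology Z0 Z1 k) :=
  forall (x : relative_deleted_homology X (f @` realization Z0) (f @` realization Z1) i)
    (r : nat), (0 < r)%N ->
  exists L : nbhd_pair X (f @` realization Z0) (f @` realization Z1),
    [/\ outer L = star_nbhd X (r + E0.+1) (support fs Z0) :> set _,
        inner L = star_nbhd X (r + E0.+1) (support fs Z1) :> set _ &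
        a x = dual_induced fs Z0 Z1
                (pbar_induced pbar (star_nbhd X r (support fs Z0))
                   (star_nbhd X r (support fs Z1)) k (relative_component x L))].

End Duality.

Definition exact_at (A B C : zmodType) (g : A -> B) (h : B -> C) :=
  forall y, h y = 0 <-> exists x, g x = y.

(* Main.v *)
(* Put K_i for the support of f_#(C(Z_i)).  All arguments are made on chains, for a pair
   (Z0, Z1) with Z1 possibly empty, so that the absolute groups are a special case.
   Uniform acyclicity produces chain maps and homotopies by induction on skeleta, inside
   balls of controlled radius: coarse inverses g : C(N_r K_i) -> C(Z_i) of f_# that respect
   the pair, together with homotopies g f_# ~ 1, f_# g ~ 1, P Pbar ~ 1 and Pbar P ~ 1 of
   bounded displacement.  Hence phi |-> P (g^# phi), where g^# phi is extended by zero,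
   inverts f^# Pbar up to a loss of radius: every stage of the inverse limit maps onto
   H_c^k(Z0, Z1), and a class of a late stage in the kernel dies at an earlier one.  So A is
   bijective on the limit, and the top row, whose exactness could a priori be lost in the
   limit, is exact because the bottom row is and the squares commute. *)

Require Import Defs.
From HB Require Import structures.
From mathcomp Require Import all_boot all_order all_algebra finmap.
From mathcomp Require Import zify ring lra.
From mathcomp Require Import boolp classical_sets functions cardinality fsbigop reals.

Set Implicit Arguments.
Unset Strict Implicit.
Unset Printing Implicit Defensive.

Import Order.TTheory GRing.Theory Num.Theory.
Local Open Scope ring_scope.
Local Open Scope classical_set_scope.

(** * Subquotients and inverse limits *)

(** The hypotheses are metric, the constructions combinatorial. Because the complexes have finite
    dimension, bounds on the length metric and on edge paths ([near]) imply each other, so [f]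
    enters only through a vertex map [b] that is Lipschitz and proper for edge paths. Properness
    matters twice: it makes the nearest-vertex map a Lipschitz inverse, and it keeps supports finite
    when a chain map is transposed to compactly supported cochains. Uniform acyclicity yields
    homotopies of chain maps only. For [pbar \o p], which acts on cochains, the homotopy is
    therefore obtained on the transposed matrix and transposed back. At every stage the duality map
    is induced by the same formula [c |-> dual_map Z0 fs (pbar c)], in which the radius does not
    occur. One chain thus represents a class at its own stage and at all earlier ones, the maps
    agree with the bonding maps, and each square of the diagram is checked on a single chain at a
    single stage. The empty simplex counts as a simplex of degree -1 wherever reduced cycles or
    augmentations occur; this accounts for most case distinctions on the degree. *)

Section Additive.
Variables (U V : zmodType) (f : U -> V) (fB : zmod_morphism f).
Let g := f.
HB.instance Definition _ := GRing.isZmodMorphism.Build U V g fB.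
(** Serves for maps whose additivity is a lemma, possibly under a side condition such as
    [i + k = n], which a canonical instance could not carry. *)
Definition additive_of : {additive U -> V} := g.
End Additive.

Section Subquot.
Variables (A : zmodType) (Z B : zmodClosed A).

Lemma cls0 : cls Z B 0 = 0.
Proof. by rewrite -[X in cls _ _ X](subrr 0) clsB ?rpred0 // subrr. Qed.

Lemma cls_eq0 a : a \in Z -> (cls Z B a = 0) <-> (a \in B).
Proof.
move=> aZ; rewrite -cls0; split=> [/(cls_eq aZ (rpred0 _))|aB].
  by rewrite subr0.
by apply: eq_cls; rewrite ?rpred0 // subr0.
Qed.

End Subquot.

(** The conditions under which [hmap phi], defined through the chosen representative [rep], may be
    computed on any representative. *)
Definition respects (A A' : zmodType) (Z B : zmodClosed A) (Z' B' : zmodClosed A')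
    (phi : A -> A') :=
  [/\ {in Z &, {morph phi : a b / a - b}}, {homo phi : a / a \in Z >-> a \in Z'} &
      forall a, a \in Z -> a \in B -> phi a \in B'].

Section Hmap.
Variables (A A' : zmodType) (Z B : zmodClosed A) (Z' B' : zmodClosed A').

Lemma hmap_cls (phi : A -> A') a : respects Z B Z' B' phi -> a \in Z ->
  @hmap _ _ Z B Z' B' phi (cls Z B a) = cls Z' B' (phi a).
Proof.
move=> [phiB phiZ phiN] aZ; apply: eq_cls; rewrite ?phiZ ?rep_cycle //.
rewrite -phiB ?rep_cycle //; apply: phiN; first by rewrite rpredB ?rep_cycle.
by apply: (@cls_eq _ Z); rewrite ?rep_cycle // repK.
Qed.

Lemma respects_zmod (phi : A -> A') : respects Z B Z' B' phi ->
  zmod_morphism (@hmap _ _ Z B Z' B' phi).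
Proof. by move=> [*]; exact: hmapB. Qed.

End Hmap.

(* A map from a limit to a group [B] is bijective as soon as it is surjective at
   every stage of a cofinal sequence and its kernel at some later stage dies under
   the bonding map: the system is then pro-isomorphic to the constant one. *)
Section LimitBijection.
Variables (S : inverse_system) (B : zmodType).
Hypothesis le_trans : forall i j k : S, index_le i j -> index_le j k -> index_le i k.
Hypothesis bond_comp : forall (i j k : S) (ij : index_le i j) (jk : index_le j k)
  (ik : index_le i k) x, bond ij (bond jk x) = bond ik x.
Variable (L : nat -> S).
Hypothesis L_le : forall r r', (r <= r')%N -> index_le (L r) (L r').
Hypothesis L_cofinal : forall i, exists r, index_le i (L r).
Variable a : forall r, {additive term (L r) -> B}.
Hypothesis a_bond : forall r r' (le : index_le (L r) (L r')) x,
  (r <= r')%N -> a r (bond le x) = a r' x.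
Hypothesis a_surj : forall r b, exists x, a r x = b.
Hypothesis a_inj : forall r, exists2 r', (r <= r')%N &
  forall (le : index_le (L r) (L r')) x, a r' x = 0 -> bond le x = 0.

Lemma component_bond (x : limit S) (i j : S) (ij : index_le i j) :
  bond ij (component x j) = component x i.
Proof. by have /asboolP := valP x; apply. Qed.

Lemma limit_eq (x y : limit S) : (forall i, component x i = component y i) -> x = y.
Proof.
by move=> xy; apply: val_inj; apply: functional_extensionality_dep => i; apply: xy.
Qed.

(** The duality maps are specified at every radius at once; this lets them be defined at one stage
    and read off at any other. *)
Lemma limit_map_const r r' (x : limit S) :
  (r <= r')%N -> a r (component x (L r)) = a r' (component x (L r')).
Proof. by move=> rr'; rewrite -(component_bond x (L_le rr')) a_bond. Qed.

(** The inverse sends [b] to the thread whose entry at [i] is the image of a preimage of [b] taken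
    so late that the kernel dies on the way to [i]. Two such preimages differ by an element of that
    kernel, so the entry does not depend on the choice; the relation [Q] records the admissible
    entries. *)
Lemma limit_map_bijective r0 :
  bijective (fun x : limit S => a r0 (component x (L r0))).
Proof.
have a_eq r r' (x : limit S) : a r (component x (L r)) = a r' (component x (L r')).
  by case/orP: (leq_total r r') => /limit_map_const.
pose Q i (b : B) (z : term i) := exists r r' (ir : index_le i (L r))
  (le : index_le (L r) (L r')) y,
  [/\ (r <= r')%N, forall x, a r' x = 0 -> bond le x = 0, a r' y = b & z = bond ir (bond le y)].
have Qex i b : exists z, Q i b z.
  have [r ir] := L_cofinal i; have [r' rr' kill] := a_inj r.
  have [y yb] := a_surj r' b; exists (bond ir (bond (L_le rr') y)).
  by exists r, r', ir, (L_le rr'), y; split=> // x; exact: kill.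
have Quniq i j (ij : index_le i j) b z z' : Q i b z -> Q j b z' -> bond ij z' = z.
  move=> [r1 [r1' [ir1 [le1 [y1 [rr1 kill1 ab1 ->]]]]]].
  move=> [r2 [r2' [ir2 [le2 [y2 [rr2 kill2 ab2 ->]]]]]].
  (* Both entries are compared with the image of one preimage at the common later stage [m]. *)
  pose m := maxn r1' r2'; have [y yb] := a_surj m b.
  have m1 : (r1' <= m)%N by exact: leq_maxl.
  have m2 : (r2' <= m)%N by exact: leq_maxr.
  have -> : bond le1 y1 = bond le1 (bond (L_le m1) y).
    apply/eqP; rewrite -subr_eq0 -raddfB kill1 // raddfB ab1 a_bond // yb subrr //.
  have -> : bond le2 y2 = bond le2 (bond (L_le m2) y).
    apply/eqP; rewrite -subr_eq0 -raddfB kill2 // raddfB ab2 a_bond // yb subrr //.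
  have im := le_trans ij (le_trans ir2 (le_trans le2 (L_le m2))).
  have jm := le_trans ir2 (le_trans le2 (L_le m2)).
  have r1m := le_trans le1 (L_le m1); have r2m := le_trans le2 (L_le m2).
  rewrite (bond_comp _ _ r1m) (bond_comp _ _ r2m) (bond_comp _ _ jm).
  by rewrite (bond_comp _ _ im) (bond_comp _ _ im).
pose g b : thread S := fun i => projT1 (cid (Qex i b)).
have gC b : g b \in compatible (S := S).
  apply/asboolP => i j ij.
  exact: (Quniq _ _ ij b _ _ (projT2 (cid (Qex i b))) (projT2 (cid (Qex j b)))).
exists (fun b => Limit (gC b)) => [x|b].
  apply: limit_eq => i; rewrite /component /= /g; case: cid => z /= [r [r' [ir [le [y [rr kill yb ->]]]]]].
  rewrite -/(component x i) -(component_bond x ir) -(component_bond x le).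
  congr (bond ir _).
  by apply/eqP; rewrite -subr_eq0 -raddfB kill // raddfB yb (a_eq r0 r') subrr.
rewrite /component /= /g; case: cid => z /= [r [r' [ir [le [y [rr kill yb ->]]]]]].
have rm : (r' <= maxn r0 r')%N by exact: leq_maxr.
have [w wb] := a_surj (maxn r0 r') b.
have -> : bond le y = bond le (bond (L_le rm) w).
  by apply/eqP; rewrite -subr_eq0 -raddfB kill // raddfB yb a_bond // wb subrr.
have rm' := le_trans le (L_le rm).
have m0 := le_trans ir rm'.
by rewrite (bond_comp _ _ rm') (bond_comp _ _ m0) (a_bond m0) ?leq_maxl ?wb.
Qed.

End LimitBijection.

(** * Simplicial chains *)

Section Chains.
Variables (d : Order.disp_t) (V : orderType d).
Implicit Types (S T K L : set {fset V}) (s t : {fset V}) (a b c phi psi : cochain V) (i k : int).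

Definition finsupp_chain c := finite_set [set s | c s != 0].

Lemma chainsP S i c : reflect (finsupp_chain c /\
  forall s, c s != 0 -> S s /\ #|` s|%:Z = i + 1) (c \in chains S i).
Proof. exact: asboolP. Qed.

Lemma chains_finsupp S i c : c \in chains S i -> finsupp_chain c.
Proof. by move=> /chainsP[]. Qed.

Lemma chains_mem S i c s : c \in chains S i -> c s != 0 -> S s.
Proof. by move=> /chainsP[_ h] /h[]. Qed.

Lemma chains_out S i c s : c \in chains S i -> ~ S s -> c s = 0.
Proof. by move=> cS nS; apply/eqP/negPn/negP => /(chains_mem cS). Qed.

Lemma chains_card S i c s : c \in chains S i -> c s != 0 -> #|` s|%:Z = i + 1.
Proof. by move=> /chainsP[_ h] /h[]. Qed.

Lemma chains_in S T i c : c \in chains S i -> (forall s, S s -> c s != 0 -> T s) ->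
  c \in chains T i.
Proof.
move=> /chainsP[fc cS] ST; apply/chainsP; split=> // s cs.
by have [Ss sE] := cS s cs; split=> //; exact: ST.
Qed.

Lemma finsupp_seq c : finsupp_chain c -> exists X : {fset {fset V}}, forall s, s \notin X -> c s = 0.
Proof.
move=> fc; exists (fset_set [set s | c s != 0]) => s /negP sX.
by apply/eqP/negPn/negP => cs; apply: sX; rewrite in_fset_set //; exact/mem_set.
Qed.

Lemma finsuppD a b : finsupp_chain a -> finsupp_chain b -> finsupp_chain (a + b).
Proof.
move=> fa fb; apply: (@sub_finite_set _ _ ([set s | a s != 0] `|` [set s | b s != 0])).
  move=> s /= abs; have [a0|] := eqVneq (a s) 0; last by left.
  by right; move: abs; rewrite [(a + b) s](_ : _ = a s + b s) // a0 add0r.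
by rewrite finite_setU.
Qed.

Definition at_simplex t c : int := c t.
Lemma at_simplexB t : zmod_morphism (at_simplex t). Proof. by []. Qed.
HB.instance Definition _ t :=
  GRing.isZmodMorphism.Build (cochain V) int (at_simplex t) (at_simplexB t).

Lemma sum_at (I : Type) (r : seq I) (P : pred I) (F : I -> cochain V) t :
  (\sum_(x <- r | P x) F x) t = \sum_(x <- r | P x) F x t.
Proof. exact: (raddf_sum (at_simplex t)). Qed.

Lemma mulrz_at c (n : int) t : (c *~ n) t = c t * n.
Proof. by rewrite -mulrzz; exact: (raddfMz (at_simplex t)). Qed.

Lemma simplex_chains S i s : S s -> #|` s|%:Z = i + 1 -> simplex_chain s \in chains S i.
Proof.
move=> Ss sE; apply/chainsP; rewrite /simplex_chain /finsupp_chain; split=> [|t].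
  apply: (@sub_finite_set _ _ [set s]) => // t /=.
  by case: (t =P s) => //.
by case: (t =P s) => [->|].
Qed.

Lemma finsupp_simplex s : finsupp_chain (simplex_chain s).
Proof. by apply: (@chains_finsupp setT (#|` s|%:Z - 1)); apply: simplex_chains; rewrite ?subrK. Qed.

Lemma chain_decomposition c (X : {fset {fset V}}) : (forall s, s \notin X -> c s = 0) ->
  c = \sum_(s <- X) simplex_chain s *~ c s.
Proof.
move=> cX; apply: funext => t; rewrite sum_at.
under eq_bigr do rewrite mulrz_at.
have [tX|tX] := boolP (t \in X); last first.
  rewrite (cX _ tX) big_seq big1 // => s sX; rewrite /simplex_chain.
  by case: eqP tX => [->|]; rewrite ?sX ?mul0r.
rewrite (bigD1_seq t) ?fset_uniq //= {1}/simplex_chain eqxx mul1r big1 ?addr0 // => s.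
by rewrite eq_sym /simplex_chain => /negbTE->; rewrite mul0r.
Qed.

(** Closure under differences is the form in which additivity is stated throughout; sums and integer
    multiples are recovered inside the proof. *)
Lemma chain_ind S i (P : cochain V -> Prop) : P 0 ->
  (forall a b, a \in chains S i -> b \in chains S i -> P a -> P b -> P (a - b)) ->
  (forall s, S s -> #|` s|%:Z = i + 1 -> P (simplex_chain s)) ->
  forall c, c \in chains S i -> P c.
Proof.
move=> P0 PB Ps c cS; have [X cX] := finsupp_seq (chains_finsupp cS).
pose Q a := a \in chains S i /\ P a.
have Q0 : Q 0 by split=> //; rewrite rpred0.
have QB a b : Q a -> Q b -> Q (a - b).
  by move=> [aS aP] [bS bP]; split; [rewrite rpredB | exact: PB].
have QN a : Q a -> Q (- a) by rewrite -sub0r; exact: QB.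
have QD a b : Q a -> Q b -> Q (a + b).
  by move=> qa qb; rewrite -[b]opprK; apply: QB => //; exact: QN.
have QMn a n : Q a -> Q (a *+ n).
  by move=> qa; elim: n => [|n IH]; rewrite ?mulr0n // mulrS; exact: QD.
have QMz a (n : int) : Q a -> Q (a *~ n).
  move=> qa; case: n => n; first exact: QMn.
  by rewrite NegzE mulrNz; apply: QN; exact: QMn.
suff: Q c by case.
rewrite (chain_decomposition cX); elim/big_ind: _ => // s _.
have [->|cs] := eqVneq (c s) 0; first by rewrite mulr0z.
have /chainsP[_ /(_ s cs)[Ss sE]] := cS.
by apply: QMz; split; [exact: simplex_chains | exact: Ps].
Qed.

Lemma chain_ext (U : zmodType) (F G : cochain V -> U) S i :
  {in chains S i &, {morph F : a b / a - b}} ->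
  {in chains S i &, {morph G : a b / a - b}} ->
  (forall s, S s -> #|` s|%:Z = i + 1 -> F (simplex_chain s) = G (simplex_chain s)) ->
  {in chains S i, F =1 G}.
Proof.
move=> FB GB FG; apply: chain_ind => [|a b aS bS Fa Fb|//].
  by rewrite -[X in F X](subrr 0) -[X in G X](subrr 0) FB ?GB ?rpred0 // !subrr.
by rewrite FB // GB // Fa Fb.
Qed.

Lemma morphB0 (U : zmodType) (F : cochain V -> U) S i :
  {in chains S i &, {morph F : a b / a - b}} -> F 0 = 0.
Proof. by move=> FB; rewrite -[X in F X](subrr 0) FB ?rpred0 // subrr. Qed.

Lemma morphD (U : zmodType) (F : cochain V -> U) S i :
  {in chains S i &, {morph F : a b / a - b}} ->
  {in chains S i &, {morph F : a b / a + b}}.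
Proof.
move=> FB a b aS bS; have FN x : x \in chains S i -> F (- x) = - F x.
  by move=> xS; have := FB 0 x (rpred0 _) xS; rewrite (morphB0 FB) !sub0r.
by rewrite -[X in a + X]opprK FB ?rpredN // FN // opprK.
Qed.

Lemma morphMz (U : zmodType) (F : cochain V -> U) S i (n : int) :
  {in chains S i &, {morph F : a b / a - b}} ->
  {in chains S i, {morph F : a / a *~ n}}.
Proof.
move=> FB a aS; have FMn m : F (a *+ m) = F a *+ m.
  elim: m => [|m IH]; first by rewrite !mulr0n (morphB0 FB).
  by rewrite !mulrS (morphD FB) ?rpredMn // IH.
case: n => n; first exact: FMn.
have := FB 0 (a *+ n.+1) (rpred0 _) (rpredMn _ aS).
by rewrite (morphB0 FB) !sub0r FMn NegzE !mulrNz.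
Qed.

Lemma evaluation_fset phi c (X : {fset {fset V}}) : (forall s, s \notin X -> c s = 0) ->
  evaluation phi c = \sum_(s <- X) phi s * c s.
Proof. by move=> cX; rewrite /evaluation (fsbigTE X) // => s /cX ->; rewrite mulr0. Qed.

Lemma finsupp_seq2 a b : finsupp_chain a -> finsupp_chain b ->
  exists X : {fset {fset V}}, (forall s, s \notin X -> a s = 0) /\ (forall s, s \notin X -> b s = 0).
Proof.
move=> /finsupp_seq[X aX] /finsupp_seq[Y bY]; exists (X `|` Y)%fset.
by split=> s; rewrite in_fsetU negb_or => /andP[? ?]; [exact: aX | exact: bY].
Qed.

Lemma evaluationBr phi a b : finsupp_chain a -> finsupp_chain b ->
  evaluation phi (a - b) = evaluation phi a - evaluation phi b.
Proof.
move=> fa fb; have [X [aX bX]] := finsupp_seq2 fa fb.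
rewrite (evaluation_fset _ aX) (evaluation_fset _ bX) (@evaluation_fset _ _ X).
  by rewrite -sumrB; apply: eq_bigr => s _; rewrite -mulrBr.
by move=> s sX; rewrite [LHS](_ : _ = a s - b s) // aX // bX // subrr.
Qed.

Lemma evaluationB_chains phi S i : {in chains S i &, {morph evaluation phi : a b / a - b}}.
Proof. by move=> a b /chains_finsupp fa /chains_finsupp fb; exact: evaluationBr. Qed.

Lemma evaluationDr phi a b : finsupp_chain a -> finsupp_chain b ->
  evaluation phi (a + b) = evaluation phi a + evaluation phi b.
Proof.
move=> fa fb; have [X [aX bX]] := finsupp_seq2 fa fb.
rewrite (evaluation_fset _ aX) (evaluation_fset _ bX) (@evaluation_fset _ _ X).
  by rewrite -big_split; apply: eq_bigr => s _; exact: mulrDr.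
by move=> s sX; rewrite [LHS](_ : _ = a s + b s) // aX // bX // addr0.
Qed.

Lemma evaluationBl phi psi c : finsupp_chain c ->
  evaluation (phi - psi) c = evaluation phi c - evaluation psi c.
Proof.
move=> /finsupp_seq[X cX]; rewrite !(evaluation_fset _ cX) -sumrB.
by apply: eq_bigr => s _; rewrite -mulrBl.
Qed.

Lemma evaluation0l c : evaluation 0 c = 0.
Proof. by apply: fsbig1 => s _; rewrite [X in X * _](_ : _ = 0) // mul0r. Qed.

Lemma evaluation0r phi : evaluation phi 0 = 0.
Proof. by apply: fsbig1 => s _; rewrite [X in _ * X](_ : _ = 0) // mulr0. Qed.

Lemma evaluation_simplex phi s : evaluation phi (simplex_chain s) = phi s.
Proof.
rewrite (@evaluation_fset _ _ [fset s]%fset) ?big_seq_fset1 /simplex_chain ?eqxx ?mulr1 //.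
by move=> t; rewrite inE => /negbTE->.
Qed.

Lemma evaluation_simplex_l s c : evaluation (simplex_chain s) c = c s.
Proof.
rewrite -[RHS](evaluation_simplex c); rewrite /evaluation; apply: eq_fsbigr => t _.
by rewrite mulrC.
Qed.

Lemma eq_evaluation phi psi c : (forall s, c s != 0 -> phi s = psi s) ->
  evaluation phi c = evaluation psi c.
Proof.
move=> pp; apply: eq_fsbigr => s _; have [->|/pp->//] := eqVneq (c s) 0.
by rewrite !mulr0.
Qed.

Lemma evaluation_eq0 phi c : (forall s, c s != 0 -> phi s = 0) -> evaluation phi c = 0.
Proof. by move=> h; rewrite (@eq_evaluation _ 0) ?evaluation0l. Qed.

Lemma evaluation_neq0 phi c : evaluation phi c != 0 -> exists s, phi s != 0 /\ c s != 0.
Proof.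
move=> e0; apply/not_existsP => h; move/eqP: e0; apply; apply: evaluation_eq0 => s cs.
by apply/eqP/negPn/negP => ps; apply: (h s).
Qed.

(** Finiteness of the support is proved along with the formula, since [evaluation] is additive only
    on finitely supported chains. *)
Lemma evaluation_sum (I : Type) (r : seq I) (g : I -> {fset V}) (n : I -> int) phi :
  finsupp_chain (\sum_(x <- r) simplex_chain (g x) *~ n x) /\
  evaluation phi (\sum_(x <- r) simplex_chain (g x) *~ n x) = \sum_(x <- r) phi (g x) * n x.
Proof.
elim: r => [|x r [fr IH]]; first by rewrite !big_nil evaluation0r; split=> //;
  rewrite /finsupp_chain; apply: (@sub_finite_set _ _ set0) => // s /eqP.
have fx : finsupp_chain (simplex_chain (g x) *~ n x).
  by apply: (@sub_finite_set _ _ [set s | simplex_chain (g x) s != 0]); [move=> s /=; rewrite mulrz_at; apply: contra => /eqP->; rewrite mul0r | exact: finsupp_simplex].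
rewrite !big_cons; split; first exact: finsuppD.
rewrite evaluationDr // IH; congr (_ + _).
have E := @morphMz _ (evaluation phi) setT (#|` g x|%:Z - 1) (n x) (@evaluationB_chains phi setT _).
by rewrite E ?evaluation_simplex ?mulrzz //; apply: simplex_chains; rewrite ?subrK.
Qed.

Definition simplex_boundary s : cochain V :=
  \sum_(v <- s) simplex_chain (s `\ v)%fset *~ incidence s v.

(** [boundary] is a sum over the cofaces of [t]. For a single simplex [s] at most one of them
    counts, because adding [v] to [t] gives [s] exactly when [v] lies in [s] and [t] is the facet
    opposite to [v]. *)
Lemma boundary_simplexT s : boundary setT (simplex_chain s) = simplex_boundary s.
Proof.
apply: funext => t; rewrite /boundary asboolT //.
rewrite /simplex_boundary sum_at; under [RHS]eq_bigr do rewrite mulrz_at.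
have E v : v \notin t -> ((v |` t)%fset == s) = (v \in s) && (t == (s `\ v)%fset).
  move=> vt; apply/eqP/andP => [<-|[vs /eqP->]]; last by rewrite fsetD1K.
  by rewrite fset1U1 fsetU1K.
have F v : v \notin t -> incidence (v |` t)%fset v * simplex_chain s (v |` t)%fset =
    (if v \in s then simplex_chain (s `\ v)%fset t * incidence s v else 0).
  move=> vt; rewrite /simplex_chain E //; case: ifP => vs /=; last by rewrite mulr0.
  by case: (t =P _) => [->|_]; rewrite ?mulr0 ?mul0r // fsetD1K // mul1r mulr1.
rewrite fsbig_mkcond (fsbigTE s) => [|v vs]; last first.
  by rewrite /patch; case: ifP => //; rewrite inE => /F ->; rewrite (negbTE vs).
apply: eq_big_seq => v vs; rewrite /patch; case: ifPn; first by rewrite inE => /F ->; rewrite vs.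
move=> /negP vt; rewrite /simplex_chain; case: (t =P _) => [tE|_]; last by rewrite mul0r.
by case: vt; rewrite inE /= tE !inE eqxx.
Qed.

(** Reduces computations to the complex of all finite sets, the empty one included, where boundary
    and coboundary are adjoint and square to zero in every degree. *)
Lemma boundaryE S c : boundary S c = restriction S (boundary setT c).
Proof.
by apply: funext => t; rewrite /boundary /restriction; case: asboolP => // _; rewrite asboolT.
Qed.

Lemma coboundaryE S c : coboundary S c = restriction S (coboundary setT c).
Proof.
by apply: funext => t; rewrite /coboundary /restriction; case: asboolP => // _; rewrite asboolT.
Qed.

Lemma restrictionB S : {morph restriction S : a b / a - b}.
Proof.
move=> a b; apply: funext => t.
rewrite /restriction [RHS](_ : _ = (if `[< S t >] then a t else 0) - (if `[< S t >] then b t else 0)) //.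
by case: asboolP => // _; rewrite subrr.
Qed.

Lemma restriction_id S c : (forall s, c s != 0 -> S s) -> restriction S c = c.
Proof.
move=> cS; apply: funext => t; rewrite /restriction.
by case: asboolP => // nS; apply/esym/eqP/negPn/negP => /cS.
Qed.

Lemma restriction_chains S i c : c \in chains S i -> restriction S c = c.
Proof. by move=> cS; apply: restriction_id => s; exact: chains_mem cS. Qed.

Lemma chains_restriction S T i c : c \in chains S i -> restriction T c \in chains (S `&` T) i.
Proof.
move=> /chainsP[fc cS]; have rE s : restriction T c s != 0 -> T s /\ c s != 0.
  by rewrite /restriction; case: asboolP => //; rewrite eqxx.
apply/chainsP; split; first by apply: sub_finite_set fc => s /rE[].
by move=> s /rE[Ts /cS[]].
Qed.

Lemma chainsT S i c : c \in chains S i -> c \in chains setT i.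
Proof. by move=> /chains_in; apply. Qed.

Lemma boundaryB_chains S T i : {in chains T i &, {morph boundary S : a b / a - b}}.
Proof.
move=> a b /chainsT aT /chainsT bT.
by rewrite boundaryE (boundaryB aT bT) restrictionB -!boundaryE.
Qed.

Lemma card_fsetD1 s v i : v \in s -> #|` s|%:Z = i + 1 -> #|` s `\ v|%fset%:Z = i.
Proof. by move=> vs; rewrite (cardfsD1 v s) vs PoszD addrC => /addIr. Qed.

Lemma boundary_finsupp S i c : c \in chains setT i -> boundary S c \in chains S (i - 1).
Proof.
move: c; apply: chain_ind => [|a b aT bT|s _ sE].
- by rewrite (morphB0 (@boundaryB_chains S setT i)) rpred0.
- by move=> aS bS; rewrite (boundaryB_chains S aT bT) rpredB.
rewrite boundaryE boundary_simplexT.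
have /(chains_restriction S) : simplex_boundary s \in chains setT (i - 1).
  rewrite /simplex_boundary big_seq rpred_sum // => v vs; apply: rpredMz.
  by apply: simplex_chains => //; rewrite subrK; exact: card_fsetD1 vs sE.
by rewrite setTI.
Qed.

Lemma evaluation_boundaryT phi i c : c \in chains setT i ->
  evaluation phi (boundary setT c) = evaluation (coboundary setT phi) c.
Proof.
move: c; apply: (chain_ext (S := setT) (i := i)) => [a b aT bT|a b aT bT|s _ sE].
- rewrite (boundaryB_chains _ aT bT) (@evaluationB_chains phi setT (i - 1)) //;
  exact: boundary_finsupp.
- by rewrite (@evaluationB_chains _ setT i).
rewrite boundary_simplexT /simplex_boundary (proj2 (evaluation_sum _ _ _ _)).
rewrite evaluation_simplex /coboundary asboolT //.
by apply: eq_bigr => v _; rewrite mulrC.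
Qed.

Lemma evaluation_restriction S phi c :
  evaluation (restriction S phi) c = evaluation phi (restriction S c).
Proof.
apply: eq_fsbigr => s _; rewrite /restriction; case: asboolP => //.
by rewrite mul0r mulr0.
Qed.

(** For [v < w], deleting [w] does not change the number of vertices below [v], while deleting [v]
    lowers the number below [w] by one. *)
Lemma incidence_swap s v w : v \in s -> w \in s -> v != w ->
  incidence s v * incidence (s `\ v)%fset w = - (incidence s w * incidence (s `\ w)%fset v).
Proof.
wlog vw : v w / (v < w)%O => [H vs ws vw|vs ws _].
  case/orP: (lt_total vw) => lt; first exact: H.
  by rewrite (H w v) ?opprK // eq_sym.
have E1 : [fset u in (s `\ w)%fset | (u < v)%O]%fset = [fset u in s | (u < v)%O]%fset.
  apply/fsetP => u; rewrite !inE /=; have [->|//] := eqVneq u w.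
  by rewrite ltNge (ltW vw) /= andbF.
have E2 : [fset u in s | (u < w)%O]%fset = (v |` [fset u in (s `\ v)%fset | (u < w)%O])%fset.
  by apply/fsetP => u; rewrite !inE /=; have [->|//] := eqVneq u v; rewrite vs vw.
rewrite /incidence E1 E2 cardfsU1 !inE /= eqxx /= add1n exprS mulN1r.
by rewrite mulNr opprK mulrC.
Qed.

(** The double sum over ordered pairs of vertices is antisymmetric by [incidence_swap], hence equal
    to its negative, and the integers have no 2-torsion. *)
Lemma coboundaryTT phi : coboundary setT (coboundary setT phi) = 0.
Proof.
apply: funext => s; rewrite [RHS](_ : _ = 0) // /coboundary asboolT //.
transitivity (\sum_(v <- s) \sum_(w <- s | w != v)
    incidence s v * incidence (s `\ v)%fset w * phi (s `\ v `\ w)%fset).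
  apply: eq_bigr => v _; rewrite mulr_sumr -[RHS]big_filter.
  rewrite [RHS](perm_big (enum_fset (s `\ v)%fset)) /=.
    by apply: eq_bigr => w _; rewrite mulrA.
  apply: uniq_perm; rewrite ?filter_uniq ?fset_uniq // => w.
  by rewrite mem_filter -[RHS]/(w \in (s `\ v)%fset) !inE.
set X := LHS; have XN : X = - X.
  rewrite {1}/X (exchange_big_dep xpredT) //= /X -sumrN; apply: eq_big_seq => w ws.
  rewrite -sumrN big_seq_cond [RHS]big_seq_cond; apply: eq_big => v.
    by rewrite eq_sym.
  move=> /andP[vs vw]; rewrite (incidence_swap vs ws) 1?eq_sym // mulNr.
  by congr (- (_ * phi _)); apply/fsetP => u; rewrite !inE andbCA.
have : X *+ 2 == 0 by rewrite mulr2n {1}XN addNr.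
by rewrite mulrn_eq0 /= => /eqP.
Qed.

(** Adjoint to [coboundaryTT]: each coefficient is an evaluation against an elementary cochain. *)
Lemma boundaryTT i c : c \in chains setT i -> boundary setT (boundary setT c) = 0.
Proof.
move=> cT; apply: funext => t.
have bT := boundary_finsupp setT cT.
rewrite -evaluation_simplex_l (evaluation_boundaryT _ bT) (evaluation_boundaryT _ cT).
by rewrite coboundaryTT evaluation0l.
Qed.

End Chains.

(** * Iterated stars *)

Section Stars.
Variables (d : Order.disp_t) (V : orderType d).
Implicit Types (S T K L : set {fset V}) (s t : {fset V}) (u v w : V) (r : nat).

Definition ball S u r := star_nbhd S r [set [fset u]%fset].

(** An edge path with [r] steps, steps that stay put included; it replaces the length metric in all
    constructions. *)
Definition near S r u v := ball S u r [fset v]%fset.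

Lemma star_nbhdS S r K : star_nbhd S r.+1 K = closed_star S (star_nbhd S r K).
Proof. by []. Qed.

Lemma star_nbhdD S r r' K : star_nbhd S (r + r') K = star_nbhd S r (star_nbhd S r' K).
Proof. by rewrite /star_nbhd iterD. Qed.

Lemma closed_star_mono S S' K K' : S `<=` S' -> K `<=` K' ->
  closed_star S K `<=` closed_star S' K'.
Proof.
move=> SS KK t [St [s [v [Ss ts vs Kv]]]]; split; first exact: SS.
by exists s, v; split=> //; [exact: SS | exact: KK].
Qed.

Lemma star_nbhd_mono S S' r K K' : S `<=` S' -> K `<=` K' ->
  star_nbhd S r K `<=` star_nbhd S' r K'.
Proof. by move=> SS KK; elim: r => [|r IH] //; rewrite !star_nbhdS; exact: closed_star_mono. Qed.

Lemma ball_mono S S' u r : S `<=` S' -> ball S u r `<=` ball S' u r.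
Proof. by move=> SS; exact: star_nbhd_mono. Qed.

Lemma near0 S u v : near S 0 u v <-> v = u.
Proof.
by split=> [|->]; rewrite /near /ball //= => /fsetP /(_ v); rewrite !inE eqxx => /esym/eqP.
Qed.

Lemma near_refl S u : near S 0 u u. Proof. exact/near0. Qed.

Lemma nearS S r u v : near S r.+1 u v <->
  S [fset v]%fset /\ exists s w, [/\ S s, v \in s, w \in s & near S r u w].
Proof.
rewrite /near /ball star_nbhdS /closed_star /=; split=> -[Sv [s [w [Ss vs ws uw]]]]; split=> //.
  by exists s, w; rewrite -fsub1set.
by exists s, w; rewrite fsub1set.
Qed.

Lemma near_trans S r r' u v w : near S r u v -> near S r' v w -> near S (r' + r) u w.
Proof.
move=> uv; rewrite /near {2}/ball star_nbhdD; apply: star_nbhd_mono => // s /= ->.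
exact: uv.
Qed.

Lemma star_nbhd_vertex S r K v : star_nbhd S r K [fset v]%fset <->
  exists2 u, K [fset u]%fset & near S r u v.
Proof.
elim: r v => [|r IH] v.
  by split=> [Kv|[u Ku /near0 ->] //]; exists v => //; exact: near_refl.
rewrite star_nbhdS /closed_star /=; split=> [[Sv [s [w [Ss vs ws /IH[u Ku uw]]]]]|].
  by exists u => //; apply/nearS; split=> //; exists s, w; rewrite -fsub1set.
move=> [u Ku /nearS[Sv [s [w [Ss vs ws uw]]]]]; split=> //; exists s, w.
by rewrite fsub1set; split=> //; apply/IH; exists u.
Qed.

Lemma star_nbhd_next S r K t v : S t -> v \in t -> star_nbhd S r K [fset v]%fset ->
  star_nbhd S r.+1 K t.
Proof. by move=> St vt Kv; split=> //; exists t, v. Qed.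

Section Simplicial.
Variable S : set {fset V}.
Hypothesis Ssim : simplicial_complex S.

Lemma simplex_neq0 s : S s -> s != fset0.
Proof. by move=> Ss; apply/eqP => s0; case: Ssim => + _; rewrite -s0. Qed.

Lemma simplex_face s t : S s -> (t `<=` s)%fset -> t != fset0 -> S t.
Proof. by case: Ssim => _; apply. Qed.

Lemma simplex_vertex s v : S s -> v \in s -> S [fset v]%fset.
Proof.
move=> Ss vs; apply: (simplex_face Ss); rewrite ?fsub1set //.
by apply/fset0Pn; exists v; rewrite inE.
Qed.

Lemma simplex_pick s : S s -> exists v, v \in s.
Proof. by move=> /simplex_neq0 /fset0Pn. Qed.

Lemma near_succ r u v : S [fset v]%fset -> near S r u v -> near S r.+1 u v.
Proof. by move=> Sv uv; apply/nearS; split=> //; exists [fset v]%fset, v; rewrite inE. Qed.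

Lemma near_leq r r' u v : (r <= r')%N -> S [fset v]%fset -> near S r u v -> near S r' u v.
Proof.
move=> rr' Sv uv; rewrite -(subnK rr'); elim: (r' - r)%N => // n IH.
by rewrite addSn; exact: near_succ.
Qed.

Lemma near_edge s v w : S s -> v \in s -> w \in s -> near S 1 v w.
Proof.
move=> Ss vs ws; apply/nearS; split; first exact: simplex_vertex ws.
by exists s, v; split=> //; exact: near_refl.
Qed.

Lemma near_sym r u v : near S r u v -> near S r v u.
Proof.
elim: r v => [|r IH] v; first by move=> /near0->; exact: near_refl.
move=> /nearS[Sv [s [w [Ss vs ws uw]]]].
by rewrite -addn1; apply: near_trans (IH _ uw); exact: near_edge Ss vs ws.
Qed.

Lemma subcomplex_nbhd r K : subcomplex K S -> subcomplex (star_nbhd S r K) S.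
Proof.
move=> KS; elim: r => [|r [[IH0 IHf] IHs]] //; rewrite star_nbhdS; split=> [|t []//].
split=> [[/simplex_neq0]|]; first by rewrite eqxx.
move=> s t [Ss [s' [v [Ss' ss' vs' Kv]]]] ts t0; split; first exact: simplex_face ts t0.
by exists s', v; split=> //; exact: fsubset_trans ss'.
Qed.

Lemma subcomplex_vertex u : S [fset u]%fset -> subcomplex [set [fset u]%fset] S.
Proof.
move=> Su; split=> [|t ->//]; split=> [/= /esym/eqP|s t -> tu t0].
  by apply/negP; exact: simplex_neq0.
rewrite /=; apply/eqP; rewrite eqEfsubset tu /= fsub1set.
have /fset0Pn[v vt] := t0.
by move/fsubsetP: tu => /(_ _ vt); rewrite inE => /eqP <-.
Qed.

Lemma subcomplex_ball u r : S [fset u]%fset -> subcomplex (ball S u r) S.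
Proof. by move=> /subcomplex_vertex; exact: subcomplex_nbhd. Qed.

Lemma subcomplex_face K s v : subcomplex K S -> K s -> v \in s -> K [fset v]%fset.
Proof.
move=> [[_ Kf] _] Ks vs; apply: (Kf s); rewrite ?fsub1set //.
by apply/fset0Pn; exists v; rewrite inE.
Qed.

Lemma ball_near u r t v : S [fset u]%fset -> ball S u r t -> v \in t -> near S r u v.
Proof. by move=> /(subcomplex_ball r) bS ut vt; exact: subcomplex_face ut vt. Qed.

Lemma near_ball u r t v : S t -> v \in t -> near S r u v -> ball S u r.+1 t.
Proof. by move=> St vt uv; exact: star_nbhd_next vt uv. Qed.

Lemma ball_trans u v r r' : near S r u v -> ball S v r' `<=` ball S u (r' + r).
Proof.
move=> uv; rewrite {2}/ball star_nbhdD; apply: star_nbhd_mono => // s /= ->; exact: uv.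
Qed.

Lemma star_nbhd_leq r r' K : subcomplex K S -> (r <= r')%N ->
  star_nbhd S r K `<=` star_nbhd S r' K.
Proof.
move=> KS rr'; rewrite -(subnK rr'); elim: (r' - r)%N => // n IH t /IH {IH} Kt.
have nS := subcomplex_nbhd (n + r) KS.
have St : S t by case: nS => _; apply.
have [v vt] := simplex_pick St.
by rewrite addSn; apply: (star_nbhd_next St vt); exact: (subcomplex_face nS Kt vt).
Qed.

Lemma ball_leq r r' u : S [fset u]%fset -> (r <= r')%N -> ball S u r `<=` ball S u r'.
Proof. by move=> /subcomplex_vertex; exact: star_nbhd_leq. Qed.

Lemma closed_star_finite K : locally_finite S -> subcomplex K S ->
  finite_set K -> finite_set (closed_star S K).
Proof.
move=> lf KS fK.
apply: (@sub_finite_set _ _ (\bigcup_(t in K) \bigcup_(v in [set` t])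
   \bigcup_(s in [set s | S s /\ v \in s]) [set` fpowerset s])).
  move=> t [St [s [v [Ss ts vs Kv]]]]; exists [fset v]%fset => //.
  exists v; first by rewrite /= inE.
  by exists s => //=; rewrite fpowersetE.
apply: bigcup_finite => // t _; apply: bigcup_finite; first exact: finite_fset.
by move=> v _; apply: bigcup_finite => [|s _]; [exact: lf | exact: finite_fset].
Qed.

Lemma ball_finite u r : locally_finite S -> S [fset u]%fset -> finite_set (ball S u r).
Proof.
move=> lf Su; elim: r => [|r IH]; first exact: finite_set1.
by apply: closed_star_finite => //; exact: subcomplex_ball.
Qed.

(** [complement] contains all faces of the simplices outside the neighbourhood, and such faces may
    lie on its frontier. One star is lost, which explains most of the [.+1] in the radii below. *)
Lemma complement_far r K t : complement S (star_nbhd S r.+1 K) t ->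
  S t /\ forall v, v \in t -> ~ star_nbhd S r K [fset v]%fset.
Proof.
move=> [t0 [s [Ss nK ts]]]; split; first exact: simplex_face ts t0.
by move=> v vt Kv; apply: nK; apply: star_nbhd_next Kv => //; exact: (fsubsetP ts).
Qed.

Lemma notin_complement L t : S t -> ~ L t -> complement S L t.
Proof. by move=> St nL; split; [exact: simplex_neq0 | exists t]. Qed.

Lemma far_complement r K t v : subcomplex K S -> S t -> v \in t ->
  ~ star_nbhd S r K [fset v]%fset -> complement S (star_nbhd S r K) t.
Proof.
move=> KS St vt nK; apply: notin_complement => // Kt; apply: nK.
exact: subcomplex_face (subcomplex_nbhd r KS) Kt vt.
Qed.

Lemma complement_subset L : complement S L `<=` S.
Proof. by move=> t [t0 [s [Ss _ ts]]]; exact: simplex_face ts t0. Qed.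

Lemma complement_simplicial L : simplicial_complex (complement S L).
Proof.
split=> [[]|s t [s0 [r [Sr nL sr]]] ts t0]; first by rewrite eqxx.
by split=> //; exists r; split=> //; exact: fsubset_trans sr.
Qed.

Lemma faces_subcomplex s : S s -> subcomplex (faces s) S.
Proof.
move=> Ss; split=> [|t [t0 ts]]; last exact: simplex_face ts t0.
split=> [[]|t t' [t0 ts] tt t'0]; first by rewrite eqxx.
by split=> //; exact: fsubset_trans ts.
Qed.

Lemma set0_subcomplex : subcomplex set0 S.
Proof. by split=> //; split. Qed.

Lemma star_nbhd_faces s r t v : S s -> star_nbhd S r (faces s) t -> v \in t ->
  exists2 u, u \in s & near S r u v.
Proof.
move=> /faces_subcomplex /(subcomplex_nbhd r) fS st vt.
have /star_nbhd_vertex[u [_ us] uv] := subcomplex_face fS st vt.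
by exists u => //; rewrite -fsub1set.
Qed.

End Simplicial.

Lemma star_nbhd_set0 S r : star_nbhd S r set0 = set0.
Proof.
elim: r => // r IH; rewrite star_nbhdS IH; apply/seteqP; split=> // t.
by move=> [_ [s [v []]]].
Qed.

Lemma complement_set0 S : simplicial_complex S -> complement S set0 = S.
Proof.
move=> Ss; apply/seteqP; split=> t; first exact: complement_subset.
by move=> St; apply: notin_complement.
Qed.

End Stars.

Section LinearExtension.
Variables (d d' : Order.disp_t) (V : orderType d) (W : orderType d').

Definition linear_ext (h : {fset V} -> cochain W) : cochain V -> cochain W :=
  fun c t => evaluation (fun s => h s t) c.

Lemma linear_ext_simplex h s : linear_ext h (simplex_chain s) = h s.
Proof.
by apply: funext => t; rewrite /linear_ext evaluation_simplex.
Qed.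

Lemma linear_extB h S i : {in chains S i &, {morph linear_ext h : a b / a - b}}.
Proof.
move=> a b aS bS; apply: funext => t.
by rewrite [LHS](evaluationB_chains _ aS bS).
Qed.

Lemma linear_ext_chains h S i T j :
  (forall s, S s -> #|` s|%:Z = i + 1 -> h s \in chains T j) ->
  {homo linear_ext h : c / c \in chains S i >-> c \in chains T j}.
Proof.
move=> hT; apply: chain_ind => [|a b aS bS aT bT|s Ss sE].
- by rewrite (morphB0 (@linear_extB h S i)) rpred0.
- by rewrite (linear_extB h aS bS) rpredB.
- by rewrite linear_ext_simplex; exact: hT.
Qed.

End LinearExtension.

(** * Length metric and edge paths *)

(** Uniform acyclicity for balls around vertices, in all degrees and without the metric; with
    [boundary setT] the cycles are the reduced ones. Unlike [uniformly_acyclic] it holds for the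
    empty complex, so that one argument covers pairs with [Z1] empty. *)
Definition comb_acyclic (d : Order.disp_t) (V : orderType d) (S : set {fset V}) :=
  forall (j : int) (r : nat), exists r' : nat, forall w, S [fset w]%fset ->
  forall y, y \in chains (augmented (ball S w r)) j -> boundary setT y = 0 ->
  exists2 x, x \in chains (augmented (ball S w r')) (j + 1) & boundary setT x = y.

Section Metric.
Variables (R : realType) (d : Order.disp_t) (V : orderType d).
Implicit Types (S K X : set {fset V}) (s t : {fset V}) (u v w : V) (x y z : V -> R) (phi : V -> R).

Definition vertex_point v : V -> R := fun w => (w == v)%:R.

Lemma vertex_in_simplex s v : v \in s -> in_simplex s (vertex_point v).
Proof.
move=> vs; split=> [w|w ws|]; rewrite /vertex_point ?ler0n //.
  by case: (w =P v) ws => // ->; rewrite vs.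
rewrite (bigD1_seq v) ?fset_uniq //= eqxx big1 ?addr0 // => w /negbTE-> //.
Qed.

Lemma in_simplex_le1 s x v : in_simplex s x -> x v <= 1.
Proof.
move=> [x0 xs x1]; have [vs|/xs->//] := boolP (v \in s).
rewrite -x1 (bigD1_seq v) ?fset_uniq //= lerDl; apply: sumr_ge0 => w _; exact: x0.
Qed.

(** For coordinates in the unit interval the square of a difference is at most the sum, and the
    coordinates of both points add up to 2. *)
Lemma simplex_dist_le1 s x y : in_simplex s x -> in_simplex s y -> simplex_dist s x y <= 1.
Proof.
move=> xs ys; have [x0 _ x1] := xs; have [y0 _ y1] := ys.
rewrite /simplex_dist -[leRHS]sqrtr1 ler_sqrt ?ler01 // ler_pdivrMr ?mul1r ?ltr0n //.
apply: (@le_trans _ _ (\sum_(v <- s) (x v + y v))).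
  apply: ler_sum => v _; have := x0 v; have := y0 v.
  have := in_simplex_le1 v xs; have := in_simplex_le1 v ys; nra.
by rewrite big_split /= x1 y1.
Qed.

Lemma coordinate_le s x y v : v \in s -> `|x v - y v| <= 2 * simplex_dist s x y.
Proof.
move=> vs; rewrite -ler_sqr ?nnegrE ?mulr_ge0 ?sqrtr_ge0 ?ler0n //.
have S0 : 0 <= (\sum_(v <- s) (x v - y v) ^+ 2).
  by apply: sumr_ge0 => w _; exact: sqr_ge0.
rewrite exprMn sqr_sqrtr ?divr_ge0 ?ler0n // real_normK ?num_real //.
have : (x v - y v) ^+ 2 <= \sum_(v <- s) (x v - y v) ^+ 2.
  rewrite (bigD1_seq v) ?fset_uniq //= lerDl; apply: sumr_ge0 => w _; exact: sqr_ge0.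
lra.
Qed.

(* The affine extension of an edge-path distance is Lipschitz for the length metric; this
   is how [dist_near] bounds edge paths by lengths. *)
Definition mean phi x : R := \sum_(v \in setT) x v * phi v.

Lemma meanE phi s x : in_simplex s x -> mean phi x = \sum_(v <- s) x v * phi v.
Proof. by move=> [_ xs _]; rewrite /mean (fsbigTE s) // => v /xs ->; rewrite mul0r. Qed.

Lemma dist_le1 (a b : R) : a <= b + 1 -> b <= a + 1 -> `|a - b| <= 1.
Proof. by move=> ab ba; apply/ler_normlP; split; lra. Qed.

Lemma chain_bound (a b c e : R) : `|a - 0| <= 1 -> `|b - c| <= 1 -> `|a - b| <= e ->
  c <= 2 + e.
Proof. by move=> /ler_normlP[? ?] /ler_normlP[? ?] /ler_normlP[? ?]; lra. Qed.

Section Lipschitz.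
Variables (S : set {fset V}) (m : nat) (phi : V -> R).
Hypothesis Sm : forall s, S s -> (#|` s| <= m)%N.
Hypothesis phi_lip : forall s u v, S s -> u \in s -> v \in s -> `|phi u - phi v| <= 1.

Lemma mean_near s x u : S s -> in_simplex s x -> u \in s -> `|mean phi x - phi u| <= 1.
Proof.
move=> Ss xs us; rewrite (meanE _ xs); have [x0 _ x1] := xs.
have -> : phi u = \sum_(v <- s) x v * phi u by rewrite -mulr_suml x1 mul1r.
rewrite -sumrB -x1; apply: le_trans (ler_norm_sum _ _ _) _.
rewrite big_seq [leRHS]big_seq; apply: ler_sum => v vs; rewrite -mulrBr normrM ger0_norm //.
by rewrite ler_piMr // (phi_lip Ss).
Qed.

(** Both points have coordinate sum 1, so [phi] may be replaced by [phi - phi u], which is bounded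
    by 1 on the simplex. *)
Lemma mean_step s x y : S s -> in_simplex s x -> in_simplex s y ->
  `|mean phi x - mean phi y| <= (2 * m)%:R * simplex_dist s x y.
Proof.
move=> Ss xs ys; rewrite (meanE _ xs) (meanE _ ys) -sumrB.
have [x0 _ x1] := xs; have [y0 _ y1] := ys.
have [->|/fset0Pn[u us]] := eqVneq s fset0.
  by rewrite big_seq_fset0 normr0 mulr_ge0 ?ler0n ?sqrtr_ge0.
have -> : \sum_(v <- s) (x v * phi v - y v * phi v) =
    \sum_(v <- s) (x v - y v) * (phi v - phi u).
  apply/eqP; rewrite -subr_eq0 -sumrB.
  have -> : \sum_(v <- s) (x v * phi v - y v * phi v - (x v - y v) * (phi v - phi u)) =
     \sum_(v <- s) (x v * phi u - y v * phi u) by apply: eq_bigr => v _; ring.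
  by rewrite sumrB -!mulr_suml x1 y1 subrr.
apply: le_trans (ler_norm_sum _ _ _) _.
apply: (@le_trans _ _ (\sum_(v <- s) 2 * simplex_dist s x y)).
  rewrite big_seq [leRHS]big_seq; apply: ler_sum => v vs; rewrite normrM.
  apply: le_trans (coordinate_le x y vs).
  by rewrite ler_piMr ?normr_ge0 // (phi_lip Ss).
rewrite big_const_seq count_predT iter_addr_0 -mulr_natr -/(#|` s|).
have : (#|` s|%:R : R) <= m%:R by rewrite ler_nat Sm.
have : 0 <= simplex_dist s x y by exact: sqrtr_ge0.
move=> D0 sm; rewrite -(mulr_natr _ #|` s|) natrM mul1r mulrAC.
by apply: ler_wpM2r => //; apply: ler_wpM2l => //; rewrite ler0n.
Qed.

Lemma broken_line_mean x y l : broken_line S x y l ->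
  `|mean phi x - mean phi y| <= (2 * m)%:R * l.
Proof.
elim=> {x y l} [x _|s x y z l Ss xs ys _ IH]; first by rewrite subrr normr0 mulr0.
rewrite -(subrKA (mean phi y)) mulrDr; apply: le_trans (ler_normD _ _) _.
by apply: lerD => //; exact: mean_step.
Qed.

End Lipschitz.

Lemma broken_line_ge0 S x y l : broken_line S x y l -> 0 <= l.
Proof. by elim=> // {x y l} s x y z l *; rewrite addr_ge0 ?sqrtr_ge0. Qed.

Lemma connected_near S u v : simplicial_complex S -> connected_complex S ->
  S [fset u]%fset -> S [fset v]%fset -> exists r, near S r u v.
Proof.
move=> Ssim [_ conn] Su Sv; have [p + <-] := conn u v Su Sv.
elim: p u Su {v Sv} => [|w p IH] u Su /=; first by exists 0; exact: near_refl.
move=> /andP[/asboolP uw /IH]; have Sw : S [fset w]%fset.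
  by apply: (simplex_vertex Ssim uw); rewrite !inE eqxx orbT.
move=> /(_ Sw)[r wr]; exists (r + 1)%N; apply: near_trans wr.
by apply: (near_edge Ssim uw); rewrite !inE eqxx ?orbT.
Qed.

Lemma near_broken_line S r u v y l : simplicial_complex S -> near S r u v ->
  broken_line S (vertex_point v) y l ->
  exists2 l', l' <= r%:R + l & broken_line S (vertex_point u) y l'.
Proof.
move=> Ssim; elim: r v l => [|r IH] v l; first by move=> /near0-> ln; exists l; rewrite // add0r.
move=> /nearS[Sv [s [w [Ss vs ws /IH uw]]]] ln.
have [ps pw] := (vertex_in_simplex vs, vertex_in_simplex ws).
have [l' l'l ln'] := uw _ (broken_lineS Ss pw ps ln).
exists l' => //; apply: le_trans l'l _; rewrite -natr1 -addrA lerD2l lerD2r.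
exact: simplex_dist_le1.
Qed.

(** The additional 2 pays for the ways from [x] to [u] and from [v] to [y]. A broken line is
    returned as well, since [dist] is an infimum and says nothing when no line exists. *)
Lemma near_dist S r u v s t x y : simplicial_complex S -> near S r u v ->
  S s -> S t -> u \in s -> v \in t -> in_simplex s x -> in_simplex t y ->
  (exists l, broken_line S x y l) /\ dist S x y <= (r + 2)%:R.
Proof.
move=> Ssim uv Ss St us vt xs yt.
have [pu pv] := (vertex_in_simplex us, vertex_in_simplex vt).
have y0 : broken_line S y y 0 by apply: broken_line0; exists t.
have [l' l'l ln] := near_broken_line Ssim uv (broken_lineS St pv yt y0).
have ln' := broken_lineS Ss xs pu ln.
split; first by eexists; exact: ln'.
apply: le_trans (_ : simplex_dist s x (vertex_point u) + l' <= _).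
  apply: ge_inf => //; exists 0 => l; exact: broken_line_ge0.
have := simplex_dist_le1 xs pu; have := simplex_dist_le1 pv yt; rewrite natrD.
move: l'l; rewrite addr0; move: (simplex_dist s x _) (simplex_dist t _ y) (r%:R : R).
by clear=> A B C; lra.
Qed.

Lemma dist_near S m r : metric_complex S -> (forall s, S s -> (#|` s| <= m)%N) ->
  exists N : nat, forall s t u v x y, S s -> S t -> u \in s -> v \in t ->
    in_simplex s x -> in_simplex t y -> dist S x y <= r -> near S N u v.
Proof.
move=> [Ssim conn _] Sm.
(* The 2 covers the passage from [x] to [u] and from [y] to [v], [2 m] is the Lipschitz constant of
   [mean], and the final 1 is the slack of a nearly shortest broken line. *)
pose B : R := 2 + (2 * m)%:R * (`|r| + 1); exists (Num.bound B) => s t u v x y Ss St us vt xs yt dr.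
have Su := simplex_vertex Ssim Ss us; have Sv := simplex_vertex Ssim St vt.
pose P w n := `[< near S n u w >].
have Pex w : S [fset w]%fset -> exists n, P w n.
  by move=> /(connected_near Ssim conn Su)[n uw]; exists n; exact/asboolP.
pose dd w := if pselect (exists n, P w n) is left h then ex_minn h else 0%N.
have ddP w : S [fset w]%fset -> near S (dd w) u w /\ forall n, near S n u w -> (dd w <= n)%N.
  move=> Sw; rewrite /dd; case: pselect => [h|/(_ (Pex w Sw))//].
  by case: ex_minnP => n /asboolP un nmin; split=> // n' un'; apply: nmin; exact/asboolP.
have dd_step s' a b : S s' -> a \in s' -> b \in s' -> (dd a <= dd b + 1)%N.
  move=> Ss' as' bs'; have Sa := simplex_vertex Ssim Ss' as'.
  have Sb := simplex_vertex Ssim Ss' bs'.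
  apply: (proj2 (ddP a Sa)); rewrite addnC; apply: near_trans (proj1 (ddP b Sb)) _.
  exact: near_edge Ss' bs' as'.
pose phi w : R := (dd w)%:R.
have lip s' a b : S s' -> a \in s' -> b \in s' -> `|phi a - phi b| <= 1.
  move=> Ss' as' bs'; have := dd_step _ _ _ Ss' as' bs'; have := dd_step _ _ _ Ss' bs' as'.
  rewrite /phi -!(ler_nat R) !natrD => ba ab; exact: dist_le1.
have [r0 uv] := connected_near Ssim conn Su Sv.
have [[l0 ln0] _] := near_dist Ssim uv Ss St us vt xs yt.
have [l ln lr] : exists2 l, broken_line S x y l & l < dist S x y + 1.
  apply: inf_adherent; rewrite ?ltr01 //; split; first by exists l0.
  by exists 0 => l; exact: broken_line_ge0.
have dv : (dd v)%:R <= B.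
  have du : dd u = 0%N.
    by apply/eqP; rewrite -leqn0; apply: (proj2 (ddP u Su)); exact: near_refl.
  have m1 := mean_near lip Ss xs us; have m2 := mean_near lip St yt vt.
  have m3 := broken_line_mean Sm lip ln.
  have m4 : (2 * m)%:R * l <= (2 * m)%:R * (`|r| + 1).
    apply: ler_wpM2l; rewrite ?ler0n //; apply: le_trans (ltW lr) _; rewrite lerD2r.
    exact: le_trans dr (ler_norm r).
  move: m1; rewrite [X in _ - X](_ : _ = 0) => [m1|]; last by rewrite /phi du.
  exact: chain_bound m1 m2 (le_trans m3 m4).
suff dB : (dd v <= Num.bound B)%N by exact: near_leq dB Sv (proj1 (ddP v Sv)).
have : B < (Num.bound B)%:R.
  apply: archi_boundP; rewrite /B addr_ge0 ?ler0n // mulr_ge0 ?ler0n // addr_ge0 ?ler01 //.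
by move=> /(le_lt_trans dv); rewrite ltr_nat => /ltnW.
Qed.

End Metric.

(** * Extension of chain maps along carriers *)

Section Augmented.
Variables (d : Order.disp_t) (V : orderType d).
Implicit Types (S T K : set {fset V}) (s t : {fset V}) (c : cochain V) (i : int).

Lemma augmented_face S s t : simplicial_complex S -> augmented S s -> (t `<=` s)%fset ->
  augmented S t.
Proof.
move=> Ssim [Ss|->] ts; last by right; move: ts; rewrite fsubset0 => /eqP.
have [->|t0] := eqVneq t fset0; [by right | by left; exact: simplex_face ts t0].
Qed.

Lemma boundary_augmented S i c : simplicial_complex S -> c \in chains (augmented S) i ->
  boundary (augmented S) c = boundary setT c.
Proof.
move=> Ssim cS; symmetry; apply: (@boundary_sub _ _ _ _ i) => // s t Ss _ ts.
exact: augmented_face Ss ts.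
Qed.

Lemma chains_boundary S i c : simplicial_complex S -> c \in chains (augmented S) i ->
  boundary setT c \in chains (augmented S) (i - 1).
Proof.
move=> Ssim cS; rewrite -(boundary_augmented Ssim cS).
by apply: boundary_finsupp; exact: chainsT cS.
Qed.

Lemma chains_augmented S i c : c \in chains S i -> c \in chains (augmented S) i.
Proof. by move=> /chains_in; apply=> s Ss _; left. Qed.

Lemma chains_unaugmented S i c : i != -1 -> c \in chains (augmented S) i -> c \in chains S i.
Proof.
move=> i1 cS; apply: (chains_in cS) => s [//|s0] cs; case/eqP: i1.
by have := chains_card cS cs; rewrite s0 cardfs0; lia.
Qed.

Lemma chains_cut S i c : simplicial_complex S ->
  c \in chains (augmented S) i -> restriction S c \in chains S i.
Proof.
move=> Ssim /(chains_restriction S); rewrite (_ : _ `&` _ = S) //.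
by apply/seteqP; split=> [s []//|s Ss]; split=> //; left.
Qed.

Lemma boundary_chains S i c : c \in chains S i -> boundary S c \in chains S (i - 1).
Proof. by move=> /chainsT; exact: boundary_finsupp. Qed.

Lemma boundary_pos S i c : simplicial_complex S -> i != 0 -> c \in chains S i ->
  boundary S c = boundary setT c.
Proof.
move=> Ssim i0 cS; rewrite boundaryE; apply: restriction_id => s bs.
have bS := chains_unaugmented _ (chains_boundary Ssim (chains_augmented cS)).
by apply: chains_mem bs; apply: bS; lia.
Qed.

Lemma boundary_zero S c : simplicial_complex S -> c \in chains S 0 -> boundary S c = 0.
Proof.
move=> Ssim cS; apply: funext => s.
have bS := boundary_chains cS; apply/eqP/negPn/negP => bs.
have := chains_card bS bs; have := simplex_neq0 Ssim (chains_mem bS bs).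
by rewrite -cardfs_gt0; lia.
Qed.

Lemma boundary_boundary S i c : simplicial_complex S -> c \in chains S i ->
  boundary S (boundary S c) = 0.
Proof.
move=> Ssim cS; have [i0|i0] := eqVneq i 0.
  by move: cS; rewrite i0 => cS; rewrite (boundary_zero Ssim cS) (morphB0 (@boundaryB_chains _ _ S S 0)).
rewrite (boundary_pos Ssim i0 cS) boundaryE (boundaryTT (chainsT cS)).
by apply: funext => s; rewrite /restriction; case: asboolP.
Qed.

End Augmented.

Lemma inclusion_respects (d : Order.disp_t) (V : orderType d) (S T S' T' : set {fset V}) i :
  S `<=` S' -> face_closed S S' -> T `<=` T' ->
  respects (relative_cycles S T i) (relative_boundaries S T i)
    (relative_cycles S' T' i) (relative_boundaries S' T' i) id.
Proof.
move=> SS fc TT; split=> // [c /andP[cS cT]|c _ /asboolP[b [a [bS aT ->]]]].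
  apply/andP; split; first exact: chains_sub cS.
  by rewrite (boundary_sub SS fc cS); exact: chains_sub cT.
apply/asboolP; exists b, a; split; first exact: chains_sub bS.
  exact: chains_sub aT.
by rewrite (boundary_sub SS fc bS).
Qed.

(** A ball of radius [r] has diameter at most [2 r + 2], whatever its centre, so uniform acyclicity
    fills its cycles within a radius that depends on [r] and the degree only. *)
Lemma comb_acyclicP (R : realType) (d : Order.disp_t) (V : orderType d) (S : set {fset V}) :
  metric_complex S -> uniformly_acyclic R S ->
  comb_acyclic S /\ exists m : nat, forall s, S s -> (#|` s| <= m)%N.
Proof.
move=> [Ssim conn lf] [m [Sm _] acyc]; split; last by exists m.+1.
(* Above the dimension every chain vanishes and any radius will do. *)
move=> j r; have [jm|jm] := leP j m%:Z; last first.
  exists 0 => w Sw y yK _; exists 0; first by rewrite rpred0.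
  rewrite (morphB0 (@boundaryB_chains _ _ setT setT 0)).
  apply: funext => s; apply/esym/eqP/negPn/negP => ys.
  have [Ss|s0] := chains_mem yK ys.
    have [_ bS] := subcomplex_ball Ssim r Sw.
    by have := Sm s (bS _ Ss); have := chains_card yK ys; lia.
  by have := chains_card yK ys; rewrite s0 cardfs0; lia.
have r0 : 0 < (r + r + 2)%:R :> R by rewrite ltr0n addn2.
have [r2 _ kill] := acyc j _ jm r0; exists (r2 + r)%N => w Sw y yK dy.
have bS := subcomplex_ball Ssim r Sw; have [Ksim KS] := bS.
have [Nsim NS] := subcomplex_nbhd Ssim r2 bS.
have K0 : ball S w r !=set0.
  by exists [fset w]%fset; apply: (ball_leq Ssim Sw (leq0n r)).
have diam : diameter_le S (ball S w r) ((r + r + 2)%:R : R).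
  move=> x z [s Ks xs] [t Kt zt].
  have [u us] := simplex_pick Ssim (KS _ Ks); have [v vt] := simplex_pick Ssim (KS _ Kt).
  have uw := near_sym Ssim (ball_near Ssim Sw Ks us).
  have vw := ball_near Ssim Sw Kt vt.
  exact: (proj2 (near_dist Ssim (near_trans uw vw) (KS _ Ks) (KS _ Kt) us vt xs zt)).
have bK := boundary_augmented Ksim yK.
have yZ : y \in relative_cycles (augmented (ball S w r)) set0 j.
  by apply/andP; split=> //; rewrite bK dy rpred0.
have /= := kill _ bS K0 diam (cls _ _ y); rewrite /reduced_inclusion.
have sub : ball S w r `<=` star_nbhd S r2 (ball S w r).
  exact: (star_nbhd_leq Ssim bS (leq0n r2)).
have asub := augmented_sub sub.
have fc : face_closed (augmented (ball S w r)) (augmented (star_nbhd S r2 (ball S w r))).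
  by move=> s t Ss _ ts; exact: augmented_face Ksim Ss ts.
have incl := inclusion_respects j asub fc (@subset_refl _ set0).
rewrite (hmap_cls incl) //; have [_ inclZ _] := incl.
move=> /(cls_eq0 _ (inclZ _ yZ))/asboolP[b [a [bN a0 yE]]].
exists b; first by rewrite /ball star_nbhdD.
have -> : y = boundary setT b + a by rewrite yE (boundary_augmented Nsim bN).
rewrite (_ : a = 0) ?addr0 //; apply: funext => s.
exact: chains_out a0 _.
Qed.

(* A chain map is the case [e = 0], [eps = 1], [Phi = 0]; a homotopy between [phi] and [psi]
   is the case [e = 1], [eps = -1], [Phi = phi - psi].  The full boundary [boundary setT]
   treats the empty simplex as a simplex of degree -1, so that reduced cycles are cycles. *)
Section Carrier.
Variables (d d' : Order.disp_t) (V : orderType d) (W : orderType d').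
Variables (S : set {fset V}) (T D : {fset V} -> set {fset W}) (e eps : int).
Variables (Phi : cochain V -> cochain W) (h0 : cochain W).
Hypothesis Ssim : simplicial_complex S.
Hypothesis PhiB : forall i, {in chains (augmented S) i &, {morph Phi : a b / a - b}}.
Hypothesis PhiD : forall s, S s -> Phi (simplex_chain s) \in chains (D s) (#|` s|%:Z - 2 + e).
Hypothesis PhiC : forall s, S s ->
  boundary setT (Phi (simplex_chain s)) + Phi (boundary setT (simplex_chain s)) *~ eps = 0.
Hypothesis h0T : h0 \in chains (T fset0) (e - 1).
Hypothesis h0P : boundary setT h0 = Phi (simplex_chain fset0).
Hypothesis TD : forall s v, S s -> v \in s -> T (s `\ v)%fset `<=` D s.
Hypothesis fill : forall s y, S s -> y \in chains (D s) (#|` s|%:Z - 2 + e) ->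
  boundary setT y = 0 ->
  exists2 x, x \in chains (T s) (#|` s|%:Z - 1 + e) & boundary setT x = y.

Let solution s y x := x \in chains (T s) (#|` s|%:Z - 1 + e) /\ boundary setT x = y.
Let sol s y : cochain W :=
  if pselect (exists x, solution s y x) is left ex then projT1 (cid ex) else 0.

Let solP s y : S s -> y \in chains (D s) (#|` s|%:Z - 2 + e) -> boundary setT y = 0 ->
  solution s y (sol s y).
Proof.
move=> Ss yD y0; rewrite /sol; case: pselect => [ex|[]]; first exact: projT2 (cid ex).
by have [x xT xy] := fill Ss yD y0; exists x.
Qed.

Let Fixpoint hrec (n : nat) (s : {fset V}) : cochain W :=
  if n is n'.+1 then
    sol s (Phi (simplex_chain s) + (\sum_(v <- s) hrec n' (s `\ v)%fset *~ incidence s v) *~ eps)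
  else h0.
Let h s := hrec #|` s| s.

Lemma linear_ext_boundary (g : {fset V} -> cochain W) s :
  linear_ext g (boundary setT (simplex_chain s)) = \sum_(v <- s) g (s `\ v)%fset *~ incidence s v.
Proof.
apply: funext => t; rewrite sum_at /linear_ext boundary_simplexT.
rewrite (proj2 (evaluation_sum _ _ _ _)); apply: eq_bigr => v _.
by rewrite mulrz_at.
Qed.

Let hE s : s != fset0 -> h s =
  sol s (Phi (simplex_chain s) + linear_ext h (boundary setT (simplex_chain s)) *~ eps).
Proof.
rewrite linear_ext_boundary -cardfs_gt0 {1}/h; case E : #|` s| => [//|n] _ /=.
congr (sol s (_ + _ *~ _)); apply: eq_big_seq => v vs; rewrite /h.
by move: E; rewrite (cardfsD1 v s) vs add1n => -[->].
Qed.

Let h_step n : 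
  (forall s, augmented S s -> #|` s| = n -> h s \in chains (T s) (n%:Z - 1 + e)) /\
  (forall c, c \in chains (augmented S) (n%:Z - 1) ->
     boundary setT (linear_ext h c) = Phi c + linear_ext h (boundary setT c) *~ eps).
Proof.
elim: n => [|n [IHT IHC]].
  have hs s : #|` s| = 0%N -> s = fset0 /\ h s = h0.
    by move=> s0; split; [exact: cardfs0_eq | rewrite /h s0].
  have hT s : augmented S s -> #|` s|%:Z = 0 - 1 + 1 -> h s \in chains setT (e - 1).
    by move=> _ sE; have [|-> ->] := hs s; [lia | exact: chainsT h0T].
  split=> [s _ /hs[-> ->]|]; first by rewrite sub0r addrC.
  apply: (chain_ext (S := augmented S) (i := 0 - 1)) => [a b aS bS|a b aS bS|s _ sE].
  - rewrite (linear_extB h aS bS) (boundaryB_chains _ (linear_ext_chains hT aS) (linear_ext_chains hT bS)) //.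
  - rewrite (PhiB aS bS) (boundaryB_chains _ (chainsT aS) (chainsT bS)).
    have bT x : x \in chains (augmented S) (0 - 1) -> boundary setT x \in chains setT (0 - 1 - 1).
      by move=> xS; apply: boundary_finsupp; exact: chainsT xS.
    by rewrite (linear_extB _ (bT _ aS) (bT _ bS)) mulrzBl opprD addrACA.
  have [|s0 hs0] := hs s; first by lia.
  rewrite linear_ext_simplex hs0 h0P -s0 linear_ext_boundary s0 big_seq_fset0.
  by rewrite mul0rz addr0.
have bsS s : S s -> #|` s| = n.+1 -> boundary setT (simplex_chain s) \in chains (augmented S) (n%:Z - 1).
  move=> Ss sn; have := @chains_boundary _ _ S n%:Z (simplex_chain s) Ssim.
  by apply; apply: simplex_chains; [left | rewrite sn; lia].
have IHT' s : augmented S s -> #|` s|%:Z = n%:Z - 1 + 1 -> h s \in chains setT (n%:Z - 1 + e).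
  by move=> Ss sE; apply: (chainsT (IHT s Ss _)); lia.
(* By the induction hypothesis the boundary of [y] is that of [Phi s] plus [eps] times [Phi] of the
   boundary of [s], which is zero by [PhiC]. *)
have rhs s : S s -> #|` s| = n.+1 ->
    let y := Phi (simplex_chain s) + linear_ext h (boundary setT (simplex_chain s)) *~ eps in
    y \in chains (D s) (#|` s|%:Z - 2 + e) /\ boundary setT y = 0.
  move=> Ss sn y; have bS := bsS s Ss sn.
  have hbS := linear_ext_chains IHT' bS.
  have PT := PhiD Ss; have deg : #|` s|%:Z - 2 + e = n%:Z - 1 + e by rewrite sn; lia.
  have hbD : linear_ext h (boundary setT (simplex_chain s)) \in chains (D s) (n%:Z - 1 + e).
    rewrite linear_ext_boundary big_seq rpred_sum // => v vs; apply: rpredMz.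
    have svn : #|` (s `\ v)%fset| = n by move: sn; rewrite (cardfsD1 v s) vs add1n => -[].
    have := IHT (s `\ v)%fset _ svn; move=> /(_ _)/chains_in; apply.
      by apply: (augmented_face Ssim (s := s)); [left | exact: fsubD1set].
    by move=> t /(TD Ss vs).
  split; first by rewrite /y deg rpredD ?rpredMz // -deg.
  rewrite /y (morphD (@boundaryB_chains _ _ setT setT (n%:Z - 1 + e))) ?rpredMz //; last first.
    by rewrite -deg; exact: chainsT PT.
  rewrite (morphMz _ (@boundaryB_chains _ _ setT setT (n%:Z - 1 + e))) // IHC //.
  have s1 : simplex_chain s \in chains setT (#|` s|%:Z - 1) by apply: simplex_chains; rewrite ?subrK.
  rewrite (boundaryTT s1) (morphB0 (@linear_extB _ _ _ _ h setT 0)) mul0rz addr0.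
  exact: PhiC.
have solved s : S s -> #|` s| = n.+1 -> solution s
    (Phi (simplex_chain s) + linear_ext h (boundary setT (simplex_chain s)) *~ eps) (h s).
  move=> Ss sn; rewrite hE; last exact: (simplex_neq0 Ssim).
  by have [yD y0] := rhs s Ss sn; exact: solP.
have inS s : augmented S s -> #|` s| = n.+1 -> S s.
  by move=> [//|->]; rewrite cardfs0.
have hT s : augmented S s -> #|` s|%:Z = n.+1%:Z - 1 + 1 -> h s \in chains setT (n.+1%:Z - 1 + e).
  move=> Ss sE; have sn : #|` s| = n.+1 by lia.
  by have [+ _] := solved s (inS s Ss sn) sn; rewrite sn => /chainsT.
split=> [s Ss sn|].
  by have [+ _] := solved s (inS s Ss sn) sn; rewrite sn.
apply: (chain_ext (S := augmented S) (i := n.+1%:Z - 1)) => [a b aS bS|a b aS bS|s Ss sE].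
- by rewrite (linear_extB h aS bS) (boundaryB_chains _ (linear_ext_chains hT aS) (linear_ext_chains hT bS)).
- rewrite (PhiB aS bS) (boundaryB_chains _ (chainsT aS) (chainsT bS)).
  have bT x : x \in chains (augmented S) (n.+1%:Z - 1) -> boundary setT x \in chains setT (n.+1%:Z - 1 - 1).
    by move=> xS; apply: boundary_finsupp; exact: chainsT xS.
  by rewrite (linear_extB _ (bT _ aS) (bT _ bS)) mulrzBl opprD addrACA.
have sn : #|` s| = n.+1 by lia.
by rewrite linear_ext_simplex (proj2 (solved s (inS s Ss sn) sn)).
Qed.

(** Acyclic carriers: [D s] carries the cycle to be filled at [s], made of [Phi s] and the values on
    the facets, and [T s] carries the filling. The induction on the number of vertices starts at the
    empty simplex with the prescribed value [h0]; for chain maps this is what makes [g] preserve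
    augmentations. *)
Lemma carrier_extension : exists g : cochain V -> cochain W,
  [/\ forall i, {in chains setT i &, {morph g : a b / a - b}},
      forall s, augmented S s -> g (simplex_chain s) \in chains (T s) (#|` s|%:Z - 1 + e),
      forall i c, c \in chains (augmented S) i ->
        boundary setT (g c) = Phi c + g (boundary setT c) *~ eps &
      g (simplex_chain fset0) = h0].
Proof.
exists (linear_ext h); split=> [i|s Ss|i c cS|]; first exact: linear_extB.
  by rewrite linear_ext_simplex; apply: (proj1 (h_step #|` s|)).
  (* Degree [i] is step [i + 1] of the induction; below -1 there are no chains. *)
  have [i1|i1] := leP (-1) i.
    have [_ hc] := h_step (absz (i + 1)); apply: hc; move: cS; suff <- : i = (absz (i + 1))%:Z - 1 by [].
    lia.
  have -> : c = 0.
    apply: funext => s; apply/eqP/negPn/negP => cs.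
    by have := chains_card cS cs; lia.
  rewrite (morphB0 (@linear_extB _ _ _ _ h setT 0)) (morphB0 (@PhiB 0)).
  rewrite !(morphB0 (@boundaryB_chains _ _ setT setT 0)) (morphB0 (@linear_extB _ _ _ _ h setT 0)).
  by rewrite mul0rz addr0.
by rewrite linear_ext_simplex /h cardfs0.
Qed.

End Carrier.

Section Augmentation.
Variables (d : Order.disp_t) (V : orderType d).
Implicit Types (S T : set {fset V}) (s t : {fset V}) (c x : cochain V) (i : int).

Lemma augmentationE c : augmentation c = evaluation (fun=> 1) c.
Proof. by apply: eq_fsbigr => s _; rewrite mul1r. Qed.

(** In degree 0 the full boundary is the augmentation, because the incidence of a vertex in its own
    singleton is 1. This is how augmentations are read off at the empty simplex. *)
Lemma boundary_augmentation c : c \in chains setT 0 -> boundary setT c = simplex_chain fset0 *~ augmentation c.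
Proof.
move=> cT; apply: funext => s; rewrite mulrz_at /simplex_chain.
have bT := boundary_finsupp setT cT; have [->|s0] := eqVneq s fset0; last first.
  rewrite mul0r; apply/eqP/negPn/negP => bs; have := chains_card bT bs.
  by move: s0; rewrite -cardfs_gt0; lia.
rewrite mul1r -evaluation_simplex_l (evaluation_boundaryT _ cT) augmentationE.
apply: eq_evaluation => t /(chains_card cT) => t1.
have /cardfs1P[v ->] : #|` t| == 1%N by apply/eqP; lia.
rewrite /coboundary asboolT // big_seq_fset1 /simplex_chain fsetDv eqxx mulr1 /incidence.
rewrite (_ : [fset w in [fset v]%fset | (w < v)%O]%fset = fset0) ?cardfs0 //.
by apply/fsetP => w; rewrite !inE /=; case: (w =P v) => // ->; rewrite ltxx.
Qed.

Lemma chains_neg1 S i c : simplicial_complex S -> i < 0 -> c \in chains S i -> c = 0.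
Proof.
move=> Ssim i1 cS; apply: funext => s; apply/eqP/negPn/negP => cs.
have := simplex_neq0 Ssim (chains_mem cS cs); rewrite -cardfs_gt0.
by have := chains_card cS cs; lia.
Qed.

Lemma boundary0 S : boundary S 0 = 0 :> cochain V.
Proof. exact: (morphB0 (@boundaryB_chains _ _ S setT 0)). Qed.

Lemma augmentation_boundary S c : simplicial_complex S -> c \in chains S 1 ->
  augmentation (boundary S c) = 0.
Proof.
move=> Ssim cS; have cT := chainsT cS; rewrite (boundary_pos Ssim _ cS) //.
have := boundary_augmentation (boundary_finsupp setT cT).
rewrite (boundaryTT cT) => /(congr1 (fun c : cochain V => c fset0)).
by rewrite mulrz_at /simplex_chain eqxx mul1r.
Qed.

End Augmentation.

(** * Carriers made of balls, for maps that respect a pair *)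

Section BallCarrier.
Variables (d d' : Order.disp_t) (V : orderType d) (W : orderType d').
Variables (S S1 : set {fset V}) (T0 T1 : set {fset W}) (m : nat) (b : V -> W) (a : nat).

(* Simplices of [S1] have to go to [T1], the others to [T0]. *)
Definition target (s : {fset V}) : set {fset W} := if `[< S1 s >] then T1 else T0.

Definition carried (g : cochain V -> cochain W) (r : nat) := forall s v t, S s -> v \in s ->
  g (simplex_chain s) t != 0 -> ball (target s) (b v) r t.

Hypotheses (Ssim : simplicial_complex S) (S1sim : simplicial_complex S1).
Hypotheses (T0sim : simplicial_complex T0) (T1sim : simplicial_complex T1) (T10 : T1 `<=` T0).
Hypothesis Sm : forall s, S s -> (#|` s| <= m)%N.
Hypotheses (T0acyc : comb_acyclic T0) (T1acyc : comb_acyclic T1).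
Hypotheses (bT0 : forall v, S [fset v]%fset -> T0 [fset b v]%fset)
  (bT1 : forall v, S1 [fset v]%fset -> T1 [fset b v]%fset).
Hypothesis b_near : forall s u v, S s -> u \in s -> v \in s -> near (target s) a (b u) (b v).

Lemma target_simplicial s : simplicial_complex (target s).
Proof. by rewrite /target; case: asboolP. Qed.

Lemma target_vertex s v : S s -> v \in s -> target s [fset b v]%fset.
Proof.
move=> Ss vs; rewrite /target; case: asboolP => S1s.
  by apply: bT1; exact: simplex_vertex S1s vs.
by apply: bT0; exact: simplex_vertex Ss vs.
Qed.

Lemma target_sub s : target s `<=` T0.
Proof. by rewrite /target; case: asboolP => _ // t; exact: T10. Qed.

Lemma target_face s t : (t `<=` s)%fset -> t != fset0 -> target t `<=` target s.
Proof.
move=> ts t0; rewrite /target; case: (asboolP (S1 s)) => S1s.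
  by rewrite asboolT //; exact: simplex_face ts t0.
by case: asboolP => _ // u; exact: T10.
Qed.

Lemma comb_acyclic_choice (T : set {fset W}) : comb_acyclic T -> exists F : int -> nat -> nat,
  forall j r w, T [fset w]%fset ->
  forall y, y \in chains (augmented (ball T w r)) j -> boundary setT y = 0 ->
  exists2 x, x \in chains (augmented (ball T w (F j r))) (j + 1) & boundary setT x = y.
Proof.
move=> Tacyc; have [F HF] := choice (fun jr : int * nat => Tacyc jr.1 jr.2).
by exists (fun j r => F (j, r)) => j r; exact: (HF (j, r)).
Qed.

Section Extension.
Variables (e eps : int) (Phi : cochain V -> cochain W) (h0 : cochain W).
Hypothesis PhiB : forall i, {in chains (augmented S) i &, {morph Phi : a b / a - b}}.
Hypothesis PhiT : forall s, S s -> Phi (simplex_chain s) \in chains setT (#|` s|%:Z - 2 + e).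
Hypothesis Phia : carried Phi a.
Hypothesis PhiC : forall s, S s ->
  boundary setT (Phi (simplex_chain s)) + Phi (boundary setT (simplex_chain s)) *~ eps = 0.
Hypothesis h0T : h0 \in chains [set fset0] (e - 1).
Hypothesis h0P : boundary setT h0 = Phi (simplex_chain fset0).

(** The carrier of [s] is the intersection of the balls around [b v] for all vertices [v] of [s], so
    it does not matter which vertex serves as centre. The radii grow with the number of vertices,
    and the bound [m] on that number gives one radius for all simplices. *)
Lemma ball_carrier_extension : exists rho (g : cochain V -> cochain W),
  [/\ forall i, {in chains setT i &, {morph g : a b / a - b}},
      forall s v, S s -> v \in s -> g (simplex_chain s) \in
        chains (augmented (ball (target s) (b v) rho)) (#|` s|%:Z - 1 + e),
      forall i c, c \in chains (augmented S) i ->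
        boundary setT (g c) = Phi c + g (boundary setT c) *~ eps &
      g (simplex_chain fset0) = h0].
Proof.
have [F0 HF0] := comb_acyclic_choice T0acyc; have [F1 HF1] := comb_acyclic_choice T1acyc.
pose F j r := maxn (F0 j r) (F1 j r).
have HF s v j r : S s -> v \in s -> forall y,
    y \in chains (augmented (ball (target s) (b v) r)) j -> boundary setT y = 0 ->
    exists2 x, x \in chains (augmented (ball (target s) (b v) (F j r))) (j + 1) & boundary setT x = y.
  move=> Ss vs y yb y0; have bv := target_vertex Ss vs.
  have [x xb xy] : exists2 x, x \in chains (augmented (ball (target s) (b v)
      (if `[< S1 s >] then F1 j r else F0 j r))) (j + 1) & boundary setT x = y.
    by move: bv y yb y0; rewrite /target; case: asboolP => _ bv y yb y0; [exact: HF1 yb y0 | exact: HF0 yb y0].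
  exists x => //; apply: chains_sub xb; apply: augmented_sub.
  apply: (ball_leq (target_simplicial s) bv).
  by case: ifP => _; rewrite /F ?leq_maxr ?leq_maxl.
(* The values on facets lie within [rho n'] of their own vertices, hence within [rho n' + a] of each
   vertex of the simplex. [F] is the radius of a filling, the next [a] recentres it at the other
   vertices, and the summand [rho n'] makes the sequence increasing. *)
pose rho := fix rho n := if n is n'.+1 then
  (F (n'.+1%:Z - 2 + e)%R (rho n' + a) + a + rho n')%N else 0%N.
have rhoS n : (rho n <= rho n.+1)%N by rewrite /= leq_addl.
have rho_leq : {homo rho : n n' / (n <= n')%N}.
  by apply: homo_leq => //; exact: leq_trans.
pose D s := augmented [set t | forall v, v \in s -> ball (target s) (b v) (rho #|` s|.-1 + a) t].
(* At the empty simplex the condition on vertices would be void; with [s != fset0] only the empty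
   simplex is left in [T fset0]. *)
pose T s := augmented [set t | s != fset0 /\ forall v, v \in s -> ball (target s) (b v) (rho #|` s|) t].
have [g [gB gT gC g0]] : exists g : cochain V -> cochain W,
  [/\ forall i, {in chains setT i &, {morph g : a b / a - b}},
      forall s, augmented S s -> g (simplex_chain s) \in chains (T s) (#|` s|%:Z - 1 + e),
      forall i c, c \in chains (augmented S) i ->
        boundary setT (g c) = Phi c + g (boundary setT c) *~ eps &
      g (simplex_chain fset0) = h0].
  apply: (@carrier_extension _ _ V W S T D e eps Phi h0) => // [s Ss||s v Ss vs t|s y Ss yD y0].
  - apply: (chains_in (PhiT Ss)) => t _ Pt; left => v vs.
    have bv := target_vertex Ss vs.
    exact: (ball_leq (target_simplicial s) bv (leq_addl _ _) (Phia Ss vs Pt)).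
  - by apply: chains_sub h0T => t ->; right.
  - move=> [[sv0 st]|->]; last by right.
    left => w ws; have /fset0Pn[u us] := sv0.
    have us' : u \in s by move: us; rewrite !inE => /andP[].
    have ts := target_face (fsubD1set s v) sv0.
    have -> : #|` s|.-1 = #|` s `\ v|%fset by rewrite (cardfsD1 v s) vs.
    apply: (ball_trans (b_near Ss ws us')).
    exact: ball_mono ts _ (st u us).
  - have [v vs] := simplex_pick Ssim Ss.
    have sn : #|` s| = #|` s|.-1.+1.
      by rewrite prednK // cardfs_gt0; exact: (simplex_neq0 Ssim).
    have yb : y \in chains (augmented (ball (target s) (b v) (rho #|` s|.-1 + a))) (#|` s|%:Z - 2 + e).
      by apply: chains_sub yD; apply: augmented_sub => t; apply.
    have [x xb xy] := HF s v _ _ Ss vs y yb y0; exists x => //.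
    have -> : #|` s|%:Z - 1 + e = #|` s|%:Z - 2 + e + 1 by lia.
    apply: chains_sub xb; apply: augmented_sub => t xt; split.
      exact: (simplex_neq0 Ssim).
    move=> w ws; have := ball_trans (b_near Ss ws vs) xt.
    apply: (ball_leq (target_simplicial s) (target_vertex Ss ws)).
    by rewrite [in rho #|` s|]sn /= -sn leq_addr.
exists (rho m), g; split=> // s v Ss vs; apply: chains_sub (gT s (or_introl Ss)).
apply: augmented_sub => t [_ /(_ v vs)].
apply: (ball_leq (target_simplicial s) (target_vertex Ss vs)).
by apply: rho_leq; exact: Sm.
Qed.

End Extension.

Lemma homo_on_simplices (g : cochain V -> cochain W) (K : set {fset V}) (L : set {fset W}) i j :
  {in chains setT i &, {morph g : a b / a - b}} ->
  (forall s, K s -> #|` s|%:Z = i + 1 -> g (simplex_chain s) \in chains L j) ->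
  {homo g : c / c \in chains K i >-> c \in chains L j}.
Proof.
move=> gB gs; apply: chain_ind => [|x y xK yK gx gy|//]; first by rewrite (morphB0 gB) rpred0.
by rewrite gB ?rpredB //; [exact: chainsT xK | exact: chainsT yK].
Qed.

(** The carrier extension that sends the empty simplex to the empty simplex. Dropping the empty
    simplex afterwards, in degree 0, turns compatibility with the full boundary into preservation of
    augmentations. *)
Lemma chain_map_extension : exists rho (g : cochain V -> cochain W),
  [/\ graded_hom S T0 id g,
      forall i, {in chains S i, forall c, boundary T0 (g c) = g (boundary S c)},
      {in chains S 0, forall c, augmentation (g c) = augmentation c} & carried g rho].
Proof.
have [||||||rho [g [gB gT gC g0]]] :=
  @ball_carrier_extension 0 1 (fun=> 0) (simplex_chain fset0).
- by move=> i x y _ _; rewrite subr0.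
- by move=> s _; rewrite rpred0.
- by move=> s v t _ _ /eqP.
- by move=> s _; rewrite mul0rz addr0 boundary0.
- by apply: simplex_chains; rewrite ?cardfs0.
- apply: funext => t.
  by rewrite boundary_simplexT /simplex_boundary big_seq_fset0.
have gS s v : S s -> v \in s -> g (simplex_chain s) \in chains (ball (target s) (b v) rho) (#|` s|%:Z - 1).
  move=> Ss vs; have := gT s v Ss vs; rewrite addr0; apply: chains_unaugmented.
  by have := simplex_neq0 Ssim Ss; rewrite -cardfs_gt0; lia.
have ghom i : {homo g : c / c \in chains S i >-> c \in chains T0 i}.
  apply: homo_on_simplices => // s Ss sE; have [v vs] := simplex_pick Ssim Ss.
  have := gS s v Ss vs; rewrite sE addrK; apply: chains_sub.
  have [_ bS] := subcomplex_ball (target_simplicial s) rho (target_vertex Ss vs).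
  by move=> t /bS /target_sub.
exists rho, g; split=> [i|i c cS|c cS|s v t Ss vs].
- by split; [exact: ghom | move=> x y xS yS; exact: (gB i x y (chainsT xS) (chainsT yS))].
- have [i0|i0] := eqVneq i 0.
    move: cS; rewrite i0 => cS; rewrite (boundary_zero Ssim cS) (morphB0 (gB 0)).
    by rewrite (boundary_zero T0sim (ghom _ _ cS)).
  rewrite (boundary_pos Ssim i0 cS) (boundary_pos T0sim i0 (ghom _ _ cS)).
  by rewrite (gC _ _ (chains_augmented cS)) add0r.
- have cT := chainsT cS; have gcT := chainsT (ghom _ _ cS).
  have := gC _ _ (chains_augmented cS); rewrite add0r mulr1z.
  rewrite (boundary_augmentation cT) (boundary_augmentation gcT).
  rewrite (morphMz _ (gB (-1))) ?g0; last by apply: simplex_chains; rewrite ?cardfs0.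
  move=> /(congr1 (fun c : cochain W => c fset0)).
  by rewrite !mulrz_at /simplex_chain eqxx !mul1r.
- exact: chains_mem (gS s v Ss vs).
Qed.

Lemma homotopy_extension (phi psi : cochain V -> cochain W) :
  graded_hom S T0 id phi -> graded_hom S T0 id psi ->
  (forall i, {in chains S i, forall c, boundary T0 (phi c) = phi (boundary S c)}) ->
  (forall i, {in chains S i, forall c, boundary T0 (psi c) = psi (boundary S c)}) ->
  (forall v, S [fset v]%fset -> augmentation (phi (simplex_chain [fset v]%fset)) =
     augmentation (psi (simplex_chain [fset v]%fset))) ->
  carried phi a -> carried psi a ->
  exists rho (H : cochain V -> cochain W),
  [/\ graded_hom S T0 (fun i => i + 1) H, carried H rho &
      forall i, {in chains S i, forall c,
        phi c - psi c = boundary T0 (H c) + H (boundary S c)}].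
Proof.
move=> phiG psiG phiC psiC aug phia psia.
(* [phi] and [psi] are known on chains of [S] only. Their difference is extended by 0 to the empty
   simplex, which is compatible with the boundary because the augmentations agree. *)
pose g0 (s : {fset V}) : cochain W := if s == fset0 then 0 else phi (simplex_chain s) - psi (simplex_chain s).
pose Phi := linear_ext g0.
have PhiE i c : c \in chains S i -> Phi c = phi c - psi c.
  move: c; apply: chain_ext => [x y xS yS|x y xS yS|s Ss _].
  - by rewrite /Phi (linear_extB g0 xS yS).
  - by rewrite (proj2 (phiG i)) // (proj2 (psiG i)) // opprD addrACA -opprD.
  - by rewrite /Phi linear_ext_simplex /g0 (negbTE (simplex_neq0 Ssim Ss)).
have PhiS i c : c \in chains S i -> Phi c \in chains T0 i.
  by move=> cS; rewrite (PhiE _ _ cS) rpredB ?(proj1 (phiG i)) ?(proj1 (psiG i)).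
have sS s : S s -> simplex_chain s \in chains S (#|` s|%:Z - 1).
  by move=> Ss; apply: simplex_chains; rewrite ?subrK.
have [||||||rho [H [HB HT HC H0]]] := @ball_carrier_extension 1 (-1) Phi 0.
- by move=> i x y xS yS; rewrite /Phi (linear_extB g0 xS yS).
- move=> s Ss; have := PhiS _ _ (sS s Ss).
  by rewrite (_ : _ - 2 + 1 = #|` s|%:Z - 1); [exact: chainsT | lia].
- move=> s v t Ss vs; rewrite (PhiE _ _ (sS s Ss)).
  have [p0|p0 _] := eqVneq (phi (simplex_chain s) t) 0; last exact: phia vs p0.
  have [q0|q0 _] := eqVneq (psi (simplex_chain s) t) 0; last exact: psia vs q0.
  by rewrite [(_ - _) t](_ : _ = phi (simplex_chain s) t - psi (simplex_chain s) t) // p0 q0 subrr eqxx.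
- move=> s Ss; rewrite mulrNz mulr1z; apply/eqP; rewrite subr_eq0; apply/eqP.
  have s1 := sS s Ss; have P1 := PhiS _ _ s1.
  have [sz|sz] := eqVneq (#|` s|%:Z - 1) 0; last first.
    rewrite -(boundary_pos Ssim sz s1) -(boundary_pos T0sim sz P1).
    rewrite (PhiE _ _ (boundary_chains s1)) (PhiE _ _ s1) -(phiC _ _ s1) -(psiC _ _ s1).
    by rewrite (boundaryB_chains T0 (proj1 (phiG _) _ s1) (proj1 (psiG _) _ s1)).
  have /cardfs1P[v sv] : #|` s| == 1%N by apply/eqP; lia.
  have -> : Phi (boundary setT (simplex_chain s)) = 0.
    rewrite /Phi linear_ext_boundary sv big_seq_fset1 fsetDv /g0 eqxx mul0rz //.
  rewrite sz in P1; rewrite (boundary_augmentation (chainsT P1)).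
  rewrite augmentationE (PhiE _ _ s1) (evaluationB_chains _ (proj1 (phiG _) _ s1) (proj1 (psiG _) _ s1)).
  by rewrite -!augmentationE sv aug ?subrr ?mulr0z //; rewrite -sv.
- exact: rpred0.
- by rewrite boundary0 /Phi linear_ext_simplex /g0 eqxx.
have HS s v : S s -> v \in s -> H (simplex_chain s) \in chains (ball (target s) (b v) rho) #|` s|.
  move=> Ss vs; have := HT s v Ss vs; rewrite subrK; apply: chains_unaugmented.
  by lia.
have Hhom i : {homo H : c / c \in chains S i >-> c \in chains T0 (i + 1)}.
  apply: homo_on_simplices => // s Ss sE; have [v vs] := simplex_pick Ssim Ss.
  have := HS s v Ss vs; rewrite sE; apply: chains_sub.
  have [_ bS] := subcomplex_ball (target_simplicial s) rho (target_vertex Ss vs).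
  by move=> t /bS /target_sub.
exists rho, H; split=> [i|s v t Ss vs|i c cS].
- by split; [exact: Hhom | move=> x y xS yS; exact: (HB i x y (chainsT xS) (chainsT yS))].
- exact: chains_mem (HS s v Ss vs).
have [i0|i0] := ltP i 0.
  rewrite (chains_neg1 Ssim i0 cS) (morphB0 (proj2 (phiG 0))) (morphB0 (proj2 (psiG 0))).
  by rewrite !boundary0 !(morphB0 (HB 0)) !boundary0 !addr0.
have i1 : i + 1 != 0 by lia.
rewrite (boundary_pos T0sim i1 (Hhom _ _ cS)) (HC _ _ (chains_augmented cS)) (PhiE _ _ cS).
rewrite mulrNz mulr1z; have [iz|iz] := eqVneq i 0; last first.
  by rewrite (boundary_pos Ssim iz cS) subrK.
move: cS; rewrite iz => cS; rewrite (boundary_zero Ssim cS) (morphB0 (HB 0)) addr0.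
rewrite (boundary_augmentation (chainsT cS)) (morphMz _ (HB (-1))) ?H0 ?mul0rz ?subr0 //.
by apply: simplex_chains; rewrite ?cardfs0.
Qed.

End BallCarrier.

(** * Dual maps on cochains *)

Lemma graded_comp (d1 d2 d3 : Order.disp_t) (V1 : orderType d1) (V2 : orderType d2)
    (V3 : orderType d3) (S1 : set {fset V1}) (S2 : set {fset V2}) (S3 : set {fset V3})
    (e e' : int -> int) (g : cochain V1 -> cochain V2) (h : cochain V2 -> cochain V3) :
  graded_hom S1 S2 e g -> graded_hom S2 S3 e' h -> graded_hom S1 S3 (e' \o e) (h \o g).
Proof.
move=> gG hG i; split=> [c cS|a b aS bS] /=; first by apply: (proj1 (hG _)); exact: (proj1 (gG _)).
by rewrite (proj2 (gG i)) // (proj2 (hG (e i))) //; exact: (proj1 (gG i)).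
Qed.

Section Dual.
Variables (d d' : Order.disp_t) (V : orderType d) (W : orderType d').
Variables (S : set {fset V}) (T : set {fset W}).
Hypotheses (Ssim : simplicial_complex S) (Tsim : simplicial_complex T).
Implicit Types (g h : cochain V -> cochain W) (phi : cochain W) (e : int -> int).

Lemma chain_support (U : set {fset V}) i g c t : {in chains U i &, {morph g : a b / a - b}} ->
  c \in chains U i -> g c t != 0 ->
  exists s, [/\ U s, #|` s|%:Z = i + 1, c s != 0 & g (simplex_chain s) t != 0].
Proof.
move=> gB cU gc; apply/not_existsP => nex; move/eqP: gc; apply.
pose U' := U `&` [set s | c s != 0].
have UU : {subset chains U' i <= chains U i} by apply: chains_sub => s [].
have cU' : c \in chains U' i by apply: (chains_in cU).
suff H x : x \in chains U' i -> g x t = 0 by exact: H.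
move: x; apply: chain_ind => [|a b aU bU ga gb|s [Us cs] sE].
- by rewrite (morphB0 gB).
- by rewrite gB ?UU // [LHS](_ : _ = g a t - g b t) // ga gb subrr.
- by apply/eqP/negPn/negP => gs; apply: (nex s).
Qed.

Lemma simplex_in (U : set {fset V}) s : U s -> simplex_chain s \in chains U (#|` s|%:Z - 1).
Proof. by move=> Us; apply: simplex_chains; rewrite ?subrK. Qed.

Lemma dual_mapE g phi s : S s -> dual_map S g phi s = evaluation phi (g (simplex_chain s)).
Proof. by move=> Ss; rewrite /dual_map asboolT. Qed.

Lemma dual_map_out g phi s : ~ S s -> dual_map S g phi s = 0.
Proof. by move=> nS; rewrite /dual_map asboolF. Qed.

Lemma dual_map_eval e g i phi c : graded_hom S T e g -> c \in chains S i ->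
  evaluation phi (g c) = evaluation (dual_map S g phi) c.
Proof.
move=> /(_ i)[gh gB]; move: c; apply: chain_ext => [a b aS bS|a b aS bS|s Ss sE].
- by rewrite gB // (evaluationB_chains _ (gh _ aS) (gh _ bS)).
- by rewrite (evaluationB_chains _ aS bS).
- by rewrite evaluation_simplex dual_mapE.
Qed.

Lemma dual_map_neq0 g phi s : dual_map S g phi s != 0 ->
  S s /\ exists t, phi t != 0 /\ g (simplex_chain s) t != 0.
Proof.
rewrite /dual_map; case: asboolP => [Ss|]; last by rewrite eqxx.
by move=> /evaluation_neq0 ?; split.
Qed.

(** The transpose of a chain map preserves finite supports only if each [t] is met by the images of
    finitely many simplices. Properness enters the duality here. *)
Lemma dual_map_chains e g k k' phi : graded_hom S T e g -> (forall i, e i = k -> i = k') ->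
  (forall t, T t -> finite_set [set s | S s /\ g (simplex_chain s) t != 0]) ->
  phi \in chains T k -> dual_map S g phi \in chains S k'.
Proof.
move=> gG ek gfin phiT; apply/chainsP; split=> [|s /dual_map_neq0[Ss [t [pt gt]]]].
  apply: (@sub_finite_set _ _ (\bigcup_(t in [set t | phi t != 0])
     [set s | S s /\ g (simplex_chain s) t != 0])).
    by move=> s /dual_map_neq0[Ss [t [pt gt]]]; exists t.
  apply: bigcup_finite; first exact: chains_finsupp phiT.
  by move=> t /(chains_mem phiT); exact: gfin.
split=> //; suff <- : #|` s|%:Z - 1 = k' by rewrite subrK.
apply: ek; have := chains_card ((proj1 (gG _)) _ (simplex_in Ss)) gt.
by rewrite (chains_card phiT pt) => /addIr.
Qed.

Lemma dual_mapB g phi psi e : graded_hom S T e g ->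
  dual_map S g (phi - psi) = dual_map S g phi - dual_map S g psi.
Proof.
move=> gG; apply: funext => s.
rewrite [RHS](_ : _ = dual_map S g phi s - dual_map S g psi s) //.
have [Ss|nS] := pselect (S s); last by rewrite !dual_map_out ?subrr.
by rewrite !dual_mapE // evaluationBl //; exact: chains_finsupp (proj1 (gG _) _ (simplex_in Ss)).
Qed.

End Dual.

Lemma coboundary_neq0 (d : Order.disp_t) (V : orderType d) (S : set {fset V}) phi s :
  coboundary S phi s != 0 -> S s /\ exists v, v \in s /\ phi (s `\ v)%fset != 0.
Proof.
rewrite /coboundary; case: asboolP => [Ss|]; last by rewrite eqxx.
move=> c0; split=> //; apply/not_existsP => nex; move/eqP: c0; apply.
rewrite big_seq big1 // => v vs; have [->|pv] := eqVneq (phi (s `\ v)%fset) 0.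
  by rewrite mulr0.
by case: (nex v).
Qed.

Section DualHomotopy.
Variables (d : Order.disp_t) (V : orderType d).
Variables (S : set {fset V}).
Hypotheses (Ssim : simplicial_complex S).

Lemma coboundary_chains k phi : locally_finite S -> phi \in chains S k ->
  coboundary S phi \in chains S (k + 1).
Proof.
move=> lf phiS; apply/chainsP; split=> [|s /coboundary_neq0[Ss [v [vs pv]]]].
  apply: (@sub_finite_set _ _ (\bigcup_(t in [set t | phi t != 0])
     \bigcup_(v in [set` t]) [set s | S s /\ v \in s])).
    move=> s /coboundary_neq0[Ss [v [vs pv]]]; exists (s `\ v)%fset => //.
    have [w ws] := simplex_pick Ssim (chains_mem phiS pv).
    by exists w => //; split=> //; move: ws; rewrite !inE => /andP[].
  apply: bigcup_finite => [|t _]; first exact: chains_finsupp phiS.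
  by apply: bigcup_finite => [|v _]; [exact: finite_fset | exact: lf].
split=> //; rewrite (cardfsD1 v s) vs PoszD; have := chains_card phiS pv; lia.
Qed.

Lemma coboundary_coboundary phi : phi fset0 = 0 -> coboundary S (coboundary S phi) = 0.
Proof.
move=> phi0; apply: funext => s; rewrite [RHS](_ : _ = 0) //.
rewrite coboundaryE /restriction; case: asboolP => // Ss.
rewrite -[RHS]/((0 : cochain V) s) -(coboundaryTT phi) /coboundary asboolT //.
apply: eq_big_seq => v vs; congr (_ * _).
have [sv|sv] := eqVneq (s `\ v)%fset fset0.
  by rewrite sv big_seq_fset0; case: asboolP.
by rewrite !asboolT //; exact: simplex_face Ss (fsubD1set _ _) sv.
Qed.

(** In degree 0 [coboundary S] reads [phi] at the empty simplex while [boundary S] drops it; hence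
    the condition on [phi], which all cochains of a complex satisfy. *)
Lemma evaluation_coboundary phi i c : phi fset0 = 0 -> c \in chains S i ->
  evaluation (coboundary S phi) c = evaluation phi (boundary S c).
Proof.
move=> phi0 cS; have cT := chainsT cS.
rewrite (@eq_evaluation _ _ _ (coboundary setT phi)); last first.
  by move=> s /(chains_mem cS) Ss; rewrite coboundaryE /restriction asboolT.
rewrite -(evaluation_boundaryT _ cT) [in RHS]boundaryE -evaluation_restriction.
apply: eq_evaluation => s /(chains_mem (chains_boundary Ssim (chains_augmented cS))).
by rewrite /restriction => -[Ss|->]; [rewrite asboolT | case: asboolP].
Qed.

Lemma chains0 k phi : phi \in chains S k -> phi fset0 = 0.
Proof. by move=> phiS; apply: chains_out phiS _; case: Ssim. Qed.

End DualHomotopy.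

Section DualMaps.
Variables (d d' : Order.disp_t) (V : orderType d) (W : orderType d').
Variables (S : set {fset V}) (T : set {fset W}).
Hypotheses (Ssim : simplicial_complex S) (Tsim : simplicial_complex T).

Lemma dual_map0 g (phi : cochain W) : dual_map S g phi fset0 = 0.
Proof. by apply: dual_map_out; case: Ssim. Qed.

Lemma dual_chain_map g (phi : cochain W) : graded_hom S T id g ->
  (forall i, {in chains S i, forall c, boundary T (g c) = g (boundary S c)}) ->
  phi fset0 = 0 ->
  dual_map S g (coboundary T phi) = coboundary S (dual_map S g phi).
Proof.
move=> gG gC phi0; apply: funext => s.
have [Ss|nS] := pselect (S s); last first.
  by rewrite dual_map_out // /coboundary asboolF.
have s1 := simplex_in Ss; have gs := proj1 (gG _) _ s1.
rewrite dual_mapE // (evaluation_coboundary Tsim phi0 gs) (gC _ _ s1).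
rewrite (dual_map_eval _ gG (boundary_chains s1)) -(evaluation_coboundary Ssim _ s1).
  by rewrite evaluation_simplex.
exact: dual_map0.
Qed.

Lemma dual_homotopy f g h (phi : cochain W) :
  graded_hom S T id f -> graded_hom S T id g -> graded_hom S T (fun i => i + 1) h ->
  (forall i, {in chains S i, forall c, f c - g c = boundary T (h c) + h (boundary S c)}) ->
  phi fset0 = 0 ->
  dual_map S f phi - dual_map S g phi =
    coboundary S (dual_map S h phi) + dual_map S h (coboundary T phi).
Proof.
move=> fG gG hG fgh phi0; apply: funext => s.
rewrite [LHS](_ : _ = dual_map S f phi s - dual_map S g phi s) //.
rewrite [RHS](_ : _ = coboundary S (dual_map S h phi) s + dual_map S h (coboundary T phi) s) //.
have [Ss|nS] := pselect (S s); last by rewrite !dual_map_out // /coboundary asboolF ?subrr.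
have s1 := simplex_in Ss; have hs := proj1 (hG _) _ s1.
rewrite !dual_mapE // -(evaluationB_chains _ (proj1 (fG _) _ s1) (proj1 (gG _) _ s1)).
rewrite (fgh _ _ s1) evaluationDr; last 2 first.
- exact: chains_finsupp (boundary_chains hs).
- exact: chains_finsupp (proj1 (hG _) _ (boundary_chains s1)).
rewrite addrC -(evaluation_coboundary Tsim phi0 hs); congr (_ + _).
rewrite (dual_map_eval _ hG (boundary_chains s1)) -(evaluation_coboundary Ssim _ s1).
  by rewrite evaluation_simplex.
exact: dual_map0.
Qed.

End DualMaps.

(** * Homotopies of bounded displacement *)

Section Spread.
Variables (d : Order.disp_t) (W : orderType d) (X : set {fset W}).
Hypothesis Xsim : simplicial_complex X.
Implicit Types (g h : cochain W -> cochain W) (s t : {fset W}) (v w : W) (e : int -> int).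

(** Displacement measured between any vertex of [s] and any vertex of its image. It adds up under
    composition, passes to transposes because [near] is symmetric, and, unlike [controlled], says
    where the image lies. *)
Definition spread g (D : nat) := forall s v t w, X s -> v \in s ->
  g (simplex_chain s) t != 0 -> w \in t -> near X D v w.

Lemma graded_mem e g s t : graded_hom X X e g -> X s -> g (simplex_chain s) t != 0 -> X t.
Proof. by move=> gG Xs; apply: chains_mem (proj1 (gG _) _ (simplex_in Xs)). Qed.

Lemma spread_comp e e' g h D D' : graded_hom X X e g -> graded_hom X X e' h ->
  spread g D -> spread h D' -> spread (h \o g) (D' + D).
Proof.
move=> gG hG gD hD s v t w Xs vs ht wt.
have [s' [Xs' _ gs' hs']] := chain_support (proj2 (hG _)) (proj1 (gG _) _ (simplex_in Xs)) ht.
have [v' vs'] := simplex_pick Xsim Xs'.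
exact: near_trans (gD _ _ _ _ Xs vs gs' vs') (hD _ _ _ _ Xs' vs' hs' wt).
Qed.

Lemma displacement_near (r : nat) s t v w : X s -> v \in s -> star_nbhd X r (faces s) t -> w \in t ->
  near X r.+1 v w.
Proof.
move=> Xs vs st wt; have [u us uw] := star_nbhd_faces Xsim Xs st wt.
by rewrite -addn1; apply: near_trans uw; exact: near_edge Xs vs us.
Qed.

Lemma spread_finite g D : locally_finite X -> spread g D ->
  (forall s t, X s -> g (simplex_chain s) t != 0 -> X t) ->
  forall t, X t -> finite_set [set s | X s /\ g (simplex_chain s) t != 0].
Proof.
move=> lf gD gX t Xt; have [w wt] := simplex_pick Xsim Xt.
apply: (@sub_finite_set _ _ (ball X w D.+1)).
  move=> s [Xs gt]; have [v vs] := simplex_pick Xsim Xs.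
  by apply: (near_ball Xs vs); apply: near_sym => //; exact: gD gt wt.
exact: ball_finite Xsim _ _ lf (simplex_vertex Xsim Xt wt).
Qed.

Lemma spread_carried g D : (forall s t, X s -> g (simplex_chain s) t != 0 -> X t) ->
  spread g D -> carried X set0 X set0 id g D.+1.
Proof.
move=> gX gD s v t Xs vs gt; have Xt := gX s t Xs gt; have [w wt] := simplex_pick Xsim Xt.
rewrite /target; case: asboolP => // _.
by apply: (near_ball Xt wt); exact: gD gt wt.
Qed.

(** The absolute case of [homotopy_extension]: with [S1] and [T1] empty, every simplex has target
    [X]. *)
Lemma spread_homotopy m phi psi D : comb_acyclic X -> (forall s, X s -> (#|` s| <= m)%N) ->
  graded_hom X X id phi -> graded_hom X X id psi ->
  (forall i, {in chains X i, forall c, boundary X (phi c) = phi (boundary X c)}) ->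
  (forall i, {in chains X i, forall c, boundary X (psi c) = psi (boundary X c)}) ->
  (forall v, X [fset v]%fset -> augmentation (phi (simplex_chain [fset v]%fset)) =
     augmentation (psi (simplex_chain [fset v]%fset))) ->
  spread phi D -> spread psi D ->
  exists rho h, [/\ graded_hom X X (fun i => i + 1) h, spread h rho &
      forall i, {in chains X i, forall c,
        phi c - psi c = boundary X (h c) + h (boundary X c)}].
Proof.
move=> Xacyc Xm phiG psiG phiC psiC aug phiD psiD.
have s0 : simplicial_complex (set0 : set {fset W}) by split.
have acyc0 : comb_acyclic (set0 : set {fset W}) by move=> j r; exists 0.
have phia := spread_carried (fun s t => @graded_mem id phi s t phiG) phiD.
have psia := spread_carried (fun s t => @graded_mem id psi s t psiG) psiD.
have tX s : target set0 X set0 s = X by rewrite /target; case: asboolP.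
have bn s u v : X s -> u \in s -> v \in s -> near (target set0 X set0 s) D.+1 (id u) (id v).
  rewrite tX => Xs us vs; exact: (near_leq (ltn0Sn D) (simplex_vertex Xsim Xs vs) (near_edge Xsim Xs us vs)).
have [rho [h [hG hc hP]]] := @homotopy_extension _ _ _ _ X set0 X set0 m id D.+1 Xsim s0
  Xsim s0 (@sub0set _ _) Xm Xacyc acyc0 (fun v => id) (fun v => id) bn phi psi
  phiG psiG phiC psiC aug phia psia.
exists rho, h; split=> // s v t w Xs vs ht wt.
have := hc s v t Xs vs ht; rewrite tX => bt.
exact: (ball_near Xsim (simplex_vertex Xsim Xs vs) bt wt).
Qed.

End Spread.

(** * Poincare duality with homotopies of bounded displacement *)

Section PoincareDuality.
Variables (R : realType) (d : Order.disp_t) (W : orderType d) (X : set {fset W}).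
Variables (n E0 : nat) (pbar p : cochain W -> cochain W).
Hypothesis PD : coarse_PD R X n pbar p E0.

Let Xsim : simplicial_complex X. Proof. by case: (PD_metric PD). Qed.
Let Xconn : connected_complex X. Proof. by case: (PD_metric PD). Qed.
Let Xlf : locally_finite X. Proof. by case: (PD_metric PD). Qed.
Let pbarG := PD_pbar PD.
Let pG := PD_p PD.

Lemma PD_comb_acyclic : comb_acyclic X.
Proof. exact: (proj1 (comb_acyclicP (PD_metric PD) (PD_acyclic PD))). Qed.

Lemma PD_dimension : exists m : nat, forall s, X s -> (#|` s| <= m)%N.
Proof. exact: (proj2 (comb_acyclicP (PD_metric PD) (PD_acyclic PD))). Qed.

Lemma pbar_spread : spread X pbar E0.+1.
Proof.
move=> s v t w Xs vs pt wt.
exact: displacement_near Xsim _ _ _ _ _ Xs vs (PD_pbar_displacement PD Xs pt) wt.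
Qed.

Lemma p_displacement s t : X s -> p (simplex_chain s) t != 0 -> star_nbhd X E0 (faces s) t.
Proof.
move=> Xs pt; apply: (PD_p_displacement PD Xs).
have Xt := graded_mem pG Xs pt; split; first exact: simplex_neq0 Xt.
exists (#|` s|%:Z - 1), (simplex_chain s), t; split=> //.
by apply: simplex_in; split=> //; exact: simplex_neq0 Xs.
Qed.

Lemma p_spread : spread X p E0.+1.
Proof.
move=> s v t w Xs vs pt wt.
exact: displacement_near Xsim _ _ _ _ _ Xs vs (p_displacement Xs pt) wt.
Qed.

Let ppbar := p \o pbar.
Let pbarp := pbar \o p.

Let ppbarG : graded_hom X X id ppbar.
Proof. by move=> i; have := graded_comp pbarG pG i; rewrite /= opprB addrC subrK. Qed.

Let pbarpG : graded_hom X X id pbarp.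
Proof. by move=> i; have := graded_comp pG pbarG i; rewrite /= opprB addrC subrK. Qed.

Lemma ppbar_augmentation c : c \in chains X 0 -> augmentation (p (pbar c)) = augmentation c.
Proof.
move=> cX; have [h [hG _ hP]] := PD_chain_homotopy PD.
have hc := proj1 (hG _) _ cX; have pc := proj1 (ppbarG _) _ cX.
apply/eqP; rewrite -subr_eq0 !augmentationE -(evaluationB_chains _ pc cX) [_ - _](hP _ _ cX).
rewrite (boundary_zero Xsim cX) (morphB0 (proj2 (hG 0))) addr0 -augmentationE.
by rewrite (augmentation_boundary Xsim hc).
Qed.

(* The homotopies given in [coarse_PD] have images of bounded diameter, but these may lie
   far away.  They only serve to compute the augmentation of [p \o pbar]; uniform
   acyclicity then provides homotopies of bounded displacement. *)
Lemma PD_chain_homotopy_spread : exists D h, [/\ graded_hom X X (fun i => i + 1) h,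
  spread X h D & forall i, {in chains X i, forall c,
        p (pbar c) - c = boundary X (h c) + h (boundary X c)}].
Proof.
have [m Xm] := PD_dimension.
apply: (spread_homotopy (phi := ppbar) (psi := id) (D := E0.+1 + E0.+1) Xsim PD_comb_acyclic Xm) => //.
- by move=> i; split.
- move=> i c cX; rewrite /ppbar /= -(PD_pbar_chain PD cX) -(PD_p_chain PD (proj1 (pbarG i) _ cX)) //.
- move=> v Xv; apply: ppbar_augmentation; apply: simplex_chains => //; by rewrite cardfs1.
- exact: spread_comp Xsim _ _ _ _ _ _ pbarG pG pbar_spread p_spread.
- move=> s v t w Xs vs; rewrite /simplex_chain; case: (t =P s) => // -> _ ws.
  exact: (near_leq (ltn0Sn _) (simplex_vertex Xsim Xs ws) (near_edge Xsim Xs vs ws)).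
Qed.

(* The matrix of [pbar \o p], transposed, is a chain map of bounded displacement. *)
Let tr s : cochain W := fun t => if `[< X t >] then pbarp (simplex_chain t) s else 0.
Let q := linear_ext tr.

Let pbarp_spread : spread X pbarp (E0.+1 + E0.+1).
Proof. exact: spread_comp Xsim _ _ _ _ _ _ pG pbarG p_spread pbar_spread. Qed.

Let tr_chains s : X s -> tr s \in chains X (#|` s|%:Z - 1).
Proof.
move=> Xs; have trE t : tr s t != 0 -> X t /\ pbarp (simplex_chain t) s != 0.
  by rewrite /tr; case: asboolP => //; rewrite eqxx.
apply/chainsP; split=> [|t /trE[Xt ts]].
  apply: sub_finite_set (spread_finite Xsim Xlf pbarp_spread _ Xs).
    by move=> t /trE.
  by move=> s' t Xs' st; exact: (graded_mem pbarpG Xs' st).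
split=> //; have := chains_card (proj1 (pbarpG _) _ (simplex_in Xt)) ts.
by rewrite !subrK.
Qed.

Let qG : graded_hom X X id q.
Proof.
move=> i; split; last exact: linear_extB.
by apply: linear_ext_chains => s Xs sE; have := tr_chains Xs; rewrite sE addrK.
Qed.

Let q_spread : spread X q (E0.+1 + E0.+1).
Proof.
move=> s v t w Xs vs; rewrite /q linear_ext_simplex /tr; case: asboolP => [Xt ts wt|]; last by rewrite eqxx.
by apply: near_sym => //; exact: pbarp_spread Xt wt ts vs.
Qed.

Let q_eval phi k c i : phi \in chains X k -> c \in chains X i ->
  evaluation phi (q c) = evaluation (pbarp phi) c.
Proof.
move=> phiX cX; rewrite (dual_map_eval phi qG cX); apply: eq_evaluation => s /(chains_mem cX) Xs.
rewrite dual_mapE // /q linear_ext_simplex; have fs := chains_finsupp (tr_chains Xs).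
move: phi phiX; apply: chain_ext => [a b aX bX|a b aX bX|t Xt tE].
- exact: evaluationBl.
- by rewrite (proj2 (pbarpG k)).
- by rewrite evaluation_simplex_l /tr asboolT.
Qed.

(** The transpose of [q] is a cochain map, as [p] and [pbar] are compatible with the differentials;
    the identity is tested against elementary cochains. *)
Let qC i : {in chains X i, forall c, boundary X (q c) = q (boundary X c)}.
Proof.
move=> c cX; apply: funext => t.
have qc := proj1 (qG i) _ cX; have bc := boundary_chains cX.
have [Xt|nX] := pselect (X t); last first.
  by rewrite (chains_out (boundary_chains qc) nX) (chains_out (proj1 (qG (i - 1)) _ bc) nX).
have t1 := simplex_in Xt; have t0 := chains0 Xsim t1.
rewrite -!evaluation_simplex_l -(evaluation_coboundary Xsim t0 qc).
rewrite (q_eval (coboundary_chains Xsim Xlf t1) cX) (q_eval t1 bc).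
rewrite /pbarp /= -(PD_p_chain PD t1) -(PD_pbar_chain PD (proj1 (pG _) _ t1)).
rewrite (evaluation_coboundary Xsim _ cX) //.
exact: (chains0 Xsim (proj1 (pbarpG _) _ t1)).
Qed.

(** The difference of two vertices bounds, since [X] is connected and acyclic, and [q] is a chain
    map; so all vertices have images of the same augmentation. *)
Let q_augmentation : exists a : int, forall v, X [fset v]%fset ->
  augmentation (q (simplex_chain [fset v]%fset)) = a.
Proof.
have [[v0 Xv0] _] := Xconn; exists (augmentation (q (simplex_chain [fset v0]%fset))) => v Xv.
have vX w : X [fset w]%fset -> simplex_chain [fset w]%fset \in chains X 0.
  by move=> Xw; apply: simplex_chains => //; rewrite cardfs1.
have [r v0v] := connected_near Xsim Xconn Xv0 Xv.
have [r' fill] := PD_comb_acyclic 0 r.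
have bX w : near X r v0 w -> simplex_chain [fset w]%fset \in chains (ball X v0 r) 0.
  by move=> vw; apply: simplex_chains => //; rewrite cardfs1.
have v0v0 : near X r v0 v0 := near_leq (leq0n r) Xv0 (near_refl _ _).
pose y := simplex_chain [fset v]%fset - simplex_chain [fset v0]%fset : cochain W.
have yX : y \in chains X 0 by rewrite rpredB ?vX.
have [] := fill _ Xv0 y.
- by apply: chains_augmented; rewrite rpredB ?bX.
- rewrite (boundary_augmentation (chainsT yX)) augmentationE (evaluationB_chains _ (vX _ Xv) (vX _ Xv0)).
  by rewrite !evaluation_simplex subrr mulr0z.
move=> x xb xy; have xX : x \in chains X 1.
  apply: chains_sub (chains_unaugmented _ xb) => //.
  by have [_] := subcomplex_ball Xsim r' Xv0.
apply/eqP; rewrite -subr_eq0 !augmentationE.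
rewrite -(evaluationB_chains _ (proj1 (qG 0) _ (vX _ Xv)) (proj1 (qG 0) _ (vX _ Xv0))).
rewrite -(proj2 (qG 0)) ?vX // -/y -xy -(boundary_pos Xsim _ xX) // -(qC xX) -augmentationE.
by rewrite (augmentation_boundary Xsim (proj1 (qG 1) _ xX)).
Qed.

(* Acyclicity only yields [q ~ a], where [a] is the factor by which [q] changes
   augmentations. *)
Lemma PD_cochain_homotopy_spread : exists D h,
  [/\ forall k, {homo h : phi / phi \in chains X k >-> phi \in chains X (k - 1)},
      forall phi s v, v \in s -> h phi s != 0 -> exists t, phi t != 0 /\
        forall w, w \in t -> near X D v w &
      forall k, {in chains X k, forall phi,
        pbar (p phi) - phi = coboundary X (h phi) + h (coboundary X phi)}].
Proof.
have [a qa] := q_augmentation; have [m Xm] := PD_dimension.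
pose psi (c : cochain W) : cochain W := c *~ a.
have psiB x y : psi (x - y) = psi x - psi y by rewrite /psi mulrzBl.
have psiG : graded_hom X X id psi by move=> i; split=> [c cX|x y _ _ //]; rewrite /psi rpredMz.
have vX w : X [fset w]%fset -> simplex_chain [fset w]%fset \in chains X 0.
  by move=> Xw; apply: simplex_chains => //; rewrite cardfs1.
have aug_psi c : c \in chains X 0 -> augmentation (psi c) = augmentation c * a.
  by move=> cX; rewrite !augmentationE /psi (morphMz _ (@evaluationB_chains _ _ _ X 0)) // mulrzz.
have psiC i : {in chains X i, forall c, boundary X (psi c) = psi (boundary X c)}.
  by move=> c cX; rewrite /psi (morphMz _ (@boundaryB_chains _ _ X X i)).
have aug v : X [fset v]%fset -> augmentation (q (simplex_chain [fset v]%fset)) =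
    augmentation (psi (simplex_chain [fset v]%fset)).
  by move=> Xv; rewrite qa // aug_psi ?vX // augmentationE evaluation_simplex mul1r.
have psi_spread : spread X psi (E0.+1 + E0.+1).
  move=> s v t w Xs vs; rewrite /psi mulrz_at /simplex_chain; case: (t =P s) => [->|].
    move=> _ ws; exact: (near_leq (ltn0Sn _) (simplex_vertex Xsim Xs ws) (near_edge Xsim Xs vs ws)).
  by rewrite mul0r eqxx.
have [D [H [HG HD HP]]] :=
  spread_homotopy Xsim PD_comb_acyclic Xm qG psiG qC psiC aug q_spread psi_spread.
have Hmem s t : X s -> H (simplex_chain s) t != 0 -> X t by exact: graded_mem HG.
have Hfin := spread_finite Xsim Xlf HD Hmem.
have hk k : {homo dual_map X H : phi / phi \in chains X k >-> phi \in chains X (k - 1)}.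
  by move=> phi; apply: (dual_map_chains HG _ Hfin) => i <-; rewrite addrK.
have hP0 k phi : phi \in chains X k ->
    pbarp phi - phi *~ a = coboundary X (dual_map X H phi) + dual_map X H (coboundary X phi).
  move=> phiX; rewrite -(dual_homotopy Xsim Xsim qG psiG HG HP (chains0 Xsim phiX)).
  congr (_ - _); apply: funext => s.
    have [Xs|nX] := pselect (X s); last first.
      by rewrite dual_map_out // (chains_out (proj1 (pbarpG k) _ phiX) nX).
    by rewrite dual_mapE // (q_eval phiX (simplex_in Xs)) evaluation_simplex.
  have [Xs|nX] := pselect (X s); last first.
    have paX : phi *~ a \in chains X k by rewrite rpredMz.
    by rewrite dual_map_out // (chains_out paX nX).
  rewrite dual_mapE // /psi (morphMz _ (@evaluationB_chains _ _ phi X (#|` s|%:Z - 1))) ?simplex_in //.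
  by rewrite evaluation_simplex mulrz_at mulrzz.
(* Compare the augmentations in [p pbar p pbar ~ a p pbar]. *)
have a1 : a = 1.
  have [[v Xv] _] := Xconn; have v1 := vX v Xv.
  pose phi := pbar (simplex_chain [fset v]%fset).
  have phiX : phi \in chains X n%:Z by have := proj1 (pbarG 0) _ v1; rewrite subr0.
  (* As [phi] is a cocycle, only the coboundary term of the homotopy remains; [p] turns it into a
     boundary, whose augmentation is zero. *)
  have dphi : coboundary X phi = 0.
    rewrite /phi (PD_pbar_chain PD v1) (boundary_zero Xsim v1).
    exact: (morphB0 (proj2 (pbarG 0))).
  have := hP0 _ _ phiX; rewrite dphi.
  have -> : dual_map X H 0 = 0.
    apply: funext => s; have [Xs|nX] := pselect (X s).
      by rewrite dual_mapE // evaluation0l.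
    by rewrite dual_map_out.
  rewrite addr0 => E; have pbX := proj1 (pbarpG _) _ phiX.
  have := congr1 p E; have paX : phi *~ a \in chains X n%:Z by rewrite rpredMz.
  rewrite (proj2 (pG n%:Z)) // (morphMz _ (proj2 (pG n%:Z))) //.
  have hX := hk _ _ phiX; rewrite -(PD_p_chain PD hX).
  have pphi : p phi \in chains X 0 by have := proj1 (pG _) _ phiX; rewrite subrr.
  have ppb : p (pbarp phi) \in chains X 0 by have := proj1 (pG _) _ pbX; rewrite subrr.
  move=> /(congr1 (@augmentation _ W)).
  have ph1 : p (dual_map X H phi) \in chains X 1.
    by have := proj1 (pG _) _ hX; rewrite opprB addrC subrK.
  rewrite (augmentation_boundary Xsim ph1) augmentationE.
  rewrite (evaluationB_chains _ ppb) ?rpredMz // -!augmentationE.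
  rewrite -/(psi (p phi)) aug_psi // /pbarp /= (ppbar_augmentation pphi) /phi.
  rewrite (ppbar_augmentation v1) augmentationE evaluation_simplex mul1r.
  by move=> /eqP; rewrite subr_eq0 => /eqP.
exists D, (dual_map X H); split=> // [phi s v vs|k phi phiX].
  move=> /dual_map_neq0[Xs [t [pt Ht]]]; exists t; split=> // w wt.
  exact: HD Xs vs Ht wt.
by have := hP0 _ _ phiX; rewrite a1 mulr1z.
Qed.

End PoincareDuality.

(** * Duality on chains *)

Section EvaluationSum.
Variables (d : Order.disp_t) (V : orderType d).

Lemma evaluationDl (phi psi c : cochain V) : finsupp_chain c ->
  evaluation (phi + psi) c = evaluation phi c + evaluation psi c.
Proof. by move=> fc; rewrite -[phi in RHS](addrK psi) evaluationBl // subrK. Qed.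

End EvaluationSum.

Section MoreDual.
Variables (d d' : Order.disp_t) (V : orderType d) (W : orderType d').
Implicit Types (S T : set {fset V}).

Lemma coboundary0 S : coboundary S 0 = 0 :> cochain V.
Proof. by rewrite -[X in coboundary S X](subrr 0) coboundaryB subrr. Qed.

Lemma coboundaryD S (a c : cochain V) : coboundary S (a + c) = coboundary S a + coboundary S c.
Proof.
have cN : coboundary S (- c) = - coboundary S c.
  by rewrite -[- c]sub0r coboundaryB coboundary0 sub0r.
by rewrite -[c in LHS]opprK coboundaryB cN opprK.
Qed.

Lemma dual_mapD S (T : set {fset W}) e (g : cochain V -> cochain W) (phi psi : cochain W) :
  graded_hom S T e g -> dual_map S g (phi + psi) = dual_map S g phi + dual_map S g psi.
Proof.
move=> gG; apply: funext => s.
rewrite [RHS](_ : _ = dual_map S g phi s + dual_map S g psi s) //.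
have [Ss|nS] := pselect (S s); last by rewrite !dual_map_out ?addr0.
by rewrite !dual_mapE // evaluationDl //; exact: chains_finsupp (proj1 (gG _) _ (simplex_in Ss)).
Qed.

Lemma dual_map_id S (phi : cochain V) : dual_map S id phi = restriction S phi.
Proof.
apply: funext => s; rewrite /restriction; case: asboolP => Ss.
  by rewrite dual_mapE // evaluation_simplex.
by rewrite dual_map_out.
Qed.

Lemma dual_map_zero S (g : cochain V -> cochain W) : dual_map S g 0 = 0.
Proof.
apply: funext => s; have [Ss|nS] := pselect (S s).
  by rewrite dual_mapE // evaluation0l.
by rewrite dual_map_out.
Qed.

Lemma chainsD S T i (c : cochain V) : c \in chains S i -> (forall s, T s -> c s = 0) ->
  c \in chains (S `\` T) i.
Proof. by move=> cS cT; apply: (chains_in cS) => s Ss cs; split=> // /cT /eqP; apply/negP. Qed.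

Lemma coboundary_sub S T (phi : cochain V) s : S s -> T s -> coboundary S phi s = coboundary T phi s.
Proof. by move=> Ss Ts; rewrite /coboundary !asboolT. Qed.

Lemma boundary_complement (X L : set {fset V}) i (c : cochain V) : simplicial_complex X ->
  c \in chains (complement X L) i -> boundary (complement X L) c = boundary X c.
Proof.
move=> Xsim cC; symmetry; apply: (boundary_sub (@complement_subset _ _ X Xsim L)) cC.
move=> s t Cs Xt ts; apply: (simplex_face (@complement_simplicial _ _ X L) Cs ts).
exact: (simplex_neq0 Xsim Xt).
Qed.

End MoreDual.

Section Far.
Variables (d : Order.disp_t) (W : orderType d) (X K : set {fset W}).
Hypotheses (Xsim : simplicial_complex X) (KX : subcomplex K X).
Implicit Types (c phi : cochain W) (a D : nat).

(** Stated for vertices instead of [complement]: a map then costs exactly its displacement, while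
    every return from a complement costs one more star. *)
Definition far a c := forall s v, c s != 0 -> v \in s -> ~ star_nbhd X a K [fset v]%fset.

Lemma star_nbhd_near a D v w : star_nbhd X a K [fset v]%fset -> near X D v w ->
  star_nbhd X (D + a) K [fset w]%fset.
Proof.
by move=> Kv vw; rewrite star_nbhdD; apply/star_nbhd_vertex; exists v.
Qed.

Lemma far_near (g : cochain W -> cochain W) a D c : far (D + a) c ->
  (forall s v, v \in s -> g c s != 0 ->
     exists t, [/\ c t != 0, t != fset0 & forall w, w \in t -> near X D v w]) ->
  far a (g c).
Proof.
move=> cF gD s v gs vs Kv; have [t [ct /fset0Pn[w wt] tD]] := gD s v vs gs.
by apply: (cF t w ct wt); exact: star_nbhd_near Kv (tD w wt).
Qed.

Lemma far_spread e g i a D c : graded_hom X X e g -> spread X g D -> c \in chains X i ->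
  far (D + a) c -> far a (g c).
Proof.
move=> gG gD cX cF; apply: (far_near cF) => s v vs gs.
have [t [Xt _ ct gt]] := chain_support (proj2 (gG i)) cX gs.
exists t; split=> // [|w wt]; first exact: simplex_neq0 Xt.
by apply: near_sym => //; exact: gD Xt wt gt vs.
Qed.

Lemma far_vanish i a c : c \in chains X i -> (forall s, star_nbhd X a.+1 K s -> c s = 0) -> far a c.
Proof.
move=> cX c0 s v cs vs Kv; have Xs := chains_mem cX cs.
by have := c0 s (star_nbhd_next Xs vs Kv); apply/eqP.
Qed.

Lemma far_chains i a c : far a c -> c \in chains X i ->
  c \in chains (complement X (star_nbhd X a K)) i.
Proof.
move=> cF cX; apply: (chains_in cX) => s Xs cs.
have [v vs] := simplex_pick Xsim Xs.
exact: (far_complement Xsim KX Xs vs (cF s v cs vs)).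
Qed.

Lemma complement_chains_far i a c :
  c \in chains (complement X (star_nbhd X a.+1 K)) i -> far a c.
Proof.
move=> cC s v cs vs Kv; have [_ nK] := complement_far Xsim (chains_mem cC cs).
exact: nK vs Kv.
Qed.

Lemma far_zero i a c s : far a c -> c \in chains X i -> star_nbhd X a K s -> c s = 0.
Proof.
move=> cF cX Ks; apply/eqP/negPn/negP => cs.
have [v vs] := simplex_pick Xsim (chains_mem cX cs).
exact: cF s v cs vs (subcomplex_face (subcomplex_nbhd Xsim a KX) Ks vs).
Qed.

Lemma far_leq a a' c : (a <= a')%N -> far a' c -> far a c.
Proof.
move=> aa cF s v cs vs Kv; apply: (cF s v cs vs).
exact: (star_nbhd_leq Xsim KX aa Kv).
Qed.

End Far.

Section Support.
Variables (d d' : Order.disp_t) (V : orderType d) (W : orderType d').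
Variables (X : set {fset W}) (Z0 : set {fset V}) (b : V -> W) (fs : cochain V -> cochain W) (M : nat).
Hypotheses (Xsim : simplicial_complex X) (fsG : graded_hom Z0 X id fs).
Hypothesis fs_near : forall s v t w, Z0 s -> v \in s -> fs (simplex_chain s) t != 0 ->
  w \in t -> near X M (b v) w.

Lemma fs_mem s t : Z0 s -> fs (simplex_chain s) t != 0 -> X t.
Proof. by move=> Zs; apply: chains_mem (proj1 (fsG _) _ (simplex_in Zs)). Qed.

Lemma support_spec Z t : Z `<=` Z0 -> Defs.support fs Z t ->
  exists s t', [/\ Z s, fs (simplex_chain s) t' != 0, X t' & (t `<=` t')%fset].
Proof.
move=> ZZ [t0 [i [c [t' [cZ ct tt]]]]].
have cZ0 := chains_sub ZZ cZ; have fB : {in chains Z i &, {morph fs : a b / a - b}}.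
  by move=> x y xZ yZ; apply: (proj2 (fsG i)); exact: chains_sub ZZ _ _.
have [s [Zs _ _ ft]] := chain_support fB cZ ct.
by exists s, t'; split=> //; exact: fs_mem (ZZ _ Zs) ft.
Qed.

Lemma support_subcomplex Z : Z `<=` Z0 -> subcomplex (Defs.support fs Z) X.
Proof.
move=> ZZ; split=> [|t tK]; last first.
  have [s [t' [_ _ Xt' tt]]] := support_spec ZZ tK.
  by apply: simplex_face Xt' tt _ => //; case: tK.
split=> [[]|s t [s0 [i [c [t' [cZ ct st]]]]] ts t0]; first by rewrite eqxx.
by split=> //; exists i, c, t'; split=> //; exact: fsubset_trans st.
Qed.

Lemma support_near Z t w : simplicial_complex Z -> Z `<=` Z0 -> Defs.support fs Z t -> w \in t ->
  exists v, Z [fset v]%fset /\ near X M (b v) w.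
Proof.
move=> Zsim ZZ tK wt; have [s [t' [Zs ft Xt' tt]]] := support_spec ZZ tK.
have [v vs] := simplex_pick Zsim Zs; exists v; split; first exact: simplex_vertex Zs vs.
exact: fs_near (ZZ _ Zs) vs ft (fsubsetP tt _ wt).
Qed.

Lemma support_in Z s t : Z `<=` Z0 -> Z s -> fs (simplex_chain s) t != 0 -> Defs.support fs Z t.
Proof.
move=> ZZ Zs ft; split; first exact: simplex_neq0 (fs_mem (ZZ _ Zs) ft).
by exists (#|` s|%:Z - 1), (simplex_chain s), t; split=> //; exact: simplex_in.
Qed.

End Support.

(** * Alexander duality of a pair, on chains *)

Section PairDuality.
Variables (R : realType) (d d' : Order.disp_t) (V : orderType d) (W : orderType d').
Variables (X : set {fset W}) (n E0 : nat) (pbar p : cochain W -> cochain W).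
Hypothesis PD : coarse_PD R X n pbar p E0.
Variables (Z0 Z1 : set {fset V}) (m : nat) (b : V -> W) (fs : cochain V -> cochain W).
Variables (A M : nat) (z0 : V).
Hypotheses (Z0sim : simplicial_complex Z0) (Z1sim : simplicial_complex Z1).
Hypotheses (Z10 : Z1 `<=` Z0) (Z0lf : locally_finite Z0).
Hypothesis Z0m : forall s, Z0 s -> (#|` s| <= m)%N.
Hypotheses (Z0acyc : comb_acyclic Z0) (Z1acyc : comb_acyclic Z1).
Hypothesis bX : forall v, Z0 [fset v]%fset -> X [fset b v]%fset.
Hypothesis b_lip : forall s u v, Z0 s -> u \in s -> v \in s -> near X A (b u) (b v).
Hypothesis b_proper : forall r, exists r', forall u v,
  Z0 [fset u]%fset -> Z0 [fset v]%fset -> near X r (b u) (b v) -> near Z0 r' u v.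
Hypothesis b_proper1 : forall r, exists r', forall u v,
  Z1 [fset u]%fset -> Z1 [fset v]%fset -> near X r (b u) (b v) -> near Z1 r' u v.
Hypothesis fsG : graded_hom Z0 X id fs.
Hypothesis fsC : forall i, {in chains Z0 i, forall c, boundary X (fs c) = fs (boundary Z0 c)}.
Hypothesis fs_aug : {in chains Z0 0, forall c, augmentation (fs c) = augmentation c}.
Hypothesis fs_near : forall s v t w, Z0 s -> v \in s -> fs (simplex_chain s) t != 0 ->
  w \in t -> near X M (b v) w.

Let Xsim : simplicial_complex X. Proof. by case: (PD_metric PD). Qed.
Let Xlf : locally_finite X. Proof. by case: (PD_metric PD). Qed.
Let pbarG := PD_pbar PD.
Let pG := PD_p PD.

Let K0 := Defs.support fs Z0.
Let K1 := Defs.support fs Z1.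

Let K0X : subcomplex K0 X. Proof. exact: (support_subcomplex Xsim fsG (@subset_refl _ Z0)). Qed.
Let K1X : subcomplex K1 X. Proof. exact: (support_subcomplex Xsim fsG Z10). Qed.

Let K10 : K1 `<=` K0.
Proof.
move=> t tK; have [s [t' [Zs ft Xt' tt]]] := support_spec fsG Z10 tK.
have [_ Kf] := proj1 K0X; apply: (Kf t'); [|exact: tt|by case: tK].
exact: (support_in Xsim fsG (@subset_refl _ Z0) (Z10 Zs) ft).
Qed.

Lemma b_near r u v : Z0 [fset u]%fset -> near Z0 r u v -> near X (r * A) (b u) (b v).
Proof.
move=> Zu; elim: r v => [|r IH] v; first by move=> /near0 ->; exact: near_refl.
move=> /nearS[Zv [s [w [Zs vs ws uw]]]]; rewrite mulSn.
exact: near_trans (IH _ uw) (b_lip Zs ws vs).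
Qed.

(** Simplices whose images contain [t] have vertices that [b] sends within [M] of one vertex of [t];
    by properness they lie in one ball of [Z0], which is finite. *)
Lemma fs_finite t : X t -> finite_set [set s | Z0 s /\ fs (simplex_chain s) t != 0].
Proof.
move=> Xt; have [[s0 [Zs0 ft0]]|ns] := pselect (exists s, Z0 s /\ fs (simplex_chain s) t != 0); last first.
  by rewrite (_ : [set _ | _] = set0) // -subset0 => s h; apply: ns; exists s.
have [w wt] := simplex_pick Xsim Xt; have [v0 vs0] := simplex_pick Z0sim Zs0.
have Zv0 := simplex_vertex Z0sim Zs0 vs0.
have [r' pr] := b_proper (M + M); apply: sub_finite_set (ball_finite Z0sim r'.+1 Z0lf Zv0).
move=> s [Zs ft]; have [v vs] := simplex_pick Z0sim Zs.
apply: (near_ball Zs vs); apply: pr => //; first exact: simplex_vertex Zs vs.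
apply: near_trans (fs_near Zs0 vs0 ft0 wt) _; apply: near_sym => //.
exact: fs_near Zs vs ft wt.
Qed.

Section Inverse.
Variable r : nat.
Let N0 := star_nbhd X r K0.
Let N1 := star_nbhd X r K1.

Let N0X : subcomplex N0 X. Proof. exact: subcomplex_nbhd. Qed.
Let N1X : subcomplex N1 X. Proof. exact: subcomplex_nbhd. Qed.
Let N0sim : simplicial_complex N0. Proof. by case: N0X. Qed.
Let N1sim : simplicial_complex N1. Proof. by case: N1X. Qed.
Let N10 : N1 `<=` N0. Proof. exact: star_nbhd_mono. Qed.
Let N0sub : N0 `<=` X. Proof. by case: N0X. Qed.

Let nearest w z := near X (r + M) (b z) w.

Lemma nearest_exists Z w : simplicial_complex Z -> Z `<=` Z0 ->
  star_nbhd X r (Defs.support fs Z) [fset w]%fset -> exists z, Z [fset z]%fset /\ nearest w z.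
Proof.
move=> Zsim ZZ /star_nbhd_vertex[u uK uw].
have [z [Zz zu]] := support_near fsG fs_near Zsim ZZ uK (fset11 u).
by exists z; split=> //; exact: near_trans zu uw.
Qed.

(** A single vertex map for both complexes, with values in [Z1] on [N1], so that its extension can
    respect the pair. *)
Lemma nearest_choice : exists z : W -> V,
  [/\ forall w, N0 [fset w]%fset -> Z0 [fset z w]%fset,
      forall w, N1 [fset w]%fset -> Z1 [fset z w]%fset &
      forall w, N0 [fset w]%fset -> nearest w (z w)].
Proof.
have /choice[z zP] : forall w, exists z, N0 [fset w]%fset ->
    [/\ Z0 [fset z]%fset, N1 [fset w]%fset -> Z1 [fset z]%fset & nearest w z].
  move=> w; have [N1w|nN1] := pselect (N1 [fset w]%fset).
    have [z [Z1z nz]] := nearest_exists Z1sim Z10 N1w.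
    by exists z => _; split=> //; exact: Z10.
  have [N0w|nN0] := pselect (N0 [fset w]%fset).
    have [z [Z0z nz]] := nearest_exists Z0sim (@subset_refl _ Z0) N0w.
    by exists z => _; split=> //.
  by exists z0.
exists z; split=> w Nw; have [] := zP w => //; first exact: N10.
by move=> _ + _; apply.
Qed.

(** Adjacent vertices have nearest points whose images under [b] are close. Properness makes the
    nearest points themselves close, in [Z1] for simplices of [N1] and in [Z0] otherwise, which is
    the condition for extension along balls. *)
Lemma coarse_inverse : exists D (g : cochain W -> cochain V),
  [/\ graded_hom N0 Z0 id g,
      forall i, {in chains N0 i, forall c, boundary Z0 (g c) = g (boundary N0 c)},
      {in chains N0 0, forall c, augmentation (g c) = augmentation c},
      forall s t, N1 s -> g (simplex_chain s) t != 0 -> Z1 t &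
      forall s v t z, N0 s -> v \in s -> g (simplex_chain s) t != 0 -> z \in t ->
        near X D v (b z)].
Proof.
have [z [zZ0 zZ1 zn]] := nearest_choice.
(* The way from [b (z u)] to [u], along an edge to [v], and back to [b (z v)]. *)
pose r1 := (r + M + (1 + (r + M)))%N.
have [a0 pr0] := b_proper r1; have [a1 pr1] := b_proper1 r1.
have [mX Xm] := PD_dimension PD.
have zz s u v : N0 s -> u \in s -> v \in s -> near X r1 (b (z u)) (b (z v)).
  move=> Ns us vs; have Nu := simplex_vertex N0sim Ns us; have Nv := simplex_vertex N0sim Ns vs.
  apply: near_trans (_ : near X (1 + (r + M)) (b (z u)) v) _.
    exact: near_trans (zn u Nu) (near_edge Xsim (N0sub Ns) us vs).
  by apply: near_sym => //; exact: zn.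
have zz' s u v : N0 s -> u \in s -> v \in s -> near (target N1 Z0 Z1 s) (maxn a0 a1) (z u) (z v).
  move=> Ns us vs; have zuv := zz s u v Ns us vs.
  have Nu := simplex_vertex N0sim Ns us; have Nv := simplex_vertex N0sim Ns vs.
  rewrite /target; case: asboolP => N1s.
    have Nu1 := simplex_vertex N1sim N1s us; have Nv1 := simplex_vertex N1sim N1s vs.
    exact: (near_leq (leq_maxr _ _) (zZ1 v Nv1) (pr1 _ _ (zZ1 u Nu1) (zZ1 v Nv1) zuv)).
  exact: (near_leq (leq_maxl _ _) (zZ0 v Nv) (pr0 _ _ (zZ0 u Nu) (zZ0 v Nv) zuv)).
have [rho [g [gG gC gaug gc]]] := chain_map_extension N0sim N1sim Z0sim Z1sim Z10
  (fun s Ns => Xm s (N0sub Ns)) Z0acyc Z1acyc zZ0 zZ1 zz'.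
have gt s v t y : N0 s -> v \in s -> g (simplex_chain s) t != 0 -> y \in t -> near Z0 rho (z v) y.
  move=> Ns vs gst yt; have Zv := zZ0 v (simplex_vertex N0sim Ns vs).
  apply: (ball_near Z0sim Zv _ yt).
  by apply: ball_mono (gc s v t Ns vs gst); rewrite /target; case: asboolP => _ // ? /Z10.
(* An edge path with [rho] steps in [Z0] becomes one with [rho] times [A] steps in [X]; the rest is
   the distance from [v] to [b (z v)]. *)
exists (rho * A + (r + M))%N, g; split=> // [s t N1s gst|s v t y Ns vs gst yt].
  have [v vs] := simplex_pick N1sim N1s.
  have := gc s v t (N10 N1s) vs gst; rewrite /target asboolT //.
  have [_] := subcomplex_ball Z1sim rho (zZ1 v (simplex_vertex N1sim N1s vs)); apply.
have Nv := simplex_vertex N0sim Ns vs.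
apply: near_trans (near_sym Xsim (zn v Nv)) _.
exact: b_near (zZ0 v Nv) (gt s v t y Ns vs gst yt).
Qed.

Lemma fs_graded : graded_hom Z0 N0 id fs.
Proof.
move=> i; split=> [c cZ|]; last exact: (proj2 (fsG i)).
apply: (chains_in (proj1 (fsG i) _ cZ)) => t Xt ct.
have [s [Zs _ _ ft]] := chain_support (proj2 (fsG i)) cZ ct.
have := support_in Xsim fsG (@subset_refl _ Z0) Zs ft.
exact: (star_nbhd_leq Xsim K0X (leq0n r)).
Qed.

Lemma fs_chain i c : c \in chains Z0 i -> boundary N0 (fs c) = fs (boundary Z0 c).
Proof.
move=> cZ; rewrite -(fsC cZ); symmetry; apply: (boundary_sub N0sub) (proj1 (fs_graded i) _ cZ).
move=> s t Ns Xt ts; apply: (simplex_face N0sim Ns ts); exact: (simplex_neq0 Xsim Xt).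
Qed.

Lemma fs_mem1 s t : Z1 s -> fs (simplex_chain s) t != 0 -> N1 t.
Proof.
by move=> Zs ft; apply: (star_nbhd_leq Xsim K1X (leq0n r)); exact: (support_in Xsim fsG Z10 Zs ft).
Qed.

Section Composites.
Variables (D : nat) (g : cochain W -> cochain V).
Hypotheses (gG : graded_hom N0 Z0 id g)
  (gC : forall i, {in chains N0 i, forall c, boundary Z0 (g c) = g (boundary N0 c)})
  (gaug : {in chains N0 0, forall c, augmentation (g c) = augmentation c})
  (g1 : forall s t, N1 s -> g (simplex_chain s) t != 0 -> Z1 t)
  (g_near : forall s v t z, N0 s -> v \in s -> g (simplex_chain s) t != 0 -> z \in t ->
     near X D v (b z)).

Lemma g_finite t : Z0 t -> finite_set [set s | N0 s /\ g (simplex_chain s) t != 0].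
Proof.
move=> Zt; have [z zt] := simplex_pick Z0sim Zt; have Xz := bX (simplex_vertex Z0sim Zt zt).
apply: sub_finite_set (ball_finite Xsim D.+1 Xlf Xz) => s [Ns gst].
have [v vs] := simplex_pick N0sim Ns; apply: (near_ball (N0sub Ns) vs).
by apply: near_sym => //; exact: g_near Ns vs gst zt.
Qed.

(** On [Z1] the homotopy has to stay in [Z1]. The composite does, because [fs] maps [Z1] into [N1]
    and [g] maps [N1] into [Z1]; acyclicity of [Z1] itself then fills the homotopy inside it. *)
Lemma source_homotopy : exists rho (G : cochain V -> cochain V),
  [/\ graded_hom Z0 Z0 (fun i => i + 1) G,
      forall i, {in chains Z0 i, forall c,
        g (fs c) - c = boundary Z0 (G c) + G (boundary Z0 c)},
      forall s t, Z1 s -> G (simplex_chain s) t != 0 -> Z1 t &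
      spread Z0 G rho].
Proof.
have [r0 pr0] := b_proper (D + M); have [r1 pr1] := b_proper1 (D + M).
have gfG : graded_hom Z0 Z0 id (g \o fs) := graded_comp fs_graded gG.
have idG : graded_hom Z0 Z0 id id by move=> i; split.
have comp s t : Z0 s -> g (fs (simplex_chain s)) t != 0 -> exists u,
    [/\ N0 u, fs (simplex_chain s) u != 0 & g (simplex_chain u) t != 0].
  move=> Zs gt; have [u [Nu _ fu gu]] := chain_support (proj2 (gG _)) (proj1 (fs_graded _) _ (simplex_in Zs)) gt.
  by exists u.
have gf_near s v t y : Z0 s -> v \in s -> g (fs (simplex_chain s)) t != 0 -> y \in t ->
    near X (D + M) (b v) (b y).
  move=> Zs vs gt yt; have [u [Nu fu gu]] := comp s t Zs gt.
  have [w wu] := simplex_pick N0sim Nu.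
  exact: near_trans (fs_near Zs vs fu wu) (g_near Nu wu gu yt).
have gf_mem s t : Z0 s -> g (fs (simplex_chain s)) t != 0 -> Z0 t.
  by move=> Zs; apply: chains_mem (proj1 (gfG _) _ (simplex_in Zs)).
pose a := (maxn r0 r1).+1.
have carg : carried Z0 Z1 Z0 Z1 id (g \o fs) a.
  move=> s v t Zs vs gt; have Zt := gf_mem s t Zs gt; have [y yt] := simplex_pick Z0sim Zt.
  have Zv := simplex_vertex Z0sim Zs vs; have Zy := simplex_vertex Z0sim Zt yt.
  have vy := gf_near s v t y Zs vs gt yt.
  rewrite /target; case: asboolP => Z1s.
    have [u [Nu fu gu]] := comp s t Zs gt; have Z1t := g1 (fs_mem1 Z1s fu) gu.
    have Z1v := simplex_vertex Z1sim Z1s vs; have Z1y := simplex_vertex Z1sim Z1t yt.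
    exact: (near_ball Z1t yt (near_leq (leq_maxr _ _) Z1y (pr1 _ _ Z1v Z1y vy))).
  exact: (near_ball Zt yt (near_leq (leq_maxl _ _) Zy (pr0 _ _ Zv Zy vy))).
have tgt s : Z0 s -> target Z1 Z0 Z1 s s by rewrite /target; case: asboolP.
have tsim s : simplicial_complex (target Z1 Z0 Z1 s) by exact: target_simplicial.
have cari : carried Z0 Z1 Z0 Z1 id id a.
  move=> s v t Zs vs; rewrite /simplex_chain; case: (t =P s) => // -> _.
  have tv := simplex_vertex (tsim s) (tgt s Zs) vs.
  apply: (ball_leq (tsim s) tv (ltn0Sn _)).
  by apply: (near_ball (tgt s Zs) vs); exact: near_refl.
have bn s u v : Z0 s -> u \in s -> v \in s -> near (target Z1 Z0 Z1 s) a (id u) (id v).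
  move=> Zs us vs; have tv := simplex_vertex (tsim s) (tgt s Zs) vs.
  exact: (near_leq (ltn0Sn _) tv (near_edge (tsim s) (tgt s Zs) us vs)).
have gfC i : {in chains Z0 i, forall c, boundary Z0 ((g \o fs) c) = (g \o fs) (boundary Z0 c)}.
  by move=> c cZ /=; rewrite (gC (proj1 (fs_graded i) _ cZ)) (fs_chain cZ).
have aug v : Z0 [fset v]%fset -> augmentation ((g \o fs) (simplex_chain [fset v]%fset)) =
    augmentation (id (simplex_chain [fset v]%fset) : cochain V).
  move=> Zv; have v1 : simplex_chain [fset v]%fset \in chains Z0 0.
    by apply: simplex_chains => //; rewrite cardfs1.
  by rewrite /= (gaug (proj1 (fs_graded 0) _ v1)) (fs_aug v1).
have [rho [G [GG Gc GP]]] := homotopy_extension Z0sim Z1sim Z0sim Z1sim Z10 Z0m Z0acyc Z1acyc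
  (fun v => id) (fun v => id) bn gfG idG gfC (fun i c _ => erefl) aug carg cari.
exists rho, G; split=> // [s t Z1s Gt|s v t y Zs vs Gt yt].
  have [v vs] := simplex_pick Z1sim Z1s; have := Gc s v t (Z10 Z1s) vs Gt.
  rewrite /target asboolT //.
  by have [_] := subcomplex_ball Z1sim rho (simplex_vertex Z1sim Z1s vs); apply.
have Zv := simplex_vertex Z0sim Zs vs; apply: (ball_near Z0sim Zv _ yt).
by apply: ball_mono (Gc s v t Zs vs Gt); rewrite /target; case: asboolP => _ // ? /Z10.
Qed.

(** Here bounded displacement replaces compatibility with the pair: it makes the transpose of [H]
    vanish on [N1] for cochains far enough from [K1]. *)
Lemma target_homotopy : exists rho (H : cochain W -> cochain W),
  [/\ graded_hom N0 X (fun i => i + 1) H,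
      forall i, {in chains N0 i, forall c,
        fs (g c) - c = boundary X (H c) + H (boundary N0 c)} &
      forall s v t w, N0 s -> v \in s -> H (simplex_chain s) t != 0 -> w \in t ->
        near X rho v w].
Proof.
have [mX Xm] := PD_dimension PD.
have fgG : graded_hom N0 X id (fs \o g) := graded_comp gG fsG.
have idG : graded_hom N0 X id id by move=> i; split=> [c|//]; exact: chains_sub.
have s0 : simplicial_complex (set0 : set {fset W}) by split.
have acyc0 : comb_acyclic (set0 : set {fset W}) by move=> j ?; exists 0.
pose a := (M + D).+1.
have tX s : target set0 X set0 s = X by rewrite /target; case: asboolP.
have bn s u v : N0 s -> u \in s -> v \in s -> near (target set0 X set0 s) a (id u) (id v).
  rewrite tX => Ns us vs; have Xs := N0sub Ns.
  exact: (near_leq (ltn0Sn _) (simplex_vertex Xsim Xs vs) (near_edge Xsim Xs us vs)).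
have carg : carried N0 set0 X set0 id (fs \o g) a.
  move=> s v t Ns vs ft; rewrite tX.
  have Xt := chains_mem (proj1 (fgG _) _ (simplex_in Ns)) ft.
  have [u [Zu _ gu fu]] := chain_support (proj2 (fsG _)) (proj1 (gG _) _ (simplex_in Ns)) ft.
  have [y yu] := simplex_pick Z0sim Zu; have [w wt] := simplex_pick Xsim Xt.
  apply: (near_ball Xt wt).
  exact: near_trans (g_near Ns vs gu yu) (fs_near Zu yu fu wt).
have cari : carried N0 set0 X set0 id id a.
  move=> s v t Ns vs; rewrite tX /simplex_chain; case: (t =P s) => // -> _.
  have Xs := N0sub Ns; apply: (ball_leq Xsim (simplex_vertex Xsim Xs vs) (ltn0Sn _)).
  by apply: (near_ball Xs vs); exact: near_refl.
have fgC i : {in chains N0 i, forall c, boundary X ((fs \o g) c) = (fs \o g) (boundary N0 c)}.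
  by move=> c cN /=; rewrite (fsC (proj1 (gG i) _ cN)) (gC cN).
have idC i : {in chains N0 i, forall c, boundary X (id c) = id (boundary N0 c)}.
  move=> c cN; have fc : face_closed N0 X; last exact: (boundary_sub N0sub fc cN).
  by move=> s t Ns Xt ts; apply: (simplex_face N0sim Ns ts); exact: (simplex_neq0 Xsim Xt).
have aug v : N0 [fset v]%fset -> augmentation ((fs \o g) (simplex_chain [fset v]%fset)) =
    augmentation (id (simplex_chain [fset v]%fset) : cochain W).
  move=> Nv; have v1 : simplex_chain [fset v]%fset \in chains N0 0.
    by apply: simplex_chains => //; rewrite cardfs1.
  by rewrite /= (fs_aug (proj1 (gG 0) _ v1)) (gaug v1).
have [rho [H [HG Hc HP]]] := homotopy_extension N0sim s0 Xsim s0 (@sub0set _ X)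
  (fun s Ns => Xm s (N0sub Ns)) (PD_comb_acyclic PD) acyc0
  (fun v Nv => N0sub Nv) (fun v => id) bn fgG idG fgC idC aug carg cari.
exists rho, H; split=> // s v t w Ns vs Ht wt; have := Hc s v t Ns vs Ht; rewrite tX => bt.
exact: (ball_near Xsim (simplex_vertex Xsim (N0sub Ns) vs) bt wt).
Qed.

End Composites.
End Inverse.

Let Y0 r := complement X (star_nbhd X r K0).
Let Y1 r := complement X (star_nbhd X r K1).

Lemma fs_dual_chains k phi : phi \in chains X k -> dual_map Z0 fs phi \in chains Z0 k.
Proof. by apply: (dual_map_chains fsG) => // t; exact: fs_finite. Qed.

Lemma fs_dual_zero phi s : (forall t, Z0 s -> fs (simplex_chain s) t != 0 -> phi t = 0) ->
  dual_map Z0 fs phi s = 0.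
Proof.
move=> h; have [Zs|nZ] := pselect (Z0 s); last by rewrite dual_map_out.
by rewrite dual_mapE //; apply: evaluation_eq0 => t; exact: h.
Qed.

(** Extended by zero, [phi'] is not a cocycle, but its coboundary stays beyond radius [a] from [K0]
    and [phi'] itself beyond radius [a] from [K1]; so [p phi'] is a relative cycle. Its image is
    cohomologous to the pullback of [phi'] by [pbar p ~ 1] ([E1]), and that pullback to [phi] by
    [g fs ~ 1] ([E2]). *)
Lemma duality_surjective r k phi : phi \in relative_cocycles Z0 Z1 k ->
  exists2 c, c \in relative_cycles (Y1 r) (Y0 r) (n%:Z - k) &
    dual_map Z0 fs (pbar c) - phi \in relative_coboundaries Z0 Z1 k.
Proof.
move=> /andP[phiZ /eqP dphi].
have phi0 : phi \in chains Z0 k by apply: chains_sub phiZ => s [].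
have phi1 s : Z1 s -> phi s = 0 by move=> Z1s; apply: (chains_out phiZ) => -[].
have [D1 [h [hdeg hnear hP]]] := PD_cochain_homotopy_spread PD.
pose e := E0.+1; pose a := (e + (D1 + r))%N.
have [D [g [gG gC gaug g1 gnear]]] := coarse_inverse a.+1.
have [rho [G [GG GP G1 Gs]]] := source_homotopy gG gC gaug g1 gnear.
pose N0 := star_nbhd X a.+1 K0; pose N1 := star_nbhd X a.+1 K1.
have N0X : subcomplex N0 X by exact: subcomplex_nbhd.
have N10 : N1 `<=` N0 by exact: star_nbhd_mono.
have [N0sim N0sub] := N0X.
pose phi' := dual_map N0 g phi.
have phiN : phi' \in chains N0 k.
  by apply: (dual_map_chains gG) phi0 => // t; exact: (g_finite gnear).
have phiX : phi' \in chains X k by exact: chains_sub phiN.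
have far1 : far X K1 a phi'.
  apply: (far_vanish phiX) => s N1s; rewrite /phi' dual_mapE; last exact: N10.
  by apply: evaluation_eq0 => t /(g1 _ _ N1s) /phi1.
have dphiX := coboundary_chains Xsim Xlf phiX.
(* Inside [N0] the pullback by the chain map [g] is a cocycle; only the cut at the frontier of [N0]
   produces a coboundary. *)
have far0 : far X K0 a (coboundary X phi').
  apply: (far_vanish dphiX) => s Ns; rewrite (coboundary_sub _ (N0sub _ Ns) Ns).
  rewrite /phi' -(dual_chain_map N0sim Z0sim gG gC (chains0 Z0sim phi0)) dphi.
  by rewrite dual_map_zero.
have pphi := proj1 (pG k) _ phiX; have pspread := p_spread PD.
exists (p phi'); first apply/andP.
  have cY : p phi' \in chains (Y1 r) (n%:Z - k).
    apply: (far_chains Xsim K1X _ pphi).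
    apply: (far_spread Xsim pG pspread phiX); apply: far_leq far1 => //.
    by rewrite /a addnA leq_add2r leq_addr.
  split=> //; rewrite (boundary_complement Xsim cY) (PD_p_chain PD phiX).
  have -> : n%:Z - k - 1 = n%:Z - (k + 1) by rewrite opprD addrA.
  apply: (far_chains Xsim K0X _ (proj1 (pG _) _ dphiX)).
  apply: (far_spread Xsim pG pspread dphiX); apply: far_leq far0 => //.
  by rewrite /a addnA leq_add2r leq_addr.
have hphi := hdeg _ _ phiX.
have hfar (L : set {fset W}) (LX : subcomplex L X) j psi t : psi \in chains X j -> far X L a psi ->
    L t -> h psi t = 0.
  move=> psiX psif Lt; apply: (far_zero Xsim LX (a := 0) _ (hdeg _ _ psiX)) => //.
  apply: (far_near (D := D1)) => [|s v vs hs]; first by apply: far_leq psif => //; rewrite /a addn0 (leq_trans (leq_addr r D1)) // leq_addl.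
  have [u [pu hu]] := hnear psi s v vs hs; exists u; split=> //.
  exact: (simplex_neq0 Xsim (chains_mem psiX pu)).
have E1 : dual_map Z0 fs (pbar (p phi')) - dual_map Z0 fs phi' =
    coboundary Z0 (dual_map Z0 fs (h phi')).
  have pbp : pbar (p phi') \in chains X k.
    by have := proj1 (pbarG _) _ pphi; rewrite opprB addrC subrK.
  rewrite -(dual_mapB _ _ fsG) (hP _ _ phiX) (dual_mapD _ _ fsG).
  rewrite (dual_chain_map Z0sim Xsim fsG fsC (chains0 Xsim hphi)).
  (* The homotopy moves the coboundary of [phi'] too little to reach [K0], where [fs] takes its
     values. *)
  rewrite [X in _ + X](_ : _ = 0) ?addr0 //; apply: funext => s.
  apply: fs_dual_zero => t Zs ft; apply: (hfar K0 K0X _ _ _ dphiX far0).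
  exact: (support_in Xsim fsG (@subset_refl _ Z0) Zs ft).
have E2 : dual_map Z0 fs phi' - phi = coboundary Z0 (dual_map Z0 G phi).
  have idG : graded_hom Z0 Z0 id (id : cochain V -> cochain V) by move=> i; split.
  have gfG : graded_hom Z0 Z0 id (g \o fs) := graded_comp (fs_graded a.+1) gG.
  have := dual_homotopy Z0sim Z0sim gfG idG GG GP (chains0 Z0sim phi0).
  rewrite dual_map_id (restriction_chains phi0) dphi dual_map_zero addr0 => <-.
  congr (_ - _); apply: funext => s.
  have [Zs|nZ] := pselect (Z0 s); last by rewrite !dual_map_out.
  by rewrite !dual_mapE // (dual_map_eval phi gG (proj1 (fs_graded a.+1 _) _ (simplex_in Zs))).
have Gphi : dual_map Z0 G phi \in chains Z0 (k - 1).
  apply: (dual_map_chains GG) phi0 => [i <-|t Zt]; first by rewrite addrK.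
  by apply: (spread_finite Z0sim Z0lf Gs) => // s u Zs; exact: graded_mem GG Zs.
(* The primitive must vanish on [Z1]: the first summand does because [phi'] is far from [K1], the
   second because [G] preserves [Z1], where [phi] is zero. *)
apply/asboolP; exists (dual_map Z0 fs (h phi') + dual_map Z0 G phi).
  apply: rpredD; apply: chainsD => //; first exact: fs_dual_chains.
    move=> s Zs; apply: fs_dual_zero => t _ ft; apply: (hfar K1 K1X _ _ _ phiX far1).
    exact: (support_in Xsim fsG Z10 Zs ft).
  move=> s Zs; rewrite dual_mapE; last exact: Z10.
  by apply: evaluation_eq0 => t /(G1 _ _ Zs) /phi1.
by rewrite coboundaryD -E1 -E2 addrA subrK.
Qed.

(** A primitive [psi] of the image of [c] is pulled back along [g] and corrected by the homotopy
    [fs g ~ 1]; the result [theta] is a primitive of [pbar c] near [K0]. Then [p theta], corrected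
    by the homotopy [p pbar ~ 1], bounds [c] up to a chain far from [K0]. *)
Lemma duality_injective r k : exists2 r', (r <= r')%N & forall c,
  c \in relative_cycles (Y1 r') (Y0 r') (n%:Z - k) ->
  dual_map Z0 fs (pbar c) \in relative_coboundaries Z0 Z1 k ->
  c \in relative_boundaries (Y1 r) (Y0 r) (n%:Z - k).
Proof.
have [D2 [h' [hG hs hP]]] := PD_chain_homotopy_spread PD.
pose e := E0.+1; pose a := (e + r)%N.
have [D [g [gG gC gaug g1 gnear]]] := coarse_inverse a.+1.
have [rho [H [HG HP Hnear]]] := target_homotopy gG gC gaug gnear.
pose N0 := star_nbhd X a.+1 K0; pose N1 := star_nbhd X a.+1 K1.
have N0X : subcomplex N0 X by exact: subcomplex_nbhd.
have N1X : subcomplex N1 X by exact: subcomplex_nbhd.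
have N10 : N1 `<=` N0 by exact: star_nbhd_mono.
have [N0sim N0sub] := N0X.
(* [D2] is spent by the homotopy [p pbar ~ 1], [e] by [pbar] and [rho] by [H]; within [a.+1] the
   cochain [theta] is under control, and [a] leaves [e] for [p]. *)
pose q := (D2 + (e + (rho + a.+1)))%N.
have ra : (r <= e + (rho + a.+1))%N.
  by apply: leq_trans (leq_addl _ _); apply: leq_trans (leq_addl _ _); rewrite leqW // leq_addl.
have rq : (D2 + r <= q)%N by rewrite leq_add2l.
have deg : n%:Z - k + 1 = n%:Z - (k - 1) by rewrite opprB addrA addrAC.
(* The extra star is the loss in passing from a complement to [far]. *)
exists q.+1 => [|c /andP[cY dcY] /asboolP[psi psiZ phiE]].
  by apply: leqW; apply: leq_trans rq; exact: leq_addl.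
have cX : c \in chains X (n%:Z - k) := chains_sub (@complement_subset _ _ X Xsim _) cY.
have cfar : far X K1 q c := complement_chains_far Xsim cY.
move: dcY; rewrite (boundary_complement Xsim cY) => dcY.
have dcX := boundary_chains cX.
have dcfar : far X K0 q (boundary X c) := complement_chains_far Xsim dcY.
pose phi := pbar c.
have phiX : phi \in chains X k by have := proj1 (pbarG _) _ cX; rewrite opprB addrC subrK.
have dphiX := coboundary_chains Xsim Xlf phiX.
have phifar : far X K1 (rho + a.+1) phi.
  apply: (far_spread Xsim pbarG (pbar_spread PD) cX); apply: far_leq cfar => //.
  by rewrite /q leq_addl.
have dphifar : far X K0 (rho + a.+1) (coboundary X phi).
  rewrite (PD_pbar_chain PD cX).
  apply: (far_spread Xsim pbarG (pbar_spread PD) dcX); apply: far_leq dcfar => //.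
  by rewrite /q leq_addl.
have psi0 : psi \in chains Z0 (k - 1) by apply: chains_sub psiZ => s [].
have psi1 s : Z1 s -> psi s = 0 by move=> Z1s; apply: (chains_out psiZ) => -[].
pose theta := dual_map N0 g psi - dual_map N0 H phi.
have gpsi : dual_map N0 g psi \in chains N0 (k - 1).
  by apply: (dual_map_chains gG) psi0 => // t; exact: (g_finite gnear).
have Hphi : dual_map N0 H phi \in chains N0 (k - 1).
  apply: (dual_map_chains HG) phiX => [i <-|t Xt]; first by rewrite addrK.
  have [w wt] := simplex_pick Xsim Xt; have Xw := simplex_vertex Xsim Xt wt.
  apply: sub_finite_set (ball_finite Xsim rho.+1 Xlf Xw) => s [Ns Ht].
  have [v vs] := simplex_pick N0sim Ns; apply: (near_ball (N0sub _ Ns) vs).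
  by apply: near_sym => //; exact: Hnear Ns vs Ht wt.
have Hzero (L : set {fset W}) j xi s (LX : subcomplex L X) : xi \in chains X j ->
    far X L (rho + a.+1) xi -> star_nbhd X a.+1 L s -> N0 s -> dual_map N0 H xi s = 0.
  move=> xiX xif Ls Ns; rewrite dual_mapE //; apply: evaluation_eq0 => t Ht.
  apply/eqP/negPn/negP => xt; have [w wt] := simplex_pick Xsim (chains_mem xiX xt).
  have [v vs] := simplex_pick N0sim Ns.
  apply: (xif t w xt wt); apply: star_nbhd_near (Hnear _ _ _ _ Ns vs Ht wt).
  exact: subcomplex_face (subcomplex_nbhd Xsim _ LX) Ls vs.
have thetaN : theta \in chains N0 (k - 1) by rewrite rpredB.
have thetaX : theta \in chains X (k - 1) := chains_sub N0sub thetaN.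
have theta1 s : N1 s -> theta s = 0.
  move=> N1s; rewrite [LHS](_ : _ = dual_map N0 g psi s - dual_map N0 H phi s) //.
  rewrite (Hzero K1 _ _ _ K1X phiX phifar N1s (N10 _ N1s)) dual_mapE; last exact: N10.
  by rewrite subr0; apply: evaluation_eq0 => t /(g1 _ _ N1s) /psi1.
(* The dual homotopy formula leaves one extra term, the transpose of [H] applied to the coboundary
   of [phi]; it vanishes on [N0] because that coboundary is far from [K0]. *)
have dtheta s : N0 s -> coboundary X theta s = phi s.
  move=> Ns; rewrite (coboundary_sub _ (N0sub _ Ns) Ns) /theta coboundaryB.
  rewrite -(dual_chain_map N0sim Z0sim gG gC (chains0 Z0sim psi0)) -phiE.
  rewrite [LHS](_ : _ = dual_map N0 g (dual_map Z0 fs phi) s -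
    coboundary N0 (dual_map N0 H phi) s) //.
  have idG : graded_hom N0 X id (id : cochain W -> cochain W).
    by move=> i; split=> [x|//]; exact: chains_sub.
  have fgG : graded_hom N0 X id (fs \o g) := graded_comp gG fsG.
  have E := dual_homotopy N0sim Xsim fgG idG HG HP (chains0 Xsim phiX).
  have := congr1 (fun x : cochain W => x s) E; rewrite dual_map_id.
  rewrite [X in X = _ -> _](_ : _ = dual_map N0 (fs \o g) phi s - restriction N0 phi s) //.
  rewrite [X in _ = X -> _](_ : _ = coboundary N0 (dual_map N0 H phi) s +
     dual_map N0 H (coboundary X phi) s) //.
  rewrite (Hzero K0 _ _ _ K0X dphiX dphifar Ns Ns) addr0 {1}/restriction asboolT // => <-.
  have -> : dual_map N0 g (dual_map Z0 fs phi) s = dual_map N0 (fs \o g) phi s.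
    by rewrite !dual_mapE // (dual_map_eval phi fsG (proj1 (gG _) _ (simplex_in Ns))).
  by rewrite opprB addrC subrK.
have dthetaX := coboundary_chains Xsim Xlf thetaX; rewrite subrK in dthetaX.
have diffX : phi - coboundary X theta \in chains X k by rewrite rpredB.
have difffar : far X K0 a (phi - coboundary X theta).
  apply: (far_vanish diffX) => s Ns.
  by rewrite [LHS](_ : _ = phi s - coboundary X theta s) // dtheta // subrr.
have thetafar : far X K1 a theta by apply: (far_vanish thetaX) => s Ns; exact: theta1.
have ptX := proj1 (pG _) _ thetaX; have pdX := proj1 (pG _) _ diffX.
have hcX := proj1 (hG _) _ cX; have hdcX := proj1 (hG _) _ dcX.
(* Boundary of the first chain plus the second chain is [p phi - (p (pbar c) - c)], that is [c]. *)
apply/asboolP; exists (p theta - h' c), (p (phi - coboundary X theta) - h' (boundary X c)); split.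
- apply: rpredB.
    rewrite deg.
    exact: (far_chains Xsim K1X (far_spread Xsim pG (p_spread PD) thetaX thetafar) ptX).
  apply: (far_chains Xsim K1X _ hcX); apply: (far_spread Xsim hG hs cX).
  exact: far_leq rq cfar.
- apply: rpredB.
    exact: (far_chains Xsim K0X (far_spread Xsim pG (p_spread PD) diffX difffar) pdX).
  rewrite subrK in hdcX.
  apply: (far_chains Xsim K0X _ hdcX); apply: (far_spread Xsim hG hs dcX).
  exact: far_leq rq dcfar.
have bY : p theta - h' c \in chains (Y1 r) (n%:Z - k + 1).
  apply: rpredB.
    rewrite deg.
    exact: (far_chains Xsim K1X (far_spread Xsim pG (p_spread PD) thetaX thetafar) ptX).
  apply: (far_chains Xsim K1X _ hcX); apply: (far_spread Xsim hG hs cX).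
  exact: far_leq rq cfar.
rewrite (boundary_complement Xsim bY).
have hcX' := hcX; rewrite deg in hcX'.
rewrite (boundaryB_chains _ ptX hcX') (PD_p_chain PD thetaX).
rewrite (proj2 (pG k) _ _ phiX dthetaX) /phi addrACA -opprD -(hP _ _ cX).
by rewrite addrCA subrr addr0 opprB addrC subrK.
Qed.

End PairDuality.

(** * Coarse embeddings on vertices *)

Section CoarseMaps.
Variables (R : realType) (d d' : Order.disp_t) (V : orderType d) (W : orderType d').
Variables (S : set {fset V}) (T : set {fset W}) (mS mT : nat).
Variables (f : (V -> R) -> (W -> R)) (b : V -> W).
Hypotheses (Sm : metric_complex S) (Tm : metric_complex T).
Hypotheses (Sdim : forall s, S s -> (#|` s| <= mS)%N) (Tdim : forall s, T s -> (#|` s| <= mT)%N).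
Hypothesis fT : set_fun (realization S) (realization T) f.
Hypothesis f_coarse : coarse_embedding (realization S) (dist S) (dist T) f.
Hypothesis b_carrier : forall v, S [fset v]%fset ->
  exists t, [/\ T t, in_simplex t (f (vertex_point R v)) & b v \in t].

Let Ssim : simplicial_complex S. Proof. by case: Sm. Qed.
Let Tsim : simplicial_complex T. Proof. by case: Tm. Qed.

Lemma dist_ge0 (x y : V -> R) : 0 <= dist S x y.
Proof.
rewrite /dist; have [[l ln]|no] := pselect (exists l, broken_line S x y l).
  by apply: lb_le_inf => [|l' /broken_line_ge0//]; exists l.
by rewrite inf_out // => -[[l ln] _]; apply: no; exists l.
Qed.

Lemma vertex_realization s v : S s -> v \in s -> realization S (vertex_point R v).
Proof. by move=> Ss vs; exists s => //; exact: vertex_in_simplex. Qed.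

(** Unboundedness of the lower control function bounds the distance of points by that of their
    images; both ends are translated between lengths and edge paths. *)
Lemma coarse_proper r : exists r', forall u v, S [fset u]%fset -> S [fset v]%fset ->
  near T r (b u) (b v) -> near S r' u v.
Proof.
have [rho1 [rho2 [[mono1 unb1] _ fd]]] := f_coarse.
(* The images are at distance at most [r + 2]; one more makes [rho1 a] exceed it strictly. *)
have [a a0 ra] := unb1 ((r + 2)%:R + 1).
have [N HN] := dist_near a Sm Sdim; exists N => u v Su Sv uv.
have [tu [Tu fu bu]] := b_carrier Su; have [tv [Tv fv bv]] := b_carrier Sv.
have us : u \in [fset u]%fset by rewrite inE.
have vs : v \in [fset v]%fset by rewrite inE.
have [_ dT] := near_dist Tsim uv Tu Tv bu bv fu fv.
apply: (HN _ _ _ _ _ _ Su Sv us vs (vertex_in_simplex R us) (vertex_in_simplex R vs)).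
rewrite leNgt; apply/negP => /ltW lt; have := mono1 _ _ a0 lt.
have [le1 _] := fd _ _ (vertex_realization Su us) (vertex_realization Sv vs).
have h : rho1 a <= (r + 2)%:R -> False.
  by move=> h; have := le_trans ra h; rewrite gerDl ler10.
by move=> /le_trans /(_ le1) /le_trans /(_ dT).
Qed.

(** Stated for all points of a simplex and all carriers of their images, since [approximates]
    compares with the image of the whole simplex and [f] may be discontinuous. *)
Lemma coarse_lipschitz : exists A, forall s x t u v, S s -> in_simplex s x -> T t ->
  in_simplex t (f x) -> u \in s -> v \in t -> near T A (b u) v.
Proof.
have [rho1 [rho2 [_ [mono2 _] fd]]] := f_coarse.
(* The two points share a simplex: an edge path with 0 steps bounds their distance by [0 + 2]. *)
have [N HN] := dist_near (rho2 (0 + 2)%:R) Tm Tdim; exists N => s x t u v Ss sx Tt tx us vt.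
have Su := simplex_vertex Ssim Ss us; have [tu [Tu fu bu]] := b_carrier Su.
apply: (HN _ _ _ _ _ _ Tu Tt bu vt fu tx).
have [_ le2] := fd _ _ (vertex_realization Ss us) (ex_intro2 _ _ s Ss sx : realization S x).
apply: le_trans le2 (mono2 _ _ (dist_ge0 _ _) _).
have [_] := near_dist Ssim (near_refl S u) Ss Ss us us (vertex_in_simplex R us) sx.
by [].
Qed.

Lemma coarse_lipschitz_vertex : exists A, forall s u v, S s -> u \in s -> v \in s ->
  near T A (b u) (b v).
Proof.
have [A HA] := coarse_lipschitz; exists A => s u v Ss us vs.
have [t [Tt ft bt]] := b_carrier (simplex_vertex Ssim Ss vs).
exact: HA Ss (vertex_in_simplex R vs) Tt ft us bt.
Qed.

Lemma b_vertex v : S [fset v]%fset -> T [fset b v]%fset.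
Proof. by move=> /b_carrier[t [Tt _ bt]]; exact: simplex_vertex Tt bt. Qed.

Lemma point_carrier s x : S s -> in_simplex s x -> exists t, [/\ T t, in_simplex t (f x) &
  exists v, v \in t].
Proof.
move=> Ss sx; have [t Tt tx] := fT (ex_intro2 _ _ s Ss sx : realization S x).
by exists t; split=> //; exact: simplex_pick Tt.
Qed.

Section Approximation.
Variable fs : cochain V -> cochain W.

Lemma support_faces s t : graded_hom S T id fs -> S s -> Defs.support fs (faces s) t ->
  exists s' t', [/\ S s', (s' `<=` s)%fset, fs (simplex_chain s') t' != 0, T t' & (t `<=` t')%fset].
Proof.
move=> fsG Ss st; have [_ FS] := faces_subcomplex Ssim Ss.
have [s' [t' [[s'0 ss] ft Tt tt]]] := support_spec fsG FS st.
by exists s', t'; split=> //; exact: simplex_face Ss ss s'0.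
Qed.

Lemma fs_nonzero v : {in chains S 0, forall c, augmentation (fs c) = augmentation c} ->
  S [fset v]%fset -> exists t, fs (simplex_chain [fset v]%fset) t != 0.
Proof.
move=> aug Sv; have v1 : simplex_chain [fset v]%fset \in chains S 0.
  by apply: simplex_chains => //; rewrite cardfs1.
have : augmentation (fs (simplex_chain [fset v]%fset)) != 0.
  by rewrite (aug _ v1) augmentationE evaluation_simplex oner_eq0.
by rewrite augmentationE => /evaluation_neq0[t [_ ft]]; exists t.
Qed.

Lemma approximates_near : approximates T S f fs -> exists M, forall s v t w,
  S s -> v \in s -> fs (simplex_chain s) t != 0 -> w \in t -> near T M (b v) w.
Proof.
move=> [fsG _ _ [M0 HM]]; have [N HN] := dist_near M0 Tm Tdim.
have [A HA] := coarse_lipschitz; exists (N + A)%N => s v t w Ss vs ft wt.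
have Tt : T t := fs_mem fsG Ss ft.
have [H1 _] := HM s Ss; have [] := H1 (vertex_point R w).
  exists t; last exact: vertex_in_simplex.
  split; first exact: simplex_neq0 Tt.
  exists (#|` s|%:Z - 1), (simplex_chain s), t; split=> //.
  by apply: simplex_in; split=> //; exact: simplex_neq0 Ss.
move=> q [x sx <-] dq; have [t' [Tt' tx' [u ut']]] := point_carrier Ss sx.
apply: near_trans (HA _ _ _ _ _ Ss sx Tt' tx' vs ut') _; apply: near_sym => //.
exact: HN _ _ _ _ _ _ Tt Tt' wt ut' (vertex_in_simplex R wt) tx' dq.
Qed.

Lemma near_approximates : graded_hom S T id fs ->
  (forall i, {in chains S i, forall c, boundary T (fs c) = fs (boundary S c)}) ->
  {in chains S 0, forall c, augmentation (fs c) = augmentation c} ->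
  (exists M, forall s v t w,
    S s -> v \in s -> fs (simplex_chain s) t != 0 -> w \in t -> near T M (b v) w) ->
  approximates T S f fs.
Proof.
move=> fsG fsC aug [M HM]; have [A HA] := coarse_lipschitz; split=> //.
exists (A + M + 2)%:R => s Ss; split=> [x [t st tx]|q [x sx <-]].
  have [s' [t' [Ss' ss ft Tt' tt]]] := support_faces fsG Ss st.
  have [v vs'] := simplex_pick Ssim Ss'; have vs := fsubsetP ss v vs'.
  have Tt : T t by case: st => t0 _; exact: simplex_face Tt' tt t0.
  have [w wt] := simplex_pick Tsim Tt.
  have bw := HM s' v t' w Ss' vs' ft (fsubsetP tt w wt).
  have [u [Tu fu bu]] := b_carrier (simplex_vertex Ssim Ss vs).
  exists (f (vertex_point R v)); first by exists (vertex_point R v) => //; exact: vertex_in_simplex.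
  have [_] := near_dist Tsim (near_sym Tsim bw) Tt Tu wt bu tx fu.
  by move=> /le_trans; apply; rewrite ler_nat; lia.
have [v vs] := simplex_pick Ssim Ss; have Sv := simplex_vertex Ssim Ss vs.
have [t ft] := fs_nonzero aug Sv; have Tt : T t := fs_mem fsG Sv ft.
have [w wt] := simplex_pick Tsim Tt.
have bw := HM _ v t w Sv (fset11 v) ft wt.
have [t' [Tt' tx' [u ut']]] := point_carrier Ss sx.
have bu := HA _ _ _ _ _ Ss sx Tt' tx' vs ut'.
exists (vertex_point R w).
  exists t; last exact: vertex_in_simplex.
  split; first exact: simplex_neq0 Tt.
  exists 0, (simplex_chain [fset v]%fset), t; split=> //.
  apply: simplex_chains; rewrite ?cardfs1 //; split; last by rewrite fsub1set.
  exact: simplex_neq0 Sv.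
have [_] := near_dist Tsim (near_trans (near_sym Tsim bw) bu) Tt Tt' wt ut' (vertex_in_simplex R wt) tx'.
by move=> /le_trans; apply; rewrite ler_nat; lia.
Qed.

End Approximation.

Section Neighborhoods.
Variables (fs : cochain V -> cochain W) (M : nat) (Z : set {fset V}).
Hypothesis fsG : graded_hom S T id fs.
Hypothesis aug : {in chains S 0, forall c, augmentation (fs c) = augmentation c}.
Hypothesis fs_near : forall s v t w, S s -> v \in s -> fs (simplex_chain s) t != 0 ->
  w \in t -> near T M (b v) w.
Hypotheses (Zsim : simplicial_complex Z) (ZS : Z `<=` S).

Lemma star_is_nbhd r : is_nbhd T (f @` realization Z) (star_nbhd T r (Defs.support fs Z)).
Proof.
have KT := support_subcomplex Tsim fsG ZS.
have NT := subcomplex_nbhd Tsim r KT; split=> //.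
exists (r + M + 2)%:R => x [t Nt tx]; have [_ NTs] := NT; have Tt := NTs _ Nt.
have [w wt] := simplex_pick Tsim Tt.
have /star_nbhd_vertex[u uK uw] := subcomplex_face NT Nt wt.
have [v [Zv vu]] := support_near fsG fs_near Zsim ZS uK (fset11 u).
have [tv [Tv fv bv]] := b_carrier (ZS Zv).
exists (f (vertex_point R v)).
  by exists (vertex_point R v) => //; exists [fset v]%fset => //; apply: vertex_in_simplex; rewrite inE.
exact: (proj2 (near_dist Tsim (near_sym Tsim (near_trans vu uw)) Tt Tv wt bv tx fv)).
Qed.

(** Preservation of the augmentation gives every vertex of [Z] a nonzero image, so the support has a
    simplex within [M] of each [b v]; points near [f Z] are therefore near the support. *)
Lemma nbhd_cofinal L : is_nbhd T (f @` realization Z) L ->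
  exists r, L `<=` star_nbhd T r (Defs.support fs Z).
Proof.
have KT := support_subcomplex Tsim fsG ZS.
move=> [[Lsim LT] [r0 Lr]]; have [N HN] := dist_near r0 Tm Tdim.
have [A HA] := coarse_lipschitz; exists (N + (A + M)).+1 => t Lt.
have Tt := LT _ Lt; have [w wt] := simplex_pick Tsim Tt.
have [q [x [s Zs sx] <-] dq] := Lr (vertex_point R w) (ex_intro2 _ _ t Lt (vertex_in_simplex R wt)).
have Ss := ZS Zs; have [t' [Tt' tx' [u ut']]] := point_carrier Ss sx.
have [v vs] := simplex_pick Ssim Ss; have Sv := simplex_vertex Ssim Ss vs.
have [t2 ft2] := fs_nonzero aug Sv; have Tt2 : T t2 := fs_mem fsG Sv ft2.
have [w2 w2t] := simplex_pick Tsim Tt2.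
have bw2 := fs_near Sv (fset11 v) ft2 w2t.
have bu := HA _ _ _ _ _ Ss sx Tt' tx' vs ut'.
have wu := HN _ _ _ _ _ _ Tt Tt' wt ut' (vertex_in_simplex R wt) tx' dq.
have Zv := simplex_vertex Zsim Zs vs.
have K2 : Defs.support fs Z t2 := support_in Tsim fsG ZS Zv ft2.
apply: (star_nbhd_next Tt wt); apply/star_nbhd_vertex.
exists w2; first exact: subcomplex_face KT K2 w2t.
exact: near_trans (near_trans (near_sym Tsim bw2) bu) (near_sym Tsim wu).
Qed.

End Neighborhoods.

End CoarseMaps.

(** * Exact sequences and the stages of the limit *)

Section CohomologySequence.
Variables (d : Order.disp_t) (V : orderType d) (Z0 Z1 : set {fset V}).
Hypotheses (Z0sim : simplicial_complex Z0) (Z1sim : simplicial_complex Z1).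
Hypotheses (Z10 : Z1 `<=` Z0) (Z0lf : locally_finite Z0).
Implicit Types (c : cochain V) (k : int) (s : {fset V}).

Lemma restriction_coboundary c : c fset0 = 0 ->
  coboundary Z1 (restriction Z1 c) = restriction Z1 (coboundary Z0 c).
Proof.
move=> c0; apply: funext => s; rewrite /restriction /coboundary.
case: asboolP => // Z1s; rewrite asboolT; last exact: Z10.
apply: eq_big_seq => v vs; congr (_ * _); have [sv|sv] := eqVneq (s `\ v)%fset fset0.
  by rewrite sv c0; case: asboolP.
by rewrite asboolT //; exact: simplex_face Z1s (fsubD1set _ _) sv.
Qed.

Lemma restriction_at S c s : S s -> restriction S c s = c s.
Proof. by move=> Ss; rewrite /restriction asboolT. Qed.

Lemma chains_set0 k c : (c \in chains (Z0 `\` set0) k) = (c \in chains Z0 k).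
Proof. by rewrite setD0. Qed.

Lemma chainsDP k c : c \in chains (Z0 `\` Z1) k -> c \in chains Z0 k /\ forall s, Z1 s -> c s = 0.
Proof.
move=> cZ; split; first by apply: chains_sub cZ => s [].
by move=> s Z1s; apply: (chains_out cZ) => -[].
Qed.

Lemma restriction_chains1 k c : c \in chains Z0 k -> restriction Z1 c \in chains Z1 k.
Proof. by move=> /(chains_restriction Z1); apply: chains_sub => s []. Qed.

Lemma sub_restriction k c : c \in chains Z0 k -> c - restriction Z1 c \in chains (Z0 `\` Z1) k.
Proof.
move=> cZ; apply: chainsD.
  by rewrite rpredB //; exact: chains_sub Z10 _ (restriction_chains1 cZ).
move=> s Z1s; rewrite [LHS](_ : _ = c s - restriction Z1 c s) //.
by rewrite restriction_at // subrr.
Qed.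

Lemma from_relative_respects k : respects (relative_cocycles Z0 Z1 k)
  (relative_coboundaries Z0 Z1 k) (relative_cocycles Z0 set0 k) (relative_coboundaries Z0 set0 k) id.
Proof.
split=> // [c /andP[/chainsDP[cZ _] cc]|c _ /asboolP[e /chainsDP[eZ _] ->]].
  by apply/andP; rewrite chains_set0.
by apply/asboolP; exists e; rewrite ?chains_set0.
Qed.

Lemma restriction_respects k : respects (relative_cocycles Z0 set0 k)
  (relative_coboundaries Z0 set0 k) (relative_cocycles Z1 set0 k)
  (relative_coboundaries Z1 set0 k) (restriction Z1).
Proof.
split=> [x y _ _|c /andP[]|c _ /asboolP[e]]; first exact: restrictionB.
- rewrite chains_set0 => cZ /eqP cc; apply/andP; split.
    by rewrite setD0; exact: restriction_chains1.
  rewrite (restriction_coboundary (chains0 Z0sim cZ)) cc.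
  by apply/eqP; apply: funext => s; rewrite /restriction; case: asboolP.
- rewrite chains_set0 => eZ ->; apply/asboolP; exists (restriction Z1 e).
    by rewrite setD0; exact: restriction_chains1.
  by rewrite (restriction_coboundary (chains0 Z0sim eZ)).
Qed.

(** A cochain of [Z1], seen on [Z0], is its own extension by zero. So [coboundary Z0] induces the
    usual connecting homomorphism, with a canonical lift. *)
Lemma coconnecting_respects k : respects (relative_cocycles Z1 set0 k)
  (relative_coboundaries Z1 set0 k) (relative_cocycles Z0 Z1 (k + 1))
  (relative_coboundaries Z0 Z1 (k + 1)) (coboundary Z0).
Proof.
split=> [x y _ _|c /andP[]|c _ /asboolP[e]]; first exact: coboundaryB.
- rewrite setD0 => cZ1 /eqP cc; have cZ := chains_sub Z10 cZ1.
  apply/andP; split; last by rewrite (coboundary_coboundary Z0sim (chains0 Z0sim cZ)).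
  apply: chainsD; first exact: coboundary_chains.
  by move=> s Z1s; rewrite (coboundary_sub c (Z10 Z1s) Z1s) cc.
- rewrite setD0 => eZ1 ->; have eZ := chains_sub Z10 eZ1; apply/asboolP.
  have deZ := coboundary_chains Z0sim Z0lf eZ; rewrite subrK in deZ.
  (* The extension by zero of the coboundary of [e] on [Z1] is the restriction of [coboundary Z0 e];
     up to the cocycle [coboundary Z0 e] it equals this cochain, which vanishes on [Z1]. *)
  exists (- (coboundary Z0 e - restriction Z1 (coboundary Z0 e))).
    by rewrite addrK rpredN; exact: sub_restriction.
  rewrite opprB coboundaryB (coboundary_coboundary Z0sim (chains0 Z0sim eZ)) subr0.
  by rewrite -(restriction_coboundary (chains0 Z0sim eZ)) (restriction_chains eZ1).
Qed.

Lemma from_relative_cls k c : c \in relative_cocycles Z0 Z1 k ->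
  @from_relative _ V Z0 Z1 k (cls _ _ c) = cls _ _ c.
Proof. by move=> cZ; rewrite /from_relative (hmap_cls (from_relative_respects k)). Qed.

Lemma cohomology_restriction_cls k c : c \in relative_cocycles Z0 set0 k ->
  @cohomology_restriction _ V Z0 Z1 k (cls _ _ c) = cls _ _ (restriction Z1 c).
Proof. by move=> cZ; rewrite /cohomology_restriction (hmap_cls (restriction_respects k)). Qed.

Lemma coconnecting_cls k c : c \in relative_cocycles Z1 set0 k ->
  @coconnecting _ V Z0 Z1 k (cls _ _ c) = cls _ _ (coboundary Z0 c).
Proof. by move=> cZ; rewrite /coconnecting (hmap_cls (coconnecting_respects k)). Qed.

Lemma restriction_sub k c : c \in chains (Z0 `\` Z1) k -> restriction Z1 c = 0.
Proof.
move=> /chainsDP[_ c1]; apply: funext => s.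
by rewrite /restriction; case: asboolP => // /c1.
Qed.

Lemma exact_restriction k :
  exact_at (@from_relative _ V Z0 Z1 k) (@cohomology_restriction _ V Z0 Z1 k).
Proof.
move=> y; split=> [|[x <-]]; last first.
  have xZ := rep_cycle x; rewrite -(repK x); have [_ fZ _] := from_relative_respects k.
  have /andP[xD _] := xZ; rewrite from_relative_cls // cohomology_restriction_cls.
    by rewrite (restriction_sub xD) cls0.
  exact: fZ.
have cZ := rep_cycle y; rewrite -(repK y); move: (rep y) cZ => c cZ {y}.
have /andP[] := cZ; rewrite chains_set0 => c0 /eqP cc.
rewrite cohomology_restriction_cls //; have [_ rZ _] := restriction_respects k.
move=> /(cls_eq0 _ (rZ _ cZ))/asboolP[e]; rewrite setD0 => eZ1 E.
have eZ := chains_sub Z10 eZ1; have deZ := coboundary_chains Z0sim Z0lf eZ.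
rewrite subrK in deZ; have dZ : c - coboundary Z0 e \in relative_cocycles Z0 Z1 k.
  apply/andP; split; last first.
    by rewrite coboundaryB cc (coboundary_coboundary Z0sim (chains0 Z0sim eZ)) subrr.
  apply: chainsD; first by rewrite rpredB.
  move=> s Z1s; rewrite [LHS](_ : _ = c s - coboundary Z0 e s) //.
  by rewrite (coboundary_sub e (Z10 Z1s) Z1s) -E restriction_at // subrr.
exists (cls _ _ (c - coboundary Z0 e)); rewrite from_relative_cls //.
have [_ fZ _] := from_relative_respects k; apply: eq_cls => //; first exact: fZ.
apply/asboolP; exists (- e); first by rewrite setD0 rpredN.
by rewrite -[- e]sub0r coboundaryB coboundary0 sub0r addrAC subrr sub0r.
Qed.

Lemma exact_coconnecting k :
  exact_at (@cohomology_restriction _ V Z0 Z1 k) (@coconnecting _ V Z0 Z1 k).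
Proof.
move=> y; split=> [|[x <-]]; last first.
  have xZ := rep_cycle x; rewrite -(repK x); have [_ rZ _] := restriction_respects k.
  have /andP[] := xZ; rewrite chains_set0 => xC /eqP dx.
  rewrite cohomology_restriction_cls // coconnecting_cls; last exact: rZ.
  have [_ cZ _] := coconnecting_respects k; apply/(cls_eq0 _ (cZ _ (rZ _ xZ))).
  apply/asboolP; exists (- (rep x - restriction Z1 (rep x))).
    by rewrite addrK rpredN; exact: sub_restriction.
  by rewrite opprB coboundaryB dx subr0.
have cZ := rep_cycle y; rewrite -(repK y); move: (rep y) cZ => c cZ {y}.
have /andP[] := cZ; rewrite setD0 => c1 /eqP cc.
rewrite coconnecting_cls //; have [_ dZ _] := coconnecting_respects k.
move=> /(cls_eq0 _ (dZ _ cZ))/asboolP[e]; rewrite addrK => eD E.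
have [eZ e1] := chainsDP eD; have xZ : c - e \in relative_cocycles Z0 set0 k.
  apply/andP; split; last by rewrite coboundaryB E subrr.
  by rewrite chains_set0 rpredB //; exact: chains_sub Z10 _ c1.
exists (cls _ _ (c - e)); rewrite cohomology_restriction_cls //; congr cls.
by rewrite restrictionB (restriction_sub eD) subr0 (restriction_chains c1).
Qed.

Lemma exact_from_relative k :
  exact_at (@coconnecting _ V Z0 Z1 k) (@from_relative _ V Z0 Z1 (k + 1)).
Proof.
move=> y; split=> [|[x <-]]; last first.
  have xZ := rep_cycle x; rewrite -(repK x); have [_ cZ _] := coconnecting_respects k.
  have /andP[] := xZ; rewrite setD0 => xC _; rewrite coconnecting_cls // from_relative_cls.
    have [_ fZ _] := from_relative_respects (k + 1); apply/(cls_eq0 _ (fZ _ (cZ _ xZ))).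
    apply/asboolP; exists (rep x) => //.
    by rewrite addrK setD0; exact: chains_sub Z10 _ xC.
  exact: cZ.
have cZ := rep_cycle y; rewrite -(repK y); move: (rep y) cZ => c cZ {y}.
have /andP[cD /eqP cc] := cZ; have [c0 c1] := chainsDP cD.
rewrite from_relative_cls //; have [_ fZ _] := from_relative_respects (k + 1).
move=> /(cls_eq0 _ (fZ _ cZ))/asboolP[e]; rewrite chains_set0 addrK => eZ E.
have rZ : restriction Z1 e \in relative_cocycles Z1 set0 k.
  apply/andP; rewrite setD0; split; first exact: restriction_chains1.
  rewrite (restriction_coboundary (chains0 Z0sim eZ)) -E (restriction_sub cD) //.
exists (cls _ _ (restriction Z1 e)); rewrite coconnecting_cls //.
have [_ dZ _] := coconnecting_respects k; apply: eq_cls => //; first exact: dZ.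
apply/asboolP; exists (- (e - restriction Z1 e)).
  by rewrite addrK rpredN; exact: sub_restriction.
by rewrite opprB coboundaryB E.
Qed.

End CohomologySequence.

(** * The connecting isomorphism for subcomplexes of an acyclic complex *)

Section Connecting.
Variables (d : Order.disp_t) (W : orderType d) (X : set {fset W}).
Hypotheses (Xsim : simplicial_complex X).
Implicit Types (Y : set {fset W}) (c : cochain W) (i : int).

Definition reduced_acyclic := forall j y, y \in chains (augmented X) j -> boundary setT y = 0 ->
  exists2 x, x \in chains (augmented X) (j + 1) & boundary setT x = y.

(** By connectedness the finitely many simplices of a cycle lie in a single ball. *)
Lemma comb_acyclic_reduced : connected_complex X -> comb_acyclic X -> reduced_acyclic.
Proof.
move=> conn Xacyc j y yX y0; have [[v0 Xv0] _] := conn.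
have /choice[rad radP] : forall s, exists r, X s -> ball X v0 r s.
  move=> s; have [Xs|nX] := pselect (X s); last by exists 0.
  have [v vs] := simplex_pick Xsim Xs.
  have [r nr] := connected_near Xsim conn Xv0 (simplex_vertex Xsim Xs vs).
  by exists r.+1 => _; exact: near_ball Xs vs nr.
have [F yF] := finsupp_seq (chains_finsupp yX).
pose r := (\max_(s <- F) rad s)%N; have [r' fill] := Xacyc j r.
have yb : y \in chains (augmented (ball X v0 r)) j.
  apply: (chains_in yX) => s [Xs|->] ys; [left|by right].
  apply: (ball_leq Xsim Xv0 _ (radP s Xs)); apply: leq_bigmax_seq => //.
  by apply/negPn/negP => /yF /eqP; apply/negP.
have [x xb xy] := fill _ Xv0 y yb y0; exists x => //; apply: chains_sub xb.
by apply: augmented_sub; have [_] := subcomplex_ball Xsim r' Xv0.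
Qed.

Section Pair.
Variable Y : set {fset W}.
Hypotheses (Ysim : simplicial_complex Y) (YX : Y `<=` X).

Lemma connecting_respects i : respects (relative_cycles X Y i) (relative_boundaries X Y i)
  (relative_cycles (augmented Y) set0 (i - 1)) (relative_boundaries (augmented Y) set0 (i - 1))
  (boundary (augmented X)).
Proof.
split=> [x y /andP[xX _] /andP[yX _]|c /andP[cX cY]|c _ /asboolP[e [a [eX aY ->]]]].
- exact: (boundaryB_chains _ xX yX).
- have cX' := chains_augmented cX; rewrite (boundary_augmented Xsim cX').
  have dcY : boundary setT c \in chains (augmented Y) (i - 1).
    apply: (chains_in (chains_boundary Xsim cX')) => s [Xs|->] cs; [left|by right].
    by apply: (chains_mem cY); rewrite boundaryE restriction_at.
  apply/andP; split=> //; rewrite (boundary_augmented Ysim dcY) (boundaryTT (chainsT cX)).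
  exact: rpred0.
- have aX := chains_sub YX aY; have dX := boundary_chains eX; rewrite addrK in dX.
  rewrite (morphD (@boundaryB_chains _ _ (augmented X) X i)) //.
  apply/asboolP; exists a, 0; split; rewrite ?rpred0 //.
    by rewrite subrK; exact: chains_augmented.
  rewrite addr0 (boundary_augmented Xsim (chains_augmented aX)).
  rewrite (boundary_augmented Ysim (chains_augmented aY)).
  rewrite (boundary_augmented Xsim (chains_augmented dX)).
  have [i0|i0] := eqVneq (i + 1) 0.
    by rewrite i0 in eX; rewrite (boundary_zero Xsim eX) boundary0 add0r.
  by rewrite (boundary_pos Xsim i0 eX) (boundaryTT (chainsT eX)) add0r.
Qed.

Lemma connecting_cls i c : c \in relative_cycles X Y i ->
  @connecting _ W X Y i (cls _ _ c) = cls _ _ (boundary setT c).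
Proof.
move=> cZ; rewrite /connecting (hmap_cls (connecting_respects i)) //.
by have /andP[cX _] := cZ; rewrite (boundary_augmented Xsim (chains_augmented cX)).
Qed.

Lemma connectingB i : zmod_morphism (@connecting _ W X Y i).
Proof. exact: respects_zmod (connecting_respects i). Qed.

Lemma connecting_injective i : reduced_acyclic -> injective (@connecting _ W X Y i).
Proof.
move=> acyc x y xy; apply/eqP; rewrite -subr_eq0; apply/eqP; move: xy => /eqP.
rewrite -subr_eq0 -connectingB => /eqP; move: (x - y) => {x y} u.
have cZ := rep_cycle u; rewrite -(repK u); move: (rep u) cZ => c cZ {u}.
rewrite connecting_cls //; have /andP[cX cY] := cZ; have [_ dZ _] := connecting_respects i.
have := dZ c cZ; rewrite (boundary_augmented Xsim (chains_augmented cX)) => dcZ.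
move=> /(cls_eq0 _ dcZ)/asboolP[a [a0 [aY a00 E]]]; rewrite subrK in aY.
have a0E : a0 = 0.
  by apply: funext => s; exact: (chains_out a00).
move: E; rewrite a0E addr0 (boundary_augmented Ysim aY) => E.
apply/cls_eq0 => //; apply/asboolP.
have [i0|i0] := ltP i 0.
  exists 0, 0; rewrite !rpred0; split=> //.
  by rewrite (chains_neg1 Xsim i0 cX) boundary0 addr0.
have aX := chains_sub (augmented_sub YX) aY.
have [|e eX Ee] := acyc i (c - a) (rpredB (chains_augmented cX) aX).
  by rewrite (boundaryB_chains _ (chainsT cX) (chainsT aY)) E subrr.
exists e, a; split.
- by apply: chains_unaugmented eX; lia.
- by apply: chains_unaugmented aY; lia.
have aY' : a \in chains Y i by apply: chains_unaugmented aY; lia.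
rewrite boundaryE Ee (restriction_chains (i := i)) ?subrK //.
by rewrite rpredB //; exact: chains_sub YX _ aY'.
Qed.

Lemma connecting_surjective i y : reduced_acyclic -> exists u, @connecting _ W X Y i u = y.
Proof.
move=> acyc; have yZ := rep_cycle y; rewrite -(repK y); move: (rep y) yZ => c cZ {y}.
have /andP[cY dc] := cZ; have c0 : boundary setT c = 0.
  rewrite -(boundary_augmented Ysim cY); apply: funext => s.
  exact: (chains_out dc).
(* Here [c] has degree -2 and vanishes. In all other degrees the filling [e] does not involve the
   empty simplex. *)
have [i1|i1] := eqVneq i (-1).
  exists 0; have := @connectingB i 0 0; rewrite !subrr => ->.
  rewrite (_ : c = 0) ?cls0 //; apply: funext => s.
  by apply/eqP/negPn/negP => cs; have := chains_card cY cs; rewrite i1.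
have [e eX E] := acyc _ _ (chains_sub (augmented_sub YX) cY) c0.
rewrite subrK in eX; have eX' := chains_unaugmented i1 eX.
have eZ : e \in relative_cycles X Y i.
  apply/andP; split=> //; rewrite boundaryE E.
  by apply: chains_sub (chains_restriction X cY) => s [[//|->]] /(proj1 Xsim).
by exists (cls _ _ e); rewrite connecting_cls // E.
Qed.

End Pair.
End Connecting.

(** * The duality map at one stage *)

Section Stage.
Variables (R : realType) (d d' : Order.disp_t) (V : orderType d) (W : orderType d').
Variables (X : set {fset W}) (n E0 : nat) (pbar p : cochain W -> cochain W).
Hypothesis PD : coarse_PD R X n pbar p E0.
Variables (Z0 Z1 : set {fset V}) (fs : cochain V -> cochain W).
Hypotheses (Z0sim : simplicial_complex Z0) (Z10 : Z1 `<=` Z0).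
Hypothesis fsG : graded_hom Z0 X id fs.
Hypothesis fsC : forall i, {in chains Z0 i, forall c, boundary X (fs c) = fs (boundary Z0 c)}.
Hypothesis fs_finite : forall t, X t -> finite_set [set s | Z0 s /\ fs (simplex_chain s) t != 0].

Let Xsim : simplicial_complex X. Proof. by case: (PD_metric PD). Qed.
Let pbarG := PD_pbar PD.

Let K0 := Defs.support fs Z0.
Let K1 := Defs.support fs Z1.
Let K0X : subcomplex K0 X. Proof. exact: (support_subcomplex Xsim fsG (@subset_refl _ Z0)). Qed.
Let K1X : subcomplex K1 X. Proof. exact: (support_subcomplex Xsim fsG Z10). Qed.
Let N r K := star_nbhd X r K.
Let Y r K := complement X (N (r + E0.+1) K).

(** [E0] is the displacement of [pbar]; the additional star is lost to the faces that [complement]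
    adds. *)
Lemma pbar_vanish K r i c t : subcomplex K X -> c \in chains (Y r K) i -> N r K t -> pbar c t = 0.
Proof.
move=> KX cY Nt; apply/eqP/negPn/negP => pt.
have cX : c \in chains X i by apply: chains_sub cY => s; exact: complement_subset.
have YX : {subset chains (Y r K) i <= chains X i}.
  by apply: chains_sub => s; exact: complement_subset.
have pB : {in chains (Y r K) i &, {morph pbar : a b / a - b}}.
  by move=> a b /YX aX /YX bX; exact: (proj2 (pbarG i)).
have [s [Ys _ _ pst]] := chain_support pB cY pt.
move: Ys; rewrite /Y /N addnS => /(complement_far Xsim)[Xs nK].
have Xt := graded_mem pbarG Xs pst; have [v vt] := simplex_pick Xsim Xt.
have [u us uv] := star_nbhd_faces Xsim Xs (PD_pbar_displacement PD Xs pst) vt.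
apply: (nK u us); rewrite addnC; apply: star_nbhd_near (near_sym Xsim uv).
exact: subcomplex_face (subcomplex_nbhd Xsim r KX) Nt vt.
Qed.

Lemma pbar_respects r i k : i + k = n%:Z -> respects (relative_cycles (Y r K1) (Y r K0) i)
  (relative_boundaries (Y r K1) (Y r K0) i) (relative_cocycles (N r K0) (N r K1) k)
  (relative_coboundaries (N r K0) (N r K1) k) (restriction (N r K0) \o pbar).
Proof.
move=> ik; have YX K j : {subset chains (Y r K) j <= chains X j}.
  by apply: chains_sub => s; exact: complement_subset.
have N0X : subcomplex (N r K0) X by exact: subcomplex_nbhd.
have [N0sim N0s] := N0X.
have pbX j l x : x \in chains X j -> j + l = n%:Z -> pbar x \in chains X l.
  by move=> xX jl; have := proj1 (pbarG j) _ xX; rewrite -jl addrC addKr.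
have pbN j l x : x \in chains (Y r K1) j -> j + l = n%:Z ->
    restriction (N r K0) (pbar x) \in chains (N r K0 `\` N r K1) l.
  move=> xY jl; apply: chainsD.
    by apply: (restriction_chains1 (Z0 := X)); apply: pbX jl; exact: YX xY.
  by move=> s N1s; rewrite /restriction; case: asboolP => // _; exact: (pbar_vanish K1X xY N1s).
have cob j l x : x \in chains (Y r K1) j -> j + l = n%:Z ->
    coboundary (N r K0) (restriction (N r K0) (pbar x)) = restriction (N r K0) (pbar (boundary X x)).
  move=> xY jl; have xX := YX _ _ _ xY.
  rewrite (restriction_coboundary N0sim N0s (chains0 Xsim (pbX _ _ _ xX jl))).
  by rewrite (PD_pbar_chain PD xX).
split=> [x z /andP[xY _] /andP[zY _]|c /andP[cY dcY]|c _ /asboolP[e [a [eY aY ->]]]] /=.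
- by rewrite (proj2 (pbarG i) x z (YX _ _ _ xY) (YX _ _ _ zY)) restrictionB.
- apply/andP; split; first exact: pbN cY ik.
  rewrite (cob _ _ _ cY ik); apply/eqP; apply: funext => s.
  rewrite /restriction; case: asboolP => // Ns; move: dcY.
  by rewrite (boundary_complement Xsim cY) => dcY; exact: (pbar_vanish K0X dcY Ns).
- have ik' : i + 1 + (k - 1) = n%:Z by rewrite addrACA subrr addr0.
  have eX := YX _ _ _ eY; have aX := YX _ _ _ aY.
  apply/asboolP; exists (restriction (N r K0) (pbar e)); first exact: pbN eY ik'.
  rewrite (cob _ _ _ eY ik') (boundary_complement Xsim eY).
  have dX := boundary_chains eX; rewrite addrK in dX.
  rewrite (morphD (proj2 (pbarG i))) //; apply: funext => s.
  rewrite /restriction; case: asboolP => // Ns.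
  rewrite [LHS](_ : _ = pbar (boundary X e) s + pbar a s) //.
  by rewrite (pbar_vanish K0X aY Ns) addr0.
Qed.

Lemma dual_respects r k : respects (relative_cocycles (N r K0) (N r K1) k)
  (relative_coboundaries (N r K0) (N r K1) k) (relative_cocycles Z0 Z1 k)
  (relative_coboundaries Z0 Z1 k) (dual_map Z0 fs).
Proof.
have N0X : subcomplex (N r K0) X by exact: subcomplex_nbhd.
have [N0sim N0s] := N0X.
have fsN : graded_hom Z0 (N r K0) id fs := fs_graded PD fsG r.
have dC phi j : phi \in chains (N r K0 `\` N r K1) j -> dual_map Z0 fs phi \in chains (Z0 `\` Z1) j.
  move=> phiN; have phi0 : phi \in chains (N r K0) j by apply: chains_sub phiN => s [].
  apply: chainsD.
    by apply: (dual_map_chains fsN) phi0 => // t /N0s; exact: fs_finite.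
  move=> s Z1s; rewrite dual_mapE; last exact: Z10.
  apply: evaluation_eq0 => t ft; apply: (chains_out phiN) => -[_]; apply.
  by apply: (star_nbhd_leq Xsim K1X (leq0n r)); exact: (support_in Xsim fsG Z10 Z1s ft).
have fsNC i : {in chains Z0 i, forall c, boundary (N r K0) (fs c) = fs (boundary Z0 c)}.
  by move=> c cZ; exact: (fs_chain PD fsG fsC r cZ).
split=> [x z /andP[xN _] /andP[zN _]|c /andP[cN /eqP cc]|c _ /asboolP[e eN ->]].
- by rewrite (dual_mapB _ _ fsN).
- apply/andP; split; first exact: dC.
  have c0 : c \in chains (N r K0) k by apply: chains_sub cN => s [].
  by rewrite -(dual_chain_map Z0sim N0sim fsN fsNC (chains0 N0sim c0)) cc dual_map_zero.
- have e0 : e \in chains (N r K0) (k - 1) by apply: chains_sub eN => s [].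
  apply/asboolP; exists (dual_map Z0 fs e); first exact: dC.
  exact: (dual_chain_map Z0sim N0sim fsN fsNC (chains0 N0sim e0)).
Qed.

Definition stage r i k (u : homology (Y r K1) (Y r K0) i) : compact_cohomology Z0 Z1 k :=
  dual_induced fs Z0 Z1 (pbar_induced pbar (N r K0) (N r K1) k u).

(** The restriction to [N r K0] disappears under [dual_map], since [fs] takes its values there; the
    formula that remains does not contain [r]. *)
Lemma stage_cls r i k c : i + k = n%:Z -> c \in relative_cycles (Y r K1) (Y r K0) i ->
  dual_map Z0 fs (pbar c) \in relative_cocycles Z0 Z1 k /\
  @stage r i k (cls _ _ c) = cls _ _ (dual_map Z0 fs (pbar c)).
Proof.
move=> ik cZ; have [pB pZ pN] := pbar_respects r ik; have [_ dZ _] := dual_respects r k.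
have E : dual_map Z0 fs ((restriction (N r K0) \o pbar) c) = dual_map Z0 fs (pbar c).
  apply: funext => s; have [Zs|nZ] := pselect (Z0 s); last first.
    by rewrite !dual_map_out.
  rewrite !dual_mapE //; apply: eq_evaluation => t ft; rewrite /= restriction_at //.
  exact: chains_mem (proj1 (fs_graded PD fsG r _) _ (simplex_in Zs)) ft.
split; first by rewrite -E; apply: dZ; exact: pZ.
rewrite /stage /dual_induced /pbar_induced (hmap_cls (pbar_respects r ik)) //.
by rewrite (hmap_cls (dual_respects r k)) ?E //; exact: pZ.
Qed.

Lemma stageB r i k : i + k = n%:Z -> zmod_morphism (@stage r i k).
Proof.
move=> ik x y; rewrite /stage /dual_induced /pbar_induced.
by rewrite (respects_zmod (pbar_respects r ik)) (respects_zmod (dual_respects r k)).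
Qed.

End Stage.

(** * Duality on the limits *)

Lemma additive_limit_map (S : inverse_system) (B : zmodType) (i : S) (a : {additive term i -> B}) :
  zmod_morphism (fun x : limit S => a (component x i)).
Proof. by move=> x y; rewrite -raddfB. Qed.

Section Nbhds.
Variables (R : realType) (d : Order.disp_t) (W : orderType d) (X : set {fset W}).
Implicit Types (A : set (W -> R)).

(** The duality maps refer to a neighbourhood by its underlying set; proof irrelevance identifies it
    with the stage used in the construction. *)
Lemma nbhd_eq A (L L' : nbhd X A) : L = L' :> set _ -> L = L'.
Proof.
case: L L' => [L P] [L' P'] /= E; move: P P'; rewrite E => P P'.
by congr Nbhd; exact: Prop_irrelevance.
Qed.

Lemma nbhd_pair_eq A0 A1 (L L' : nbhd_pair X A0 A1) :
  outer L = outer L' :> set _ -> inner L = inner L' :> set _ -> L = L'.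
Proof.
case: L L' => [O I s] [O' I' s'] /= /nbhd_eq EO /nbhd_eq EI; move: s s'; rewrite EO EI => s s'.
by congr NbhdPair; exact: Prop_irrelevance.
Qed.

End Nbhds.

Section ComplementInclusions.
Variables (d : Order.disp_t) (W : orderType d) (X : set {fset W}).
Hypothesis Xsim : simplicial_complex X.
Implicit Types (L : set {fset W}) (c : cochain W) (i : int).

Lemma reduced_inclusion_respects L L' i : L `<=` L' ->
  respects (relative_cycles (augmented (complement X L')) set0 i)
    (relative_boundaries (augmented (complement X L')) set0 i)
    (relative_cycles (augmented (complement X L)) set0 i)
    (relative_boundaries (augmented (complement X L)) set0 i) id.
Proof.
move=> LL; apply: inclusion_respects => //; first exact/augmented_sub/complement_sub.
by apply: augmented_face_closed; [case; rewrite eqxx | exact: complement_face_closed].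
Qed.

Lemma reduced_inclusion_cls L L' i c : L `<=` L' ->
  c \in relative_cycles (augmented (complement X L')) set0 i ->
  @reduced_inclusion _ W (complement X L') (complement X L) i (cls _ _ c) = cls _ _ c.
Proof.
by move=> LL cZ; rewrite /reduced_inclusion (hmap_cls (reduced_inclusion_respects i LL)).
Qed.

Lemma relative_inclusion_respects L0 L1 L0' L1' i : L0 `<=` L0' -> L1 `<=` L1' ->
  respects (relative_cycles (complement X L1') (complement X L0') i)
    (relative_boundaries (complement X L1') (complement X L0') i)
    (relative_cycles (complement X L1) (complement X L0) i)
    (relative_boundaries (complement X L1) (complement X L0) i) id.
Proof.
move=> LL0 LL1; apply: inclusion_respects; first exact: complement_sub.
  exact: complement_face_closed.
exact: complement_sub.
Qed.

Lemma relative_inclusion_cls L0 L1 L0' L1' i c : L0 `<=` L0' -> L1 `<=` L1' ->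
  c \in relative_cycles (complement X L1') (complement X L0') i ->
  @homology_inclusion _ W (complement X L1') (complement X L0')
    (complement X L1) (complement X L0) i (cls _ _ c) = cls _ _ c.
Proof.
move=> LL0 LL1 cZ.
by rewrite /homology_inclusion (hmap_cls (relative_inclusion_respects i LL0 LL1)).
Qed.

End ComplementInclusions.

Section AbsoluteDuality.
Variables (R : realType) (d d' : Order.disp_t) (V : orderType d) (W : orderType d').
Variables (X : set {fset W}) (A : set (W -> R)) (K : set {fset W}) (n e : nat).
Hypotheses (Xsim : simplicial_complex X) (Xacyc : reduced_acyclic X) (KX : subcomplex K X).
Hypothesis star_nbhdP : forall r, is_nbhd X A (star_nbhd X r K).
Hypothesis cofinal : forall L, is_nbhd X A L -> exists r, L `<=` star_nbhd X r K.
Variables (Z : set {fset V}) (D : cochain W -> cochain V).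
Let Y r := complement X (star_nbhd X r K).
Variable stage0 : forall r i k, homology X (Y (r + e)) i -> compact_cohomology Z set0 k.
Hypothesis stage0B : forall r i k, i + k = n%:Z -> zmod_morphism (@stage0 r i k).
Hypothesis stage0P : forall r i k c, i + k = n%:Z -> c \in relative_cycles X (Y (r + e)) i ->
  D c \in relative_cocycles Z set0 k /\ @stage0 r i k (cls _ _ c) = cls _ _ (D c).
Hypothesis surj : forall r k phi, phi \in relative_cocycles Z set0 k ->
  exists2 c, c \in relative_cycles X (Y r) (n%:Z - k) & D c - phi \in relative_coboundaries Z set0 k.
Hypothesis inj : forall r k, exists2 r', (r <= r')%N & forall c,
  c \in relative_cycles X (Y r') (n%:Z - k) -> D c \in relative_coboundaries Z set0 k ->
  c \in relative_boundaries X (Y r) (n%:Z - k).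

Variables (i k : int).
Hypothesis ik : i + k = n%:Z.

Let iE : i = n%:Z - k. Proof. by rewrite -ik addrK. Qed.

Let stage_nbhd r : nbhd X A := Nbhd (star_nbhdP (r + e)).

Let YX r : Y r `<=` X. Proof. exact: complement_subset. Qed.
Let Ysim r : simplicial_complex (Y r). Proof. exact: complement_simplicial. Qed.

Let lift r (y : reduced_homology (Y (r + e)) (i - 1)) : homology X (Y (r + e)) i :=
  projT1 (cid (connecting_surjective Xsim (@Ysim (r + e)) (@YX (r + e)) y Xacyc)).

Let liftK r (y : reduced_homology (Y (r + e)) (i - 1)) : connecting (lift y) = y.
Proof. by rewrite /lift; case: cid. Qed.

Let lift_connecting r (u : homology X (Y (r + e)) i) : lift (connecting u) = u.
Proof. by apply: (connecting_injective Xsim (@Ysim (r + e)) (@YX (r + e)) Xacyc); exact: liftK. Qed.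

Let stage_fun r (y : reduced_homology (Y (r + e)) (i - 1)) : compact_cohomology Z set0 k :=
  @stage0 r i k (lift y).

Let stage_funB r : zmod_morphism (@stage_fun r).
Proof.
move=> x y; rewrite /stage_fun -(stage0B ik); congr stage0.
apply: (connecting_injective Xsim (@Ysim (r + e)) (@YX (r + e)) Xacyc).
by rewrite liftK (connectingB Xsim (@Ysim (r + e)) (@YX (r + e))) !liftK.
Qed.

Let stage_fun_cls r c : c \in relative_cycles X (Y (r + e)) i ->
  @stage_fun r (cls _ _ (boundary setT c)) = cls _ _ (D c).
Proof.
move=> cZ; rewrite /stage_fun.
rewrite -(connecting_cls Xsim (@Ysim (r + e)) (@YX (r + e)) cZ) lift_connecting.
exact: (proj2 (stage0P ik cZ)).
Qed.

Let relative_rep r (y : reduced_homology (Y (r + e)) (i - 1)) : exists c,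
  c \in relative_cycles X (Y (r + e)) i /\ y = cls _ _ (boundary setT c).
Proof.
have uZ := rep_cycle (lift y); exists (rep (lift y)); split=> //.
rewrite -(connecting_cls Xsim (@Ysim (r + e)) (@YX (r + e)) uZ) repK liftK //.
Qed.

Let dcycle r c : c \in relative_cycles X (Y r) i ->
  boundary setT c \in relative_cycles (augmented (Y r)) set0 (i - 1).
Proof.
move=> cZ; have [_ h _] := connecting_respects Xsim (@Ysim r) (@YX r) i.
have := h c cZ; have /andP[cX _] := cZ.
by rewrite (boundary_augmented Xsim (chains_augmented cX)).
Qed.

Lemma relative_cycles_leq r r' c : (r <= r')%N ->
  c \in relative_cycles X (Y r') i -> c \in relative_cycles X (Y r) i.
Proof.
move=> rr /andP[cX cY]; apply/andP; split=> //; apply: chains_sub cY.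
by apply: complement_sub; exact: star_nbhd_leq.
Qed.

(** Every reduced class of a complement is the boundary of a relative cycle of [X], which turns the
    absolute case into a relative one. The last clause evaluates [a] on such a cycle at any stage;
    the squares are checked through it. *)
Lemma absolute_duality : exists a : {additive deleted_homology X A (i - 1) -> compact_cohomology Z set0 k},
  bijective a /\ forall x r (L : nbhd X A) c, L = star_nbhd X (r + e) K :> set _ ->
    c \in relative_cycles X (complement X L) i ->
    reduced_component x L = cls _ _ (boundary setT c) ->
    D c \in relative_cocycles Z set0 k /\ a x = cls _ _ (D c).
Proof.
pose S := reduced_system X A (i - 1).
pose a r : {additive term (stage_nbhd r : S) -> compact_cohomology Z set0 k} :=
  additive_of (@stage_funB r).
have le_tr (I J L : S) : index_le I J -> index_le J L -> index_le I L by exact: subset_trans.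
have bond_cls (I J : S) (IJ : index_le I J) c :
    c \in relative_cycles (augmented (complement X J)) set0 (i - 1) ->
    bond IJ (cls _ _ c) = cls _ _ c by exact: reduced_inclusion_cls.
have bond_comp (I J L : S) (IJ : index_le I J) (JL : index_le J L) (IL : index_le I L) x :
    bond IJ (bond JL x) = bond IL x.
  have xZ := rep_cycle x; rewrite -(repK x) !bond_cls //.
  by have [_ h _] := reduced_inclusion_respects X (i - 1) JL; exact: h.
have L_le r r' : (r <= r')%N -> index_le (stage_nbhd r : S) (stage_nbhd r').
  by move=> rr; apply: star_nbhd_leq => //; rewrite leq_add2r.
have L_cof (I : S) : exists r, index_le I (stage_nbhd r).
  have [r Ir] := cofinal (nbhdP I); exists r; apply: subset_trans Ir _.
  by apply: star_nbhd_leq => //; exact: leq_addr.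
have bond_rep r r' (le : index_le (stage_nbhd r : S) (stage_nbhd r')) c : (r <= r')%N ->
    c \in relative_cycles X (Y (r' + e)) i ->
    bond le (cls _ _ (boundary setT c)) = cls _ _ (boundary setT c).
  by move=> rr cZ; apply: bond_cls; exact: dcycle.
have a_bond r r' (le : index_le (stage_nbhd r : S) (stage_nbhd r')) x :
    (r <= r')%N -> a r (bond le x) = a r' x.
  move=> rr; have [c [cZ ->]] := relative_rep x; rewrite bond_rep //.
  rewrite [LHS](stage_fun_cls (r := r)) ?[RHS](stage_fun_cls (r := r')) //.
  by apply: relative_cycles_leq cZ; rewrite leq_add2r.
have a_surj r y : exists x, a r x = y.
  have yZ := rep_cycle y; have [c] := surj (r + e) yZ; rewrite -iE => cZ cD.
  exists (cls _ _ (boundary setT c)); rewrite [LHS](stage_fun_cls cZ) -[RHS]repK.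
  by apply: eq_cls cD => //; exact: (proj1 (stage0P ik cZ)).
have a_inj r : exists2 r', (r <= r')%N & forall (le : index_le (stage_nbhd r : S) (stage_nbhd r')) x,
    a r' x = 0 -> bond le x = 0.
  have [r' rr' kill] := inj (r + e) k; rewrite -iE in kill.
  exists r' => [|le x]; first exact: leq_trans (leq_addr _ _) rr'.
  have [c [cZ ->]] := relative_rep x; rewrite [X in X = 0 -> _](stage_fun_cls cZ).
  move=> /(cls_eq0 _ (proj1 (stage0P ik cZ))) Dc.
  have rle : (r <= r')%N := leq_trans (leq_addr _ _) rr'.
  have cB := kill c (relative_cycles_leq (leq_addr _ _) cZ) Dc.
  have cZr : c \in relative_cycles X (Y (r + e)) i.
    by apply: relative_cycles_leq cZ; rewrite leq_add2r.
  rewrite bond_rep //; have [_ _ h] := connecting_respects Xsim (@Ysim (r + e)) (@YX (r + e)) i.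
  apply/cls_eq0; first exact: dcycle.
  have := h c cZr cB; have /andP[cX _] := cZr.
  by rewrite (boundary_augmented Xsim (chains_augmented cX)).
exists (additive_of (additive_limit_map (a 0))); split.
  exact: (limit_map_bijective le_tr bond_comp L_le L_cof a_bond a_surj a_inj 0).
move=> x r L c LE cZ xc; have EL : L = stage_nbhd r by exact: nbhd_eq.
move: cZ xc; rewrite EL => cZ xc; split; first exact: (proj1 (stage0P ik cZ)).
rewrite [LHS](limit_map_const L_le a_bond x (leq0n r)) -(stage_fun_cls cZ).
by rewrite -xc.
Qed.

End AbsoluteDuality.

Section RelativeDuality.
Variables (R : realType) (d d' : Order.disp_t) (V : orderType d) (W : orderType d').
Variables (X : set {fset W}) (A0 A1 : set (W -> R)) (K0 K1 : set {fset W}) (n e : nat).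
Hypotheses (Xsim : simplicial_complex X) (K0X : subcomplex K0 X) (K1X : subcomplex K1 X).
Hypothesis K10 : K1 `<=` K0.
Hypothesis nbhd0 : forall r, is_nbhd X A0 (star_nbhd X r K0).
Hypothesis nbhd1 : forall r, is_nbhd X A1 (star_nbhd X r K1).
Hypothesis cofinal0 : forall L, is_nbhd X A0 L -> exists r, L `<=` star_nbhd X r K0.
Hypothesis cofinal1 : forall L, is_nbhd X A1 L -> exists r, L `<=` star_nbhd X r K1.
Variables (Z0 Z1 : set {fset V}) (D : cochain W -> cochain V).
Let Y r K := complement X (star_nbhd X r K).
Variable stage1 : forall r i k,
  homology (Y (r + e) K1) (Y (r + e) K0) i -> compact_cohomology Z0 Z1 k.
Hypothesis stage1B : forall r i k, i + k = n%:Z -> zmod_morphism (@stage1 r i k).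
Hypothesis stage1P : forall r i k c, i + k = n%:Z ->
  c \in relative_cycles (Y (r + e) K1) (Y (r + e) K0) i ->
  D c \in relative_cocycles Z0 Z1 k /\ @stage1 r i k (cls _ _ c) = cls _ _ (D c).
Hypothesis surj : forall r k phi, phi \in relative_cocycles Z0 Z1 k ->
  exists2 c, c \in relative_cycles (Y r K1) (Y r K0) (n%:Z - k) &
    D c - phi \in relative_coboundaries Z0 Z1 k.
Hypothesis inj : forall r k, exists2 r', (r <= r')%N & forall c,
  c \in relative_cycles (Y r' K1) (Y r' K0) (n%:Z - k) ->
  D c \in relative_coboundaries Z0 Z1 k ->
  c \in relative_boundaries (Y r K1) (Y r K0) (n%:Z - k).

Variables (i k : int).
Hypothesis ik : i + k = n%:Z.

Let iE : i = n%:Z - k. Proof. by rewrite -ik addrK. Qed.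

Let stage_pair r : nbhd_pair X A0 A1 :=
  @NbhdPair _ _ _ _ _ _ (Nbhd (nbhd0 (r + e))) (Nbhd (nbhd1 (r + e)))
    (star_nbhd_mono (@subset_refl _ X) K10).

Let cycles_leq r r' c : (r <= r')%N ->
  c \in relative_cycles (Y r' K1) (Y r' K0) i -> c \in relative_cycles (Y r K1) (Y r K0) i.
Proof.
move=> rr; have L0 := star_nbhd_leq Xsim K0X rr; have L1 := star_nbhd_leq Xsim K1X rr.
by have [_ h _] := relative_inclusion_respects X i L0 L1; exact: h.
Qed.

Lemma relative_duality : exists a :
    {additive relative_deleted_homology X A0 A1 i -> compact_cohomology Z0 Z1 k},
  bijective a /\ forall x r (L : nbhd_pair X A0 A1) c,
    outer L = star_nbhd X (r + e) K0 :> set _ -> inner L = star_nbhd X (r + e) K1 :> set _ ->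
    c \in relative_cycles (complement X (inner L)) (complement X (outer L)) i ->
    relative_component x L = cls _ _ c ->
    D c \in relative_cocycles Z0 Z1 k /\ a x = cls _ _ (D c).
Proof.
pose S := relative_system X A0 A1 i.
pose a r : {additive term (stage_pair r : S) -> compact_cohomology Z0 Z1 k} :=
  additive_of (stage1B (r := r) ik).
have le_tr (I J L : S) : index_le I J -> index_le J L -> index_le I L.
  by move=> [a0 a1] [b0 b1]; split; [exact: subset_trans a0 b0 | exact: subset_trans a1 b1].
have bond_cls (I J : S) (IJ : index_le I J) c :
    c \in relative_cycles (complement X (inner J)) (complement X (outer J)) i ->
    bond IJ (cls _ _ c) = cls _ _ c.
  by move=> cZ; exact: (relative_inclusion_cls (proj1 IJ) (proj2 IJ) cZ).
have bond_comp (I J L : S) (IJ : index_le I J) (JL : index_le J L) (IL : index_le I L) x :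
    bond IJ (bond JL x) = bond IL x.
  have xZ := rep_cycle x; rewrite -(repK x) !bond_cls //.
  by case: (JL) => JL0 JL1; have [_ h _] := relative_inclusion_respects X i JL0 JL1; exact: h.
have L_le r r' : (r <= r')%N -> index_le (stage_pair r : S) (stage_pair r').
  by move=> rr; split; apply: star_nbhd_leq => //; rewrite leq_add2r.
have L_cof (I : S) : exists r, index_le I (stage_pair r).
  have [r0 I0] := cofinal0 (nbhdP (outer I)); have [r1 I1] := cofinal1 (nbhdP (inner I)).
  exists (maxn r0 r1); split.
    by apply: subset_trans I0 _; apply: star_nbhd_leq => //; exact: leq_trans (leq_maxl _ _) (leq_addr _ _).
  by apply: subset_trans I1 _; apply: star_nbhd_leq => //; exact: leq_trans (leq_maxr _ _) (leq_addr _ _).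
have a_bond r r' (le : index_le (stage_pair r : S) (stage_pair r')) x :
    (r <= r')%N -> a r (bond le x) = a r' x.
  move=> rr; have xZ := rep_cycle x; rewrite -(repK x) bond_cls //.
  have xZr : rep x \in relative_cycles (Y (r + e) K1) (Y (r + e) K0) i.
    by apply: cycles_leq xZ; rewrite leq_add2r.
  by rewrite [LHS](proj2 (stage1P ik xZr)) [RHS](proj2 (stage1P ik xZ)).
have a_surj r y : exists x, a r x = y.
  have yZ := rep_cycle y; have [c] := surj (r + e) yZ; rewrite -iE => cZ cD.
  exists (cls _ _ c); rewrite [LHS](proj2 (stage1P ik cZ)) -[RHS]repK.
  by apply: eq_cls cD => //; exact: (proj1 (stage1P ik cZ)).
have a_inj r : exists2 r', (r <= r')%N & forall (le : index_le (stage_pair r : S) (stage_pair r')) x,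
    a r' x = 0 -> bond le x = 0.
  have [r' rr' kill] := inj (r + e) k; rewrite -iE in kill.
  have rle : (r <= r')%N := leq_trans (leq_addr _ _) rr'.
  exists r' => // le x; have cZ := rep_cycle x; rewrite -(repK x); move: (rep x) cZ => c cZ.
  rewrite [X in X = 0 -> _](proj2 (stage1P ik cZ)).
  move=> /(cls_eq0 _ (proj1 (stage1P ik cZ))) Dc.
  have cB := kill c (cycles_leq (leq_addr _ _) cZ) Dc.
  rewrite bond_cls //; apply/cls_eq0 => //.
  by apply: cycles_leq cZ; rewrite leq_add2r.
exists (additive_of (additive_limit_map (a 0))); split.
  exact: (limit_map_bijective le_tr bond_comp L_le L_cof a_bond a_surj a_inj 0).
move=> x r L c LE0 LE1 cZ xc; have EL : L = stage_pair r by exact: nbhd_pair_eq.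
move: cZ xc; rewrite EL => cZ xc; split; first exact: (proj1 (stage1P ik cZ)).
rewrite [LHS](limit_map_const L_le a_bond x (leq0n r)) -(proj2 (stage1P ik cZ)).
by rewrite -xc.
Qed.

End RelativeDuality.

(** * Coarse Alexander duality for subcomplexes of the source *)

Section CoarseAlexander.
Variables (R : realType) (d d' : Order.disp_t) (V : orderType d) (W : orderType d').
Variables (S : set {fset V}) (X : set {fset W}) (n E0 : nat) (pbar p : cochain W -> cochain W).
Variables (f : (V -> R) -> (W -> R)) (b : V -> W) (fs : cochain V -> cochain W).
Hypothesis PD : coarse_PD R X n pbar p E0.
Hypothesis Sm : metric_complex S.
Hypothesis fX : set_fun (realization S) (realization X) f.
Hypothesis f_coarse : coarse_embedding (realization S) (dist S) (dist X) f.
Hypothesis b_carrier : forall v, S [fset v]%fset ->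
  exists t, [/\ X t, in_simplex t (f (vertex_point R v)) & b v \in t].
Hypothesis fs_approx : approximates X S f fs.

Let Xsim : simplicial_complex X. Proof. by case: (PD_metric PD). Qed.
Let Ssim : simplicial_complex S. Proof. by case: Sm. Qed.
Let Xacyc : reduced_acyclic X.
Proof.
by apply: comb_acyclic_reduced; [|case: (PD_metric PD)|exact: PD_comb_acyclic PD].
Qed.

(** What duality on chains asks of either member of a pair, in a form that the empty complex
    satisfies. [data_proper] measures in [Z] itself, so for a proper subcomplex it includes that the
    inclusion is coarse. *)
Record subcomplex_data (Z : set {fset V}) : Prop := SubcomplexData {
  data_sim : simplicial_complex Z;
  data_sub : Z `<=` S;
  data_lf : locally_finite Z;
  data_dim : exists m : nat, forall s, Z s -> (#|` s| <= m)%N;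
  data_acyclic : comb_acyclic Z;
  data_proper : forall r, exists r', forall u v, Z [fset u]%fset -> Z [fset v]%fset ->
    near X r (b u) (b v) -> near Z r' u v }.

Lemma data_set0 : subcomplex_data set0.
Proof.
split=> //; first by split.
- by move=> v; rewrite (_ : [set _ | _] = set0) // -subset0 => s [].
- by exists 0.
- by move=> j r; exists 0.
- by move=> r; exists 0.
Qed.

Lemma fs_restrict Z : simplicial_complex Z -> Z `<=` S -> graded_hom Z X id fs /\
  forall i, {in chains Z i, forall c, boundary X (fs c) = fs (boundary Z c)}.
Proof.
move=> Zsim ZS; have [fsG fsC _ _] := fs_approx; split=> [i|i c cZ].
  split=> [c cZ|x y xZ yZ]; first exact: (proj1 (fsG i) _ (chains_sub ZS cZ)).
  exact: (proj2 (fsG i) _ _ (chains_sub ZS xZ) (chains_sub ZS yZ)).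
rewrite (fsC _ _ (chains_sub ZS cZ)); congr fs; apply: (boundary_sub ZS) (cZ).
move=> s t Zs St ts; apply: (simplex_face Zsim Zs ts); exact: (simplex_neq0 Ssim St).
Qed.

Lemma nonempty_complex : exists v : V, S [fset v]%fset.
Proof. by case: Sm => _ []. Qed.

Lemma finite_preimages Z : subcomplex_data Z ->
  forall t, X t -> finite_set [set s | Z s /\ fs (simplex_chain s) t != 0].
Proof.
move=> [Zsim ZS Zlf _ _ Zproper].
have [mX Xdim] := PD_dimension PD.
have [M fs_near] := approximates_near Sm (PD_metric PD) Xdim fX f_coarse b_carrier fs_approx.
by apply: (fs_finite PD Zsim Zlf Zproper (M := M)) => s v t w /ZS; exact: fs_near.
Qed.

Section Pair.
Variables (Z0 Z1 : set {fset V}).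
Hypotheses (data0 : subcomplex_data Z0) (data1 : subcomplex_data Z1) (Z10 : Z1 `<=` Z0).

Let K0 := Defs.support fs Z0.
Let K1 := Defs.support fs Z1.
Let Y r K := complement X (star_nbhd X r K).
Let D c := dual_map Z0 fs (pbar c).

Let fsG0 : graded_hom Z0 X id fs.
Proof. exact: (proj1 (fs_restrict (data_sim data0) (data_sub data0))). Qed.
Let fsC0 : forall i, {in chains Z0 i, forall c, boundary X (fs c) = fs (boundary Z0 c)}.
Proof. exact: (proj2 (fs_restrict (data_sim data0) (data_sub data0))). Qed.

Lemma pair_chain_duality :
  (forall r k phi, phi \in relative_cocycles Z0 Z1 k ->
    exists2 c, c \in relative_cycles (Y r K1) (Y r K0) (n%:Z - k) &
      D c - phi \in relative_coboundaries Z0 Z1 k) /\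
  (forall r k, exists2 r', (r <= r')%N & forall c,
    c \in relative_cycles (Y r' K1) (Y r' K0) (n%:Z - k) ->
    D c \in relative_coboundaries Z0 Z1 k ->
    c \in relative_boundaries (Y r K1) (Y r K0) (n%:Z - k)).
Proof.
have [Z0sim Z0S Z0lf [m Z0dim] Z0acyc Z0proper] := data0.
have [Z1sim _ _ _ Z1acyc Z1proper] := data1.
have [mX Xdim] := PD_dimension PD; have [v0 _] := nonempty_complex.
have [M fs_near] := approximates_near Sm (PD_metric PD) Xdim fX f_coarse b_carrier fs_approx.
have [A b_lip] := coarse_lipschitz_vertex Sm (PD_metric PD) Xdim f_coarse b_carrier.
have bX v : Z0 [fset v]%fset -> X [fset b v]%fset.
  by move=> Zv; exact: (b_vertex (PD_metric PD) b_carrier (Z0S _ Zv)).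
have b_lip0 s u v : Z0 s -> u \in s -> v \in s -> near X A (b u) (b v).
  by move=> /Z0S; exact: b_lip.
have fs_near0 s v t w : Z0 s -> v \in s -> fs (simplex_chain s) t != 0 -> w \in t ->
    near X M (b v) w by move=> /Z0S; exact: fs_near.
have aug0 : {in chains Z0 0, forall c, augmentation (fs c) = augmentation c}.
  by have [_ _ aug _] := fs_approx; move=> c /(chains_sub Z0S); exact: aug.
split=> [r k phi phiZ|r k].
  exact: (duality_surjective PD v0 Z0sim Z1sim Z10 Z0lf Z0dim Z0acyc Z1acyc bX b_lip0
    Z0proper Z1proper fsG0 fsC0 aug0 fs_near0 r phiZ).
exact: (duality_injective PD v0 Z0sim Z1sim Z10 Z0acyc Z1acyc bX b_lip0
    Z0proper Z1proper fsG0 fsC0 aug0 fs_near0 r k).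
Qed.

End Pair.

Lemma star_nbhd_data Z : subcomplex_data Z ->
  (forall r, is_nbhd X (f @` realization Z) (star_nbhd X r (Defs.support fs Z))) /\
  (forall L, is_nbhd X (f @` realization Z) L ->
     exists r, L `<=` star_nbhd X r (Defs.support fs Z)).
Proof.
move=> [Zsim ZS _ _ _ _]; have [fsG _ aug _] := fs_approx; have [mX Xdim] := PD_dimension PD.
have [M fs_near] := approximates_near Sm (PD_metric PD) Xdim fX f_coarse b_carrier fs_approx.
split=> [r|L LA].
  exact: (star_is_nbhd (PD_metric PD) b_carrier fsG fs_near Zsim ZS).
exact: (nbhd_cofinal Sm (PD_metric PD) Xdim fX f_coarse b_carrier fsG aug fs_near Zsim ZS LA).
Qed.

Lemma support_data Z : subcomplex_data Z -> subcomplex (Defs.support fs Z) X.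
Proof.
move=> dZ; have [fsG _ _ _] := fs_approx.
exact: (support_subcomplex Xsim fsG (data_sub dZ)).
Qed.

Lemma support_set0 : Defs.support fs set0 = set0.
Proof.
rewrite -subset0 => t tK; have [fsG _ _ _] := fs_approx.
by have [s [t' [h _ _ _]]] := support_spec fsG (@sub0set _ S) tK; case: h.
Qed.

Lemma support_mono Z0 Z1 : subcomplex_data Z0 -> Z1 `<=` Z0 ->
  Defs.support fs Z1 `<=` Defs.support fs Z0.
Proof.
move=> d0 Z10 t [t0 [i [c [s [cZ cs ts]]]]]; split=> //.
by exists i, c, s; split=> //; exact: chains_sub Z10 _ cZ.
Qed.

Lemma relative_alexander Z0 Z1 i k : subcomplex_data Z0 -> subcomplex_data Z1 -> Z1 `<=` Z0 ->
  i + k = n%:Z ->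
  exists a : {additive relative_deleted_homology X (f @` realization Z0) (f @` realization Z1) i ->
      compact_cohomology Z0 Z1 k},
  [/\ bijective a, is_relative_duality_map E0 pbar fs a &
    forall x r (L : nbhd_pair X (f @` realization Z0) (f @` realization Z1)) c,
    outer L = star_nbhd X (r + E0.+1) (Defs.support fs Z0) :> set _ ->
    inner L = star_nbhd X (r + E0.+1) (Defs.support fs Z1) :> set _ ->
    c \in relative_cycles (complement X (inner L)) (complement X (outer L)) i ->
    relative_component x L = cls _ _ c ->
    dual_map Z0 fs (pbar c) \in relative_cocycles Z0 Z1 k /\
    a x = cls _ _ (dual_map Z0 fs (pbar c))].
Proof.
move=> d0 d1 Z10 ik; have [surj inj] := pair_chain_duality d0 d1 Z10.
have [N0 cof0] := star_nbhd_data d0; have [N1 cof1] := star_nbhd_data d1.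
have [fsG0 fsC0] := fs_restrict (data_sim d0) (data_sub d0).
have fin0 := finite_preimages d0.
have SB := stageB PD (data_sim d0) Z10 fsG0 fsC0 fin0.
have SP := stage_cls PD (data_sim d0) Z10 fsG0 fsC0 fin0.
have K10 := support_mono d0 Z10.
have [a [abij aP]] := relative_duality Xsim (support_data d0) (support_data d1) K10
  N0 N1 cof0 cof1 SB SP surj inj ik.
exists a; split=> // x r r0.
pose L := @NbhdPair _ _ _ _ _ _ (Nbhd (N0 (r + E0.+1)%N)) (Nbhd (N1 (r + E0.+1)%N))
    (star_nbhd_mono (@subset_refl _ X) K10).
exists L; split=> //.
have cZ := rep_cycle (relative_component x L).
have xc : relative_component x L = cls _ _ (rep (relative_component x L)) by rewrite repK.
have [_ ->] := aP x r L _ erefl erefl cZ xc.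
by rewrite -(proj2 (SP r i k _ ik cZ)) repK.
Qed.

(** Duality for the pair with second member [set0]: the support of [set0] and its star
    neighbourhoods are empty, and the complement of the empty set is [X]. *)
Lemma absolute_alexander Z i k : subcomplex_data Z -> i + k = n%:Z ->
  exists a : {additive deleted_homology X (f @` realization Z) (i - 1) ->
      compact_cohomology Z set0 k},
  [/\ bijective a, is_duality_map E0 pbar fs a &
    forall x r (L : nbhd X (f @` realization Z)) c,
    L = star_nbhd X (r + E0.+1) (Defs.support fs Z) :> set _ ->
    c \in relative_cycles X (complement X L) i ->
    reduced_component x L = cls _ _ (boundary setT c) ->
    dual_map Z fs (pbar c) \in relative_cocycles Z set0 k /\
    a x = cls _ _ (dual_map Z fs (pbar c))].
Proof.
move=> d0 ik; have Z10 : set0 `<=` Z by [].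
have [] := pair_chain_duality d0 data_set0 Z10.
have [N0 cof0] := star_nbhd_data d0.
have [fsG0 fsC0] := fs_restrict (data_sim d0) (data_sub d0).
have fin0 := finite_preimages d0.
have := stageB PD (data_sim d0) Z10 fsG0 fsC0 fin0.
have := stage_cls PD (data_sim d0) Z10 fsG0 fsC0 fin0.
rewrite /stage support_set0.
have E r : complement X (star_nbhd X r set0) = X.
  by rewrite star_nbhd_set0 (complement_set0 Xsim).
move=> SP SB surj inj.
pose stage0 r i k (u : homology X (complement X (star_nbhd X (r + E0.+1) (Defs.support fs Z))) i) :
  compact_cohomology Z set0 k :=
  dual_induced fs Z set0 (pbar_induced pbar (star_nbhd X r (Defs.support fs Z)) set0 k u).
have SB0 r j l : j + l = n%:Z -> zmod_morphism (@stage0 r j l).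
  by have := SB r j l; rewrite E star_nbhd_set0.
have SP0 r j l c : j + l = n%:Z ->
    c \in relative_cycles X (complement X (star_nbhd X (r + E0.+1) (Defs.support fs Z))) j ->
    dual_map Z fs (pbar c) \in relative_cocycles Z set0 l /\
    @stage0 r j l (cls _ _ c) = cls _ _ (dual_map Z fs (pbar c)).
  by have := SP r j l c; rewrite E star_nbhd_set0.
have surj0 r l phi : phi \in relative_cocycles Z set0 l -> exists2 c,
    c \in relative_cycles X (complement X (star_nbhd X r (Defs.support fs Z))) (n%:Z - l) &
    dual_map Z fs (pbar c) - phi \in relative_coboundaries Z set0 l.
  by have := surj r l phi; rewrite E.
have inj0 r l : exists2 r', (r <= r')%N & forall c,
    c \in relative_cycles X (complement X (star_nbhd X r' (Defs.support fs Z))) (n%:Z - l) ->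
    dual_map Z fs (pbar c) \in relative_coboundaries Z set0 l ->
    c \in relative_boundaries X (complement X (star_nbhd X r (Defs.support fs Z))) (n%:Z - l).
  by have [r' rr' h] := inj r l; exists r' => // c; have := h c; rewrite !E.
have [a [abij aP]] := absolute_duality Xsim Xacyc (support_data d0) N0 cof0 SB0 SP0 surj0 inj0 ik.
exists a; split=> // x r r0; pose L := Nbhd (N0 (r + E0.+1)%N).
have [u uE] := connecting_surjective Xsim (@complement_simplicial _ _ X L)
  (@complement_subset _ _ X Xsim L) (reduced_component x L) Xacyc.
exists L, u; split=> //; have cZ := rep_cycle u.
have xc : reduced_component x L = cls _ _ (boundary setT (rep u)).
  rewrite -uE -{1}(repK u).
  exact: (connecting_cls Xsim (@complement_simplicial _ _ X L) (@complement_subset _ _ X Xsim L) cZ).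
have [_ ->] := aP x r L _ erefl cZ xc.
by rewrite -(proj2 (SP0 r i k _ ik cZ)) repK.
Qed.

End CoarseAlexander.

(** * The top row *)

Lemma exact_transfer (A B C A' B' C' : zmodType) (g : A -> B) (h : B -> C) (g' : A' -> B')
    (h' : B' -> C') (a : A -> A') (b : B -> B') (c : {additive C -> C'}) :
  bijective a -> bijective b -> bijective c ->
  (forall x, g' (a x) = b (g x)) -> (forall y, h' (b y) = c (h y)) ->
  exact_at g' h' -> exact_at g h.
Proof.
move=> [a' aK a'K] /bij_inj b_inj /bij_inj c_inj ga hb ex y; split=> [hy|[x <-]].
  have /ex[x' gx'] : h' (b y) = 0 by rewrite hb hy raddf0.
  by exists (a' x'); apply: b_inj; rewrite -ga a'K.
by apply: c_inj; rewrite -hb -ga raddf0; apply/ex; exists (a x).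
Qed.

Section ToRelative.
Variables (d : Order.disp_t) (W : orderType d) (S T : set {fset W}).
Hypothesis Ssim : simplicial_complex S.
Implicit Types (c : cochain W) (i : int).

Lemma restriction_augmented S' i c : S' `<=` S -> c \in chains (augmented S') i ->
  restriction S c = restriction S' c.
Proof.
move=> SS cS; apply: funext => s; rewrite /restriction.
case: (asboolP (S' s)) => [/SS Ss|nS']; first by rewrite asboolT.
case: asboolP => // Ss; apply: (chains_out cS) => -[//|s0].
by have [+ _] := Ssim; rewrite -s0.
Qed.

Lemma to_relative_respects i : respects (relative_cycles (augmented S) set0 i)
  (relative_boundaries (augmented S) set0 i) (relative_cycles S T i) (relative_boundaries S T i)
  (restriction S).
Proof.
split=> [x y _ _|c /andP[cS dc]|c /andP[cS _] /asboolP[e [a [eS a0 cE]]]]; first exact: restrictionB.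
- have rS := chains_cut Ssim cS; apply/andP; split=> //.
  (* In degree -1 a chain is a multiple of the empty simplex and restricts to zero; in other degrees
     the restriction does nothing. *)
  have [i1|i1] := eqVneq i (-1).
    by rewrite i1 in rS *; rewrite (chains_neg1 Ssim _ rS) // boundary0 rpred0.
  rewrite (restriction_chains (chains_unaugmented i1 cS)) boundaryE.
  rewrite -(boundary_augmented Ssim cS) (_ : boundary _ c = 0).
    by rewrite (_ : restriction S 0 = 0) ?rpred0 // -[X in restriction S X](subrr 0) restrictionB subrr.
  by apply: funext => s; exact: (chains_out dc).
- have rS := chains_cut Ssim cS; apply/asboolP; have [i1|i1] := eqVneq (i + 1) (-1).
    exists 0, 0; rewrite !rpred0 boundary0 addr0; split=> //.
    by apply: (chains_neg1 Ssim _ rS); move: i1; clear; lia.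
  exists e, 0; rewrite rpred0 addr0; split=> //; first exact: chains_unaugmented i1 eS.
  rewrite cE [boundary S e]boundaryE (boundary_augmented Ssim eS) (_ : a = 0) ?addr0 //.
  by apply: funext => s; exact: (chains_out a0).
Qed.

Lemma to_relative_cls i c : c \in relative_cycles (augmented S) set0 i ->
  @to_relative _ W S T i (cls _ _ c) = cls _ _ (restriction S c).
Proof. by move=> cZ; rewrite /to_relative (hmap_cls (to_relative_respects i)). Qed.

End ToRelative.

Section TopRow.
Variables (R : realType) (d : Order.disp_t) (W : orderType d) (X : set {fset W}).
Variables (A0 A1 : set (W -> R)).
Hypotheses (Xsim : simplicial_complex X) (A10 : A1 `<=` A0).
Implicit Types (i : int) (L : nbhd_pair X A0 A1).

Lemma is_nbhd_mono K : is_nbhd X A1 K -> is_nbhd X A0 K.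
Proof.
move=> [KX [r Kr]]; split=> //; exists r => x /Kr[a Aa xa].
by exists a => //; exact: A10.
Qed.

Lemma empty_is_nbhd : is_nbhd X A1 set0.
Proof. by split; [exact: set0_subcomplex | exists 0 => x []]. Qed.

Let promote (K : nbhd X A1) : nbhd X A0 := Nbhd (is_nbhd_mono (nbhdP K)).

(* The limit of the connecting maps is read off the pairs [(K, set0)]. *)
Let with_empty (K : nbhd X A0) : nbhd_pair X A0 A1 :=
  @NbhdPair _ _ _ _ _ _ K (Nbhd empty_is_nbhd) (@sub0set _ _).

Let conn_sub L : complement X (outer L) `<=` complement X (inner L).
Proof. exact: complement_sub (@inner_sub _ _ _ _ _ _ L). Qed.

Let conn_cls L i c : c \in relative_cycles (complement X (inner L)) (complement X (outer L)) i ->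
  connecting (cls _ _ c : homology (complement X (inner L)) (complement X (outer L)) i) =
  cls _ _ (boundary setT c).
Proof.
exact: (connecting_cls (complement_simplicial _ _) (complement_simplicial _ _) (conn_sub (L:=L))).
Qed.

Let conn_cycle L i c : c \in relative_cycles (complement X (inner L)) (complement X (outer L)) i ->
  boundary setT c \in relative_cycles (augmented (complement X (outer L))) set0 (i - 1).
Proof.
move=> cZ; have [_ h _] := connecting_respects (complement_simplicial X (inner L))
  (complement_simplicial X (outer L)) (conn_sub (L:=L)) i.
have := h c cZ; have /andP[cX _] := cZ.
by rewrite (boundary_augmented (complement_simplicial _ _) (chains_augmented cX)).
Qed.

Lemma connecting_natural i (x : relative_deleted_homology X A0 A1 i) L L' :
  outer L `<=` outer L' -> inner L `<=` inner L' ->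
  reduced_inclusion (complement X (outer L)) (connecting (relative_component x L')) =
  connecting (relative_component x L).
Proof.
move=> L0 L1; have cZ := rep_cycle (relative_component x L').
have <- : homology_inclusion _ _ (relative_component x L') = relative_component x L.
  exact: (component_bond x (conj L0 L1)).
rewrite -(repK (relative_component x L')) conn_cls // reduced_inclusion_cls //; last exact: conn_cycle.
rewrite relative_inclusion_cls // conn_cls //.
by have [_ h _] := relative_inclusion_respects X i L0 L1; exact: h.
Qed.

Section Degree.
Variable i : int.

Definition connecting_thread (x : relative_deleted_homology X A0 A1 i) :
    thread (reduced_system X A0 (i - 1)) :=
  fun K => connecting (relative_component x (with_empty K)).

Lemma connecting_thread_compatible x : connecting_thread x \in compatible (S := _).
Proof.
apply/asboolP => K K' KK.
exact: (@connecting_natural i x (with_empty K) (with_empty K') KK (@subset_refl _ _)).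
Qed.

Definition limit_connecting x : deleted_homology X A0 (i - 1) :=
  Limit (connecting_thread_compatible x).

Lemma limit_connectingB : zmod_morphism limit_connecting.
Proof.
move=> x y; apply: limit_eq => K.
rewrite [RHS](_ : _ = connecting_thread x K - connecting_thread y K) //.
rewrite -(connectingB (complement_simplicial _ _) (complement_simplicial _ _)) //.
exact: (@conn_sub (with_empty K)).
Qed.

(** A neighbourhood of the smaller set is one of the larger, with the same complement, so the map of
    limits is a reindexing. *)
Definition inclusion_thread (x : deleted_homology X A0 i) : thread (reduced_system X A1 i) :=
  fun K => reduced_component x (promote K).

Lemma inclusion_thread_compatible x : inclusion_thread x \in compatible (S := _).
Proof. by apply/asboolP => K K' KK; exact: (@component_bond _ x (promote K) (promote K') KK). Qed.

Definition limit_inclusion x : deleted_homology X A1 i := Limit (inclusion_thread_compatible x).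

Lemma limit_inclusionB : zmod_morphism limit_inclusion.
Proof. by move=> x y; apply: limit_eq. Qed.

Definition relative_thread (x : deleted_homology X A1 i) : thread (relative_system X A0 A1 i) :=
  fun L => to_relative (complement X (outer L)) (reduced_component x (inner L)).

Lemma relative_thread_compatible x : relative_thread x \in compatible (S := _).
Proof.
apply/asboolP => L L' [L0 L1]; rewrite /relative_thread.
have cZ := rep_cycle (reduced_component x (inner L')).
have <- : reduced_inclusion _ (reduced_component x (inner L')) = reduced_component x (inner L).
  exact: (component_bond x L1).
rewrite -(repK (reduced_component x (inner L'))) reduced_inclusion_cls //.
have [_ h _] := reduced_inclusion_respects X i L1.
rewrite !(to_relative_cls _ (complement_simplicial _ _)) //; last exact: h.
have [_ hr _] := to_relative_respects (complement X (outer L')) (complement_simplicial X (inner L')) i.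
rewrite [LHS](relative_inclusion_cls L0 L1); last exact: hr.
have /andP[cS _] := cZ.
by rewrite (restriction_augmented (complement_simplicial X (inner L)) (complement_sub L1) cS).
Qed.

Definition limit_relative x : relative_deleted_homology X A0 A1 i :=
  Limit (relative_thread_compatible x).

Lemma limit_relativeB : zmod_morphism limit_relative.
Proof.
move=> x y; apply: limit_eq => L.
exact: (respects_zmod (to_relative_respects (complement X (outer L))
  (complement_simplicial X (inner L)) i) (reduced_component x (inner L)) (reduced_component y (inner L))).
Qed.

End Degree.

(** The pairs [L] and [with_empty (outer L)] have the same outer member; naturality of the
    connecting map compares them. *)
Lemma limit_connecting_component i (x : relative_deleted_homology X A0 A1 i) L :
  reduced_component (limit_connecting x) (outer L) = connecting (relative_component x L).
Proof.
rewrite -[LHS]/(connecting (relative_component x (with_empty (outer L)))).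
rewrite -(@connecting_natural i x (with_empty (outer L)) L) //=.
have cZ := rep_cycle (connecting (relative_component x L)).
by rewrite -(repK (connecting (relative_component x L))) reduced_inclusion_cls.
Qed.

Lemma limit_inclusion_component i (x : deleted_homology X A0 i) L :
  reduced_component (limit_inclusion x) (inner L) =
    reduced_inclusion (complement X (inner L)) (reduced_component x (outer L)).
Proof.
symmetry.
exact: (@component_bond _ x (promote (inner L)) (outer L) (@inner_sub _ _ _ _ _ _ L)).
Qed.

Lemma limit_relative_component i (x : deleted_homology X A1 i) L :
  relative_component (limit_relative x) L =
    to_relative (complement X (outer L)) (reduced_component x (inner L)).
Proof. by []. Qed.

End TopRow.

(** * Existence of approximating chain maps *)

Section ExistenceOfApproximation.
Variables (R : realType) (d d' : Order.disp_t) (V : orderType d) (W : orderType d').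
Variables (S : set {fset V}) (X : set {fset W}) (m mX : nat).
Variables (f : (V -> R) -> (W -> R)) (b : V -> W).
Hypotheses (Sm : metric_complex S) (Xm : metric_complex X) (Xacyc : comb_acyclic X).
Hypotheses (Sdim : forall s, S s -> (#|` s| <= m)%N) (Xdim : forall s, X s -> (#|` s| <= mX)%N).
Hypothesis fX : set_fun (realization S) (realization X) f.
Hypothesis f_coarse : coarse_embedding (realization S) (dist S) (dist X) f.
Hypothesis b_carrier : forall v, S [fset v]%fset ->
  exists t, [/\ X t, in_simplex t (f (vertex_point R v)) & b v \in t].

(** Acyclic carriers over the vertex map [b], with empty distinguished subcomplexes. *)
Lemma approximation_exists : exists fs, approximates X S f fs.
Proof.
have [Ssim _ _] := Sm; have [Xsim _ _] := Xm.
have s0 (d1 : Order.disp_t) (U : orderType d1) : simplicial_complex (set0 : set {fset U}) by split.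
have acyc0 : comb_acyclic (set0 : set {fset W}) by move=> j ?; exists 0.
have [A b_lip] := coarse_lipschitz_vertex Sm Xm Xdim f_coarse b_carrier.
have tX s : target (set0 : set {fset V}) X set0 s = X by rewrite /target; case: asboolP.
have bn s u v : S s -> u \in s -> v \in s -> near (target set0 X set0 s) A (b u) (b v).
  by rewrite tX; exact: b_lip.
have bX v : S [fset v]%fset -> X [fset b v]%fset by exact: (b_vertex Xm b_carrier).
have [rho [fs [fsG fsC aug car]]] := chain_map_extension Ssim (s0 _ V) Xsim (s0 _ W)
  (@sub0set _ X) Sdim Xacyc acyc0 bX (fun v h => False_ind _ h) bn.
exists fs; apply: (near_approximates Sm Xm Xdim fX f_coarse b_carrier fsG fsC aug).
exists rho => s v t w Ss vs ft wt; have := car s v t Ss vs ft; rewrite tX => bt.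
exact: (ball_near Xsim (bX v (simplex_vertex Ssim Ss vs)) bt wt).
Qed.

End ExistenceOfApproximation.

(** * Assembling the diagram *)

Lemma indexed_choice (I J : Type) (T : I -> J -> Type) (P : forall i j, T i j -> Prop) :
  (forall i j, exists a, P i j a) -> exists F : forall i j, T i j, forall i j, P i j (F i j).
Proof.
move=> ex; exists (fun i j => projT1 (cid (ex i j))) => i j.
exact: (projT2 (cid (ex i j))).
Qed.

Unset Implicit Arguments.

Theorem theorem1p2 (R : realType) (dV dW : Order.disp_t)
    (V : orderType dV) (W : orderType dW)
    (Z0 Z1 : set {fset V}) (X : set {fset W}) (n E0 : nat)
    (pbar p : cochain W -> cochain W) (f : (V -> R) -> (W -> R)) :
  coarse_pair R Z0 Z1 ->
  bounded_geometry Z0 -> bounded_geometry Z1 ->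
  uniformly_acyclic R Z0 -> uniformly_acyclic R Z1 ->
  coarse_PD R X n pbar p E0 ->
  set_fun (realization Z0) (realization X) f ->
  coarse_embedding (realization Z0) (dist Z0) (dist X) f ->
  (exists fs, approximates X Z0 f fs) /\
  forall fs, approximates X Z0 f fs ->
  exists
    (dT : forall i, {additive
       relative_deleted_homology X (f @` realization Z0) (f @` realization Z1) i ->
       deleted_homology X (f @` realization Z0) (i - 1)})
    (iT : forall i, {additive
       deleted_homology X (f @` realization Z0) i ->
       deleted_homology X (f @` realization Z1) i})
    (jT : forall i, {additive
       deleted_homology X (f @` realization Z1) i ->
       relative_deleted_homology X (f @` realization Z0) (f @` realization Z1) i})
    (A01 : forall i k, {additive
       relative_deleted_homology X (f @` realization Z0) (f @` realization Z1) i ->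
       compact_cohomology Z0 Z1 k})
    (A0 : forall i k, {additive
       deleted_homology X (f @` realization Z0) (i - 1) -> compact_cohomology Z0 set0 k})
    (A1 : forall i k, {additive
       deleted_homology X (f @` realization Z1) (i - 1) -> compact_cohomology Z1 set0 k}),
    (* the top row is the limit of the reduced sequences of the pairs *)
    (forall i (L : nbhd_pair X (f @` realization Z0) (f @` realization Z1)),
      [/\ forall x, reduced_component (dT i x) (outer L) =
                    connecting (relative_component x L),
          forall x, reduced_component (iT i x) (inner L) =
                    reduced_inclusion (complement X (inner L))
                      (reduced_component x (outer L)) &
          forall x, relative_component (jT i x) L =
                    to_relative (complement X (outer L))
                      (reduced_component x (inner L))]) /\
    (* the rows are exact *)
    (forall i,
      [/\ exact_at (dT i) (iT (i - 1)), exact_at (iT i) (jT i) &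
          exact_at (jT i) (dT i)]) /\
    (forall k,
      [/\ exact_at (@from_relative _ V Z0 Z1 k) (@cohomology_restriction _ V Z0 Z1 k),
          exact_at (@cohomology_restriction _ V Z0 Z1 k) (@coconnecting _ V Z0 Z1 k) &
          exact_at (@coconnecting _ V Z0 Z1 k) (@from_relative _ V Z0 Z1 (k + 1))]) /\
    (forall i k, i + k = n%:Z ->
      (* the vertical maps are the duality maps, and are isomorphisms *)
      [/\ is_relative_duality_map E0 pbar fs (A01 i k),
          is_duality_map E0 pbar fs (A0 i k) &
          is_duality_map E0 pbar fs (A1 i k)] /\
      [/\ bijective (A01 i k), bijective (A0 i k) & bijective (A1 i k)] /\
      (* the squares commute *)
      [/\ forall x, from_relative (A01 i k x) = A0 i k (dT i x),
          forall x, cohomology_restriction Z1 (A0 i k x) = A1 i k (iT (i - 1) x) &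
          forall x, coconnecting Z0 (A1 i k x) = A01 (i - 1) (k + 1) (jT (i - 1) x)]).
Proof.
move=> [Z0m Z1m Z10 ce1] _ _ ua0 ua1 PD fX fce.
have [Z0ac [m0 dim0]] := comb_acyclicP Z0m ua0; have [Z1ac [m1 dim1]] := comb_acyclicP Z1m ua1.
have [Z0sim Z0conn Z0lf] := Z0m; have [Z1sim _ Z1lf] := Z1m.
have Xm := PD_metric PD; have [Xsim Xconn _] := Xm.
have Xac := PD_comb_acyclic PD; have [mX Xdim] := PD_dimension PD.
have Xacyc := comb_acyclic_reduced Xsim Xconn Xac.
(* [f] need not send vertices to vertices; [b v] is a vertex of some simplex that contains the image
   of [v]. *)
have /choice[b bP] : forall v, exists w, Z0 [fset v]%fset ->
    exists t, [/\ X t, in_simplex t (f (vertex_point R v)) & w \in t].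
  move=> v; have [Zv|nZ] := pselect (Z0 [fset v]%fset); last first.
    by have [[w _] _] := Xconn; exists w.
  have [t Xt ft] : realization X (f (vertex_point R v)).
    by apply: fX; exists [fset v]%fset => //; apply: vertex_in_simplex; rewrite inE.
  by have [w wt] := simplex_pick Xsim Xt; exists w => _; exists t.
split; first exact: approximation_exists Z0m Xm Xac dim0 Xdim fX fce bP.
move=> fs fsA; have [fsG fsC _ _] := fsA.
have proper0 := coarse_proper Z0m Xm dim0 fce bP.
have d0 : subcomplex_data Z0 X b Z0 by split=> //; exists m0.
have d1 : subcomplex_data Z0 X b Z1.
  split=> //; first by exists m1.
  (* The inclusion of [Z1] is treated as a coarse embedding with the identity as vertex map.
     Closeness in [X] then passes to [Z0] and from there to [Z1]. *)
  have carrier1 v : Z1 [fset v]%fset -> exists t : {fset V},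
      [/\ Z0 t, in_simplex t (id (vertex_point R v)) & id v \in t].
    move=> Zv; exists [fset v]%fset; split; rewrite ?inE //; first exact: Z10.
    by apply: vertex_in_simplex; rewrite inE.
  move=> r; have [r' h] := proper0 r; have [r'' h1] := coarse_proper Z1m Z0m dim1 ce1 carrier1 r'.
  by exists r'' => u v Zu Zv uv; apply: h1 => //; apply: h => //; exact: Z10.
have A10 : f @` realization Z1 `<=` f @` realization Z0.
  by apply: image_subset => x [s Zs xs]; exists s => //; exact: Z10.
have Yb j (L : set {fset W}) c : c \in chains (complement X L) j ->
    boundary (complement X L) c = boundary X c by exact: boundary_complement.
pose B0 := f @` realization Z0; pose B1 := f @` realization Z1.
pose dT i : {additive relative_deleted_homology X B0 B1 i -> deleted_homology X B0 (i - 1)} :=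
  additive_of (@limit_connectingB R _ W X B0 B1 i).
pose iT i : {additive deleted_homology X B0 i -> deleted_homology X B1 i} :=
  additive_of (@limit_inclusionB R _ W X B0 B1 A10 i).
pose jT i : {additive deleted_homology X B1 i -> relative_deleted_homology X B0 B1 i} :=
  additive_of (@limit_relativeB R _ W X B0 B1 i).
(* The vertical maps are indexed by all pairs [i], [k]; where [i + k] differs from [n] the zero map
   fills the place. *)
have null_additive (U U' : zmodType) : zmod_morphism (fun _ : U => 0 : U') by move=> x y; rewrite subr0.
have rel i k := relative_alexander PD Z0m fX fce bP fsA (i := i) (k := k) d0 d1 Z10.
have abs0 i k := absolute_alexander PD Z0m fX fce bP fsA (i := i) (k := k) d0.
have abs1 i k := absolute_alexander PD Z0m fX fce bP fsA (i := i) (k := k) d1.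
have null_or (U U' : zmodType) (P : {additive U -> U'} -> Prop) (Q : Prop) :
    (Q -> exists a, P a) -> exists a, Q -> P a.
  have [q|nq] := pselect Q; first by move=> /(_ q)[a Pa]; exists a.
  by move=> _; exists (additive_of (null_additive U U')).
have rel' i k := null_or _ _ _ _ (rel i k).
have abs0' i k := null_or _ _ _ _ (abs0 i k).
have abs1' i k := null_or _ _ _ _ (abs1 i k).
have [A01 A01P] := indexed_choice rel'; have [A0 A0P] := indexed_choice abs0'.
have [A1 A1P] := indexed_choice abs1'.
have [N0 _] := star_nbhd_data PD Z0m fX fce bP fsA d0.
have [N1 _] := star_nbhd_data PD Z0m fX fce bP fsA d1.
(* All squares are checked at this one stage, with [r = 0], because the vertical maps can be read
   off anywhere. *)
pose L := @NbhdPair _ _ _ _ _ _ (Nbhd (N0 (0 + E0.+1)%N)) (Nbhd (N1 (0 + E0.+1)%N))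
  (star_nbhd_mono (@subset_refl _ X) (support_mono (fs:=fs) d0 Z10)).
have Ysim K : simplicial_complex (complement X K) by exact: complement_simplicial.
have YX K : complement X K `<=` X by exact: complement_subset.
have absolute_rep i (K : set {fset W}) (y : reduced_homology (complement X K) (i - 1)) : exists c,
    c \in relative_cycles X (complement X K) i /\ y = cls _ _ (boundary setT c).
  have [u <-] := connecting_surjective Xsim (Ysim K) (YX K) y Xacyc.
  exists (rep u); split; first exact: rep_cycle.
  by rewrite -{1}(repK u) (connecting_cls Xsim (Ysim K) (YX K)) ?rep_cycle.
(* A chain representing [x] relative to the outer complement is also a relative cycle of [X], and
   its boundary represents [dT i x]; so both ways around have the same cochain. *)
have square1 i k (ik : i + k = n%:Z) x : from_relative (A01 i k x) = A0 i k (dT i x).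
  have [_ _ a01] := A01P i k ik; have [_ _ a0] := A0P i k ik.
  have cZ := rep_cycle (relative_component x L).
  have xc : relative_component x L = cls _ _ (rep (relative_component x L)) by rewrite repK.
  move: (rep _) cZ xc => c cZ xc; have [Dc E1] := a01 x 0 L c erefl erefl cZ xc.
  have /andP[cY dcY] := cZ.
  have cZ0 : c \in relative_cycles X (complement X (outer L)) i.
    by apply/andP; split; [exact: chains_sub (YX _) _ cY | rewrite -(Yb _ _ _ cY)].
  have [|_ E2] := a0 (dT i x) 0 (outer L) c erefl cZ0.
    rewrite [LHS](limit_connecting_component x L) xc.
    by rewrite (connecting_cls (Ysim _) (Ysim _) (complement_sub (@inner_sub _ _ _ _ _ _ L)) cZ).
  by rewrite [A01 i k x]E1 [A0 i k _]E2 from_relative_cls.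
have square2 i k (ik : i + k = n%:Z) x :
    cohomology_restriction Z1 (A0 i k x) = A1 i k (iT (i - 1) x).
  have [_ _ a0] := A0P i k ik; have [_ _ a1] := A1P i k ik.
  have [c [cZ xc]] := absolute_rep _ _ (reduced_component x (outer L)).
  have [Dc E1] := a0 x 0 (outer L) c erefl cZ xc; have /andP[cX cY] := cZ.
  have cZ1 : c \in relative_cycles X (complement X (inner L)) i.
    apply/andP; split=> //; apply: chains_sub cY; apply: complement_sub.
    exact: (@inner_sub _ _ _ _ _ _ L).
  have [_ h _] := connecting_respects Xsim (Ysim (outer L)) (YX (outer L)) i.
  have dcZ : boundary setT c \in relative_cycles (augmented (complement X (outer L))) set0 (i - 1).
    by have := h c cZ; rewrite (boundary_augmented Xsim (chains_augmented cX)).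
  have [|_ E2] := a1 (iT (i - 1) x) 0 (inner L) c erefl cZ1.
    rewrite [LHS](limit_inclusion_component A10 x L) xc reduced_inclusion_cls //.
    exact: (@inner_sub _ _ _ _ _ _ L).
  rewrite [A0 i k x]E1 [A1 i k _]E2 cohomology_restriction_cls //; congr cls.
  apply: funext => s; rewrite /restriction /dual_map.
  by case: asboolP => // /Z10 Zs; rewrite asboolT.
(* If the boundary of [c] represents [x], it also represents the image of [x] in relative homology,
   and its dual cochain is exactly the coboundary of that of [c], without a sign. *)
have square3 i k (ik : i + k = n%:Z) x :
    coconnecting Z0 (A1 i k x) = A01 (i - 1) (k + 1) (jT (i - 1) x).
  have ik' : i - 1 + (k + 1) = n%:Z by rewrite addrACA addNr addr0.
  have [_ _ a1] := A1P i k ik; have [_ _ a01] := A01P _ _ ik'.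
  have [c [cZ xc]] := absolute_rep _ _ (reduced_component x (inner L)).
  have [Dc E1] := a1 x 0 (inner L) c erefl cZ xc; have /andP[cX cY] := cZ.
  have [_ h _] := connecting_respects Xsim (Ysim (inner L)) (YX (inner L)) i.
  have dcZ : boundary setT c \in relative_cycles (augmented (complement X (inner L))) set0 (i - 1).
    by have := h c cZ; rewrite (boundary_augmented Xsim (chains_augmented cX)).
  have bcZ : boundary X c \in relative_cycles (complement X (inner L)) (complement X (outer L)) (i - 1).
    by apply/andP; split=> //; rewrite (Yb _ _ _ cY) (boundary_boundary Xsim cX) rpred0.
  have /andP[dcY _] := dcZ.
  have [|Dbc E2] := a01 (jT (i - 1) x) 0 L (boundary X c) erefl erefl bcZ.
    rewrite [LHS](limit_relative_component x L) xc (to_relative_cls _ (Ysim _) dcZ).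
    by rewrite [in RHS]boundaryE (restriction_augmented Xsim (YX _) dcY).
  rewrite [A1 i k x]E1 [A01 _ _ _]E2 (coconnecting_cls Z0sim Z1sim Z10 Z0lf Dc).
  have [_ hd _] := coconnecting_respects Z0sim Z1sim Z10 Z0lf k.
  apply: eq_cls => //; first exact: hd.
  have pbX : pbar c \in chains X k.
    by have := proj1 (PD_pbar PD i) _ cX; rewrite -ik addrC addKr.
  have DZ : dual_map Z0 fs (pbar c) \in chains Z0 k.
    by apply: (dual_map_chains fsG) pbX => //; exact: (finite_preimages PD Z0m fX fce bP fsA d0).
  rewrite -(PD_pbar_chain PD cX) (dual_chain_map Z0sim Xsim fsG fsC (chains0 Xsim pbX)).
  rewrite -coboundaryB; apply/asboolP.
  (* The connecting map takes the coboundary of the restriction to [Z1], extended by zero; the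
     difference from the full cochain vanishes on [Z1] and is an admissible primitive. *)
  exists (- (dual_map Z0 fs (pbar c) - restriction Z1 (dual_map Z0 fs (pbar c)))).
    by rewrite addrK rpredN; exact: sub_restriction.
  rewrite opprB; congr (coboundary _ (_ - _)).
  apply: funext => s; rewrite /restriction /dual_map.
  by case: asboolP => // /Z10 Zs; rewrite asboolT.
have bij i k (ik : i + k = n%:Z) :
    [/\ bijective (A01 i k), bijective (A0 i k) & bijective (A1 i k)].
  by have [? _ _] := A01P i k ik; have [? _ _] := A0P i k ik; have [? _ _] := A1P i k ik.
have degree i : i + (n%:Z - i) = n%:Z by rewrite addrC subrK.
have degree' i : i - 1 + (n%:Z - i + 1) = n%:Z by rewrite addrACA addNr addr0.
exists dT, iT, jT, A01, A0, A1; split; last split; last split.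
- move=> i M; split=> x.
  + exact: limit_connecting_component.
  + exact: limit_inclusion_component.
  + exact: limit_relative_component.
- have ex1 i : exact_at (dT i) (iT (i - 1)).
    have [b01 b0 b1] := bij _ _ (degree i).
    apply: (exact_transfer b01 b0 b1 (square1 _ _ (degree i)) (square2 _ _ (degree i))).
    exact: exact_restriction.
  have ex2 i : exact_at (iT (i - 1)) (jT (i - 1)).
    have [b01 b0 b1] := bij _ _ (degree i); have [b01' _ _] := bij _ _ (degree' i).
    apply: (exact_transfer b0 b1 b01' (square2 _ _ (degree i)) (square3 _ _ (degree i))).
    exact: exact_coconnecting.
  have ex3 i : exact_at (jT (i - 1)) (dT (i - 1)).
    have [b01 b0 b1] := bij _ _ (degree i); have [b01' b0' _] := bij _ _ (degree' i).
    apply: (exact_transfer b1 b01' b0' (square3 _ _ (degree i)) (square1 _ _ (degree' i))).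
    exact: exact_from_relative.
  (* The squares speak of degree [i - 1] in the last two positions; shifting the index reaches
     degree [i]. *)
  move=> i; split=> //.
    by have := ex2 (i + 1); rewrite addrK.
  by have := ex3 (i + 1); rewrite addrK.
- move=> k; split; [exact: exact_restriction | exact: exact_coconnecting | exact: exact_from_relative].
- move=> i k ik; split; last split; last by split=> x; [exact: square1 | exact: square2 | exact: square3].
    by have [_ ? _] := A01P i k ik; have [_ ? _] := A0P i k ik; have [_ ? _] := A1P i k ik.
  exact: bij.
Qed.
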